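(* Let $n \geq 2$ be an integer. Let $C \subset \mathbb{G}_m^n$ be an algebraic curve whose Zariski closure $\overline{C}$ in $\mathbb{A}^n$ is a line defined over a number field $K$. Suppose that $C$ contains the point $s_0 := (1,1,\dotsc,1)$, and that $C$ is not contained in a proper algebraic subgroup of $\mathbb{G}_m^n$. Then all points $s \in C(\overline{K}) \cap \Sigma_2$ satisfy \[ h(s) \leq c\, [K(s):\mathbb{Q}]^n \bigl( \log([K(s):\mathbb{Q}])+1 \bigr), \] where $c$ is given by an explicit formula in terms of $n$ and a suitable measure of the height of $C$, namely an upper bound $H$ for the quantity $H(\Xi)$ defined in the context. The explicit form of the bound is as follows. For every $s \in C(\overline{K}) \cap \Sigma_2$, let $\delta = \max\{1,\tau(K(s))\}$, where $\tau(K(s))$ is the number of complex places of $K(s)$ (so $\delta \leq \max\{1,\tfrac12[K(s):\mathbb{Q}]\}$), and let $x$ be the coordinate on $\overline C$ fixed in the context. Then: (i) for all $\delta \in \mathbb{Z}_{\geq 1}$, letting $\lambda = \binom{n+\delta}{\delta}$, \[ h(x(s)) < n \bigl( 8\lambda^3 - 3.8\lambda^2 \bigr) \bigl( \log(\delta) + 2 \bigr) (H+1); \] (ii) if $\delta \geq \tfrac{1}{4}(n+2)$, then \[ h(x(s)) < 8n\, A(n)^2 B(n)\, \delta^n \bigl( \log(3\delta) + 2 \bigr)(H+1), \] where \[ A(n) = \begin{cases} \dfrac{2}{(4k+1)(4k)} \dbinom{5k+2}{4k-1} & \text{if } n=4k-1 \text{ with } k \in \mathbb{Z}_{\geq 1},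 \\[2ex] \dfrac{1}{4k+2} \dbinom{5k+3}{4k+1} & \text{if } n=4k+1 \text{ with } k \in \mathbb{Z}_{\geq 0}, \\[2ex] \tfrac{3}{2} A(n-1) & \text{if } n \text{ is even,} \end{cases} \qquad B(n) = \begin{cases} \dfrac{3^n}{n!} & \text{if } n \text{ is odd,} \\[2ex] \dfrac{5}{3}\cdot\dfrac{3^n}{n!} & \text{if } n \text{ is even.} \end{cases} \]
   Context: $\Sigma_2$ denotes the union of all algebraic subgroups of $\mathbb{G}_m^n$ of codimension at least $2$. The curve $C$ is closed in $\mathbb{G}_m^n$. $K(s)$ is the field generated over $K$ by the coordinates of $s$. For $s=(s_1,\dots,s_n)$, $h(s)$ is the absolute logarithmic Weil height $\sum_v \frac{[L_v:\mathbb{Q}_v]}{[L:\mathbb{Q}]}\log\max\{1,|s_1|_v,\dots,|s_n|_v\}$, where $L$ is any number field containing the coordinates of $s$, the sum is over all places $v$ of $L$, $|\cdot|_v$ extends the usual absolute value on $\mathbb{Q}$, and $\mathbb{Q}_v$ is the completion of $\mathbb{Q}$ at the place below $v$. For $\alpha \in \overline{\mathbb{Q}}$, $h(\alpha)$ is the absolute logarithmic Weil height of $\alpha$ (the case of one coordinate). Measure of the height of $C$: fix an isomorphism of algebraic curves $x \colon \overline{C} \to \mathbb{A}^1$ defined over $K$ with $x(s_0)=0$, let $\Xi = \{ x(s) : s \in \overline{C}(\overline{K}) \setminus C(\overline{K}) \}$, put $H(\Xi) = \sum_{\alpha\in\Xi} h(\alpha)$, and let $H$ be an upper bound for $H(\Xi)$.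 Concretely, $\overline C=\{(1+a_1t,\dots,1+a_nt)\}$ with $a_i\in K^\times$ and $t$ the coordinate $x$, so that $\Xi=\{-1/a_1,\dots,-1/a_n\}$ and $H(\Xi)=h(a_1)+\dots+h(a_n)$. The heights of $s$ and of $x(s)$ are related by $h(s) \leq h(x(s)) + H(\Xi) + \log 2$. *)

(* Defs.v *)
From mathcomp Require Import all_boot all_order all_algebra all_field finmap.
From mathcomp Require Import all_classical all_reals all_analysis.
From mathcomp Require Import -(notations) complex mpoly.
Set Implicit Arguments.
Unset Strict Implicit.
Unset Printing Implicit Defensive.
Import Order.TTheory GRing.Theory Num.Theory.
Local Open Scope classical_set_scope.
Local Open Scope ring_scope.

(* A number field is a [fieldExtType rat], and [algC] is the algebraic closure
   Kbar of every number field K given with an embedding [iota : K -> algC].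
   A point of A^n(Kbar) is a function ['I_n -> algC]. *)

Section Places.
Variable R : realType.

Definition is_abs_value (F : fieldType) (v : F -> R) : Prop :=
  [/\ forall x, 0 <= v x,
      forall x, v x = 0 <-> x = 0,
      forall x y, v (x * y) = v x * v y
    & forall x y, v (x + y) <= v x + v y].

(* the p-adic absolute value on Q, with |p| = 1/p *)
Definition padic_abs (p : nat) (q : rat) : R :=
  if q == 0 then 0
  else p%:R ^+ logn p `|denq q|%N / p%:R ^+ logn p `|numq q|%N.

(* A place is represented by its unique absolute value extending one of the
   usual absolute values of Q. *)
Definition places (L : fieldExtType rat) : set (L -> R) :=
  [set v | is_abs_value v /\
     ((forall q : rat, v (ratr q) = `|ratr q|) \/
      (exists2 p : nat, prime p & forall q : rat, v (ratr q) = padic_abs p q))].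

Definition complete_abs (F : fieldType) (w : F -> R) : Prop :=
  forall u : nat -> F,
    (forall e, 0 < e -> exists N : nat, forall i j : nat,
       (N <= i)%N -> (N <= j)%N -> w (u i - u j) < e) ->
    exists l : F, forall e, 0 < e -> exists N : nat, forall i : nat,
       (N <= i)%N -> w (u i - l) < e.

Definition is_completion (L : fieldExtType rat) (v : L -> R)
    (F : fieldType) (w : F -> R) (j : {rmorphism L -> F}) : Prop :=
  [/\ is_abs_value w, complete_abs w, (forall x, w (j x) = v x)
    & forall z e, 0 < e -> exists x : L, w (z - j x) < e].

(* the closure of Q in a completion L_v, that is, Q_v *)
Definition rat_closure (F : fieldType) (w : F -> R) : set F :=
  [set z | forall e, 0 < e -> exists q : rat, w (z - ratr q) < e].

(* [L_v : Q_v]; completions of (L, v) are unique up to isomorphism, so at most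
   one d satisfies the condition. *)
Definition local_degree (L : fieldExtType rat) (v : L -> R) : nat :=
  xget 0%N [set d : nat |
    exists (F : fieldType) (w : F -> R) (j : {rmorphism L -> F}),
      is_completion v w j /\
      exists b : 'I_d -> F, forall x : F,
        exists! c : 'I_d -> F,
          (forall i, rat_closure w (c i)) /\ x = \sum_(i < d) c i * b i].

Definition height_in (L : fieldExtType rat) (m : nat) (u : 'I_m -> L) : R :=
  \sum_(v \in @places L)
     (local_degree v)%:R / (\dim {:L})%:R * ln (\big[Num.max/1]_(i < m) v (u i)).

(* The value does not depend on the number field containing the coordinates. *)
Definition height (m : nat) (s : 'I_m -> algC) : R :=
  xget 0 [set r : R |
    exists (L : fieldExtType rat) (phi : {rmorphism L -> algC}) (u : 'I_m -> L),
      (forall i, phi (u i) = s i) /\ r = height_in u].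

Definition height1 (alpha : algC) : R := height (fun _ : 'I_1 => alpha).

Definition complex_places (L : fieldExtType rat) : set (L -> R) :=
  [set v | exists sigma : {rmorphism L -> complex.complex R},
     (exists x, complex.Im (sigma x) != 0) /\
     v = (fun x => complex.ComplexField.Normc.normc (sigma x))].

Definition tau (L : fieldExtType rat) : nat :=
  #|` fset_set (@complex_places L)|%fset.

End Places.

(* K(s), generated over Q by a Q-basis of K together with the s_i. *)
Definition adjoin_coords (K : fieldExtType rat) (iota : {rmorphism K -> algC})
    (n : nat) (s : 'I_n -> algC) : fieldExtType rat :=
  projT1 (num_field_exists
    ([seq iota x | x <- vbasis {:K}] ++ [seq s i | i <- enum 'I_n])).

Section Geometry.
Variable n : nat.
Implicit Types (Z C G L : set ('I_n -> algC)) (S : set (mpoly.mpoly n algC)).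

Definition zeros S : set ('I_n -> algC) :=
  [set x | forall p, S p -> mpoly.meval x p = 0].

Definition zariski_closure Z : set ('I_n -> algC) :=
  zeros [set p | forall x, Z x -> mpoly.meval x p = 0].

Definition torus : set ('I_n -> algC) := [set x | forall i, x i != 0].

Definition closed_in_torus Z : Prop := exists S, Z = torus `&` zeros S.

Definition algebraic_subgroup G : Prop :=
  [/\ closed_in_torus G, G (fun=> 1),
      forall x y, G x -> G y -> G (fun i => x i * y i)
    & forall x, G x -> G (fun i => (x i)^-1)].

Definition irreducible_in_torus Z : Prop :=
  [/\ closed_in_torus Z, Z !=set0
    & forall Z1 Z2, closed_in_torus Z1 -> closed_in_torus Z2 ->
        Z `<=` Z1 `|` Z2 -> Z `<=` Z1 \/ Z `<=` Z2].

(* Z_0 < ... < Z_m is a chain of length m of irreducible closed subsets of G *)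
Definition irreducible_chain G (m : nat) (Z : nat -> set ('I_n -> algC)) : Prop :=
  (forall i, (i <= m)%N -> irreducible_in_torus (Z i) /\ Z i `<=` G) /\
  (forall i, (i < m)%N -> Z i `<` Z i.+1).

(* dim G <= n - k, for the Krull dimension *)
Definition codim_ge G (k : nat) : Prop :=
  forall m (W : nat -> set _), irreducible_chain G m W -> (m + k <= n)%N.

Definition Sigma2 : set ('I_n -> algC) :=
  [set s | exists G, [/\ algebraic_subgroup G, codim_ge G 2 & G s]].

Definition is_line L : Prop :=
  exists p d : 'I_n -> algC, (exists i, d i != 0) /\
    L = [set x | exists t : algC, x = fun i => p i + t * d i].

Section OverK.
Variables (K : fieldExtType rat) (iota : {rmorphism K -> algC}).

Definition evalK (f : mpoly.mpoly n K) (s : 'I_n -> algC) : algC :=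
  mpoly.meval s (mpoly.map_mpoly iota f).

Definition defined_over Z : Prop :=
  exists T : set (mpoly.mpoly n K),
    Z = [set s | forall f, T f -> evalK f s = 0].

(* The polynomial x restricts to an isomorphism L -> A^1 over K, with inverse
   t |-> (y_1(t), ..., y_n(t)). *)
Definition is_iso_to_A1 L (x : mpoly.mpoly n K) : Prop :=
  exists y : 'I_n -> {poly K},
    (forall s, L s -> (fun i => (map_poly iota (y i)).[evalK x s]) = s) /\
    (forall t : algC, let s := fun i => (map_poly iota (y i)).[t] in
       L s /\ evalK x s = t).

Definition Xi C (x : mpoly.mpoly n K) : set algC :=
  [set evalK x s | s in zariski_closure C `\` C].

Definition HXi (R : realType) C (x : mpoly.mpoly n K) : R :=
  \sum_(alpha \in Xi C x) height1 R alpha.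

End OverK.
End Geometry.

Section Constants.
Variable R : realType.

Definition A_odd (n : nat) : R :=
  if (n %% 4 == 3)%N then
    let k := (n.+1 %/ 4)%N in
    2 / ((4 * k + 1)%N%:R * (4 * k)%N%:R) * 'C(5 * k + 2, 4 * k - 1)%:R
  else
    let k := (n %/ 4)%N in
    1 / (4 * k + 2)%N%:R * 'C(5 * k + 3, 4 * k + 1)%:R.

Definition A (n : nat) : R := if odd n then A_odd n else 3 / 2 * A_odd n.-1.

Definition B (n : nat) : R :=
  if odd n then 3 ^+ n / n`!%:R else 5 / 3 * (3 ^+ n / n`!%:R).

End Constants.

(* Main.v *)
Require Import Defs.
From HB Require Import structures.
From mathcomp Require Import all_boot all_order all_algebra all_field finmap.
From mathcomp Require Import all_classical all_reals all_analysis.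
From mathcomp Require Import -(notations) complex mpoly.
From mathcomp Require Import ring lra zify.
Set Implicit Arguments.
Unset Strict Implicit.
Unset Printing Implicit Defensive.
Import Order.TTheory GRing.Theory Num.Theory.
Local Open Scope classical_set_scope.
Local Open Scope ring_scope.

(* A point of C in Sigma_2 satisfies a nontrivial multiplicative relation, since the
   characters of a proper closed subgroup cannot be pairwise distinct (they would be
   linearly independent).  With s_i = 1 + a_i t and the extra form 1 + a_0 t = 1, the relation
   reads prod l_i^(p_i) = prod l_i^(q_i), homogeneous of degree d, with p_i q_i = 0.
   Eliminating t or the constant term between l_i and l_j gives, at every place,
     |a_i - a_j| max(1,|t|) <= c max(1,|a_i|) max(1,|a_j|) max(|l_i|,|l_j|),
   with c = 2 or 1, so at most one form is much smaller than max(1,|t|); it is absent from one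
   of the two sides, whose common absolute value is thus at least (kappa max(1,|t|))^d.
   Summing over the places, the product formula yields
     h(t) <= 2 n H(Xi) + n (n + 1) log 2,
   which is stronger than the bounds to be proved.

   For the heights, fix for every place b of Q an absolute value W_b of Qbar extending it.
   A place v of L over b is W_b o sigma for some embedding sigma : L -> Qbar (weak
   approximation), and its local degree is the number of such sigma.  Hence sums over the
   places of L are averages over the embeddings, which are Galois-invariant quantities. *)

(** * Absolute values and Cauchy sequences *)

(** Local degrees and heights are defined by choice ([xget]), and heights by a sum over infinitely
    many places, so they have to be computed before any inequality can be used. For a local degree
    this requires that completions exist and that all bases over the closure of Q have the same
    length; that length is the number of roots, in a completion of Qbar, of the minimal polynomial
    of a primitive element over the completion of Q. For a height it requires independence of the
    number field: the values of all embeddings at x form a multiple of the multiset of conjugates of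
    x. Sums over places are cut off at a bound P on the primes, for every large P, so that several
    of them can be compared at one P. The constant 2 n H(Xi) + n (n + 1) log 2 is the sum of log 2 +
    h(a_j) + h(a_k) over the ordered pairs of distinct indices among the n + 1 forms, with a_0 = 0.
    At each place the loss comes from a single pair, but the pair depends on the place, so all of
    them are paid for. The stated bounds follow because their factors in the degree and in delta are
    bounded below. *)

Section AbsValueTheory.
Variables (R : realType) (F : fieldType) (v : F -> R).
Hypothesis hv : is_abs_value v.

Lemma av_ge0 x : 0 <= v x. Proof. by case: hv. Qed.
Lemma av_eq0 x : (v x == 0) = (x == 0).
Proof. by case: hv => _ h _ _; apply/eqP/eqP => /h. Qed.
Lemma avM : {morph v : x y / x * y}. Proof. by case: hv. Qed.
Lemma av_leD x y : v (x + y) <= v x + v y. Proof. by case: hv. Qed.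
Lemma av0 : v 0 = 0. Proof. by apply/eqP; rewrite av_eq0. Qed.
Lemma av_gt0 x : (0 < v x) = (x != 0).
Proof. by rewrite lt0r av_eq0 av_ge0 andbT. Qed.
Lemma av1 : v 1 = 1.
Proof.
have h : v 1 != 0 by rewrite av_eq0 oner_eq0.
by apply: (mulfI h); rewrite -avM !mulr1.
Qed.
Lemma avX x n : v (x ^+ n) = v x ^+ n.
Proof. by elim: n => [|n IH]; rewrite ?expr0 ?av1 // !exprS avM IH. Qed.
Lemma avN x : v (- x) = v x.
Proof.
apply/eqP; rewrite -(@eqrXn2 _ 2%N) ?av_ge0 //.
by rewrite -!avX sqrrN.
Qed.
Lemma avBC x y : v (x - y) = v (y - x). Proof. by rewrite -avN opprB. Qed.
Lemma av_leB x y : v (x - y) <= v x + v y.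
Proof. by rewrite -(avN y) av_leD. Qed.
Lemma av_tri y x z : v (x - z) <= v (x - y) + v (y - z).
Proof. by rewrite (_ : x - z = (x - y) + (y - z)) ?av_leD //; ring. Qed.
Lemma av_dist x y : `|v x - v y| <= v (x - y).
Proof.
have h a b : v a - v b <= v (a - b).
  by rewrite lerBlDr; apply: le_trans (av_leD _ _); rewrite subrK.
by rewrite ler_norml h lerNl opprB avBC h.
Qed.
Lemma avV x : v x^-1 = (v x)^-1.
Proof.
have [->|x0] := eqVneq x 0; first by rewrite invr0 av0 invr0.
have h : v x != 0 by rewrite av_eq0.
by apply: (mulfI h); rewrite -avM !mulfV // av1.
Qed.
Lemma av_div x y : v (x / y) = v x / v y. Proof. by rewrite avM avV. Qed.
Lemma av_leD_sum (I : Type) (r : seq I) (P : pred I) (f : I -> F) :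
  v (\sum_(i <- r | P i) f i) <= \sum_(i <- r | P i) v (f i).
Proof.
elim/big_rec2: _ => [|i y x _ IH]; first by rewrite av0.
by apply: le_trans (av_leD _ _) _; rewrite lerD2l.
Qed.
Lemma av_prod (I : Type) (r : seq I) (P : pred I) (f : I -> F) :
  v (\prod_(i <- r | P i) f i) = \prod_(i <- r | P i) v (f i).
Proof. by elim/big_rec2: _ => [|i y x _ IH]; rewrite ?av1 // avM IH. Qed.
End AbsValueTheory.

Lemma is_abs_value_comp (R : realType) (E F : fieldType) (w : F -> R)
    (f : {rmorphism E -> F}) :
  is_abs_value w -> is_abs_value (w \o f).
Proof.
move=> hw; split => [x|x|x y|x y] /=; first exact: av_ge0.
- split => [/eqP|->]; last by rewrite rmorph0 av0.
  by rewrite av_eq0 // fmorph_eq0 => /eqP.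
- by rewrite rmorphM avM.
- by rewrite rmorphD av_leD.
Qed.

Lemma powers_unbounded (R : realType) (a C : R) : 1 < a -> exists m : nat, C < a ^+ m.
Proof.
move=> a1; have b0 : 0 < a - 1 by rewrite subr_gt0.
have bern m : 1 + (a - 1) * m%:R <= a ^+ m.
  elim: m => [|m IH]; first by rewrite mulr0 addr0 expr0.
  rewrite exprS; apply: le_trans (ler_wpM2l _ IH); last by apply: ltW; lra.
  have := mulr_ge0 (sqr_ge0 (a - 1)) (ler0n R m); rewrite -[m.+1]addn1 natrD; lra.
have /archi_boundP := divr_ge0 (normr_ge0 C) (ltW b0).
set m := Num.bound _; rewrite ltr_pdivrMr // => hm; exists m.
apply: lt_le_trans (bern m); have := ler_norm C; lra.
Qed.

Lemma small_powers (R : realType) (a e : R) : 0 <= a < 1 -> 0 < e ->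
  exists m : nat, a ^+ m < e.
Proof.
move=> /andP[a0 a1] e0; have [->|an0] := eqVneq a 0.
  by exists 1%N; rewrite expr1.
have ap : 0 < a by rewrite lt0r an0.
have [|m hm] := @powers_unbounded _ a^-1 e^-1; first by rewrite invf_gt1.
by exists m; move: hm; rewrite exprVn ltf_pV2 ?posrE ?exprn_gt0.
Qed.

(** Removes the constant from a comparison of two multiplicative functions, by applying it to all
    powers: if [a > b > 0], the powers of [a / b] are unbounded. *)
Lemma le_of_powers_le (R : realType) (a b C : R) : 0 <= a -> 0 <= b ->
  (forall m : nat, a ^+ m <= C * b ^+ m) -> a <= b.
Proof.
move=> a0 b0 h; rewrite leNgt; apply/negP => ba.
have [b00|bn0] := eqVneq b 0.
  have := h 1%N; rewrite !expr1 b00 mulr0; rewrite b00 in ba; lra.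
have bp : 0 < b by rewrite lt0r bn0.
have [|m hm] := @powers_unbounded _ (a / b) C; first by rewrite ltr_pdivlMr ?mul1r.
have := h m; rewrite leNgt => /negP; apply.
by move: hm; rewrite expr_div_n ltr_pdivlMr // exprn_gt0.
Qed.

Lemma eventually_and (P Q : nat -> Prop) :
  (exists N : nat, forall i, (N <= i)%N -> P i) ->
  (exists N : nat, forall i, (N <= i)%N -> Q i) ->
  exists N : nat, forall i, (N <= i)%N -> P i /\ Q i.
Proof.
move=> [N hN] [M hM]; exists (maxn N M) => i; rewrite geq_max => /andP[a b].
by split; auto.
Qed.

Section Cauchy.
Variables (R : realType) (F : fieldType) (v : F -> R).
Hypothesis hv : is_abs_value v.

Definition cauchy_abs (u : nat -> F) := forall e, 0 < e -> exists N : nat,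
  forall i j : nat, (N <= i)%N -> (N <= j)%N -> v (u i - u j) < e.
Definition cvg_abs (u : nat -> F) (l : F) := forall e, 0 < e -> exists N : nat,
  forall i : nat, (N <= i)%N -> v (u i - l) < e.

Lemma cvg_cauchy u l : cvg_abs u l -> cauchy_abs u.
Proof.
move=> h e e0; have [|N hN] := h (e / 2); first by rewrite divr_gt0.
exists N => i j hi hj; apply: le_lt_trans (av_tri hv l _ _) _.
have := hN i hi; have := hN j hj; rewrite (avBC hv l (u j)); lra.
Qed.

Lemma cvg_uniq u l m : cvg_abs u l -> cvg_abs u m -> l = m.
Proof.
move=> h k; apply/eqP; rewrite -subr_eq0 -(av_eq0 hv).
rewrite eq_le av_ge0 // andbT; apply/ler_addgt0Pr => e e0; rewrite add0r.
have e2 : 0 < e / 2 by rewrite divr_gt0.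
have [N hN] := eventually_and (h _ e2) (k _ e2).
have [] := hN N (leqnn N).
have := av_tri hv (u N) l m; rewrite (avBC hv l (u N)); lra.
Qed.

Lemma eq_cvg_abs u u' l : u =1 u' -> cvg_abs u l -> cvg_abs u' l.
Proof. by move=> h H e e0; have [N hN] := H e e0; exists N => i; rewrite -h; auto. Qed.

Lemma cvg_const c : cvg_abs (fun=> c) c.
Proof. by move=> e e0; exists 0%N => i _; rewrite subrr av0. Qed.

Lemma cvgD_abs u u' l l' : cvg_abs u l -> cvg_abs u' l' ->
  cvg_abs (fun i => u i + u' i) (l + l').
Proof.
move=> h k e e0; have e2 : 0 < e / 2 by rewrite divr_gt0.
have [N hN] := eventually_and (h _ e2) (k _ e2).
exists N => i /hN[]; have := av_leD hv (u i - l) (u' i - l').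
rewrite (_ : _ - l + _ = u i + u' i - (l + l')); [lra|ring].
Qed.

Lemma cvgM_abs u u' l l' : cvg_abs u l -> cvg_abs u' l' ->
  cvg_abs (fun i => u i * u' i) (l * l').
Proof.
(* The extra 1 pays for the product of the two errors, one of which is kept below 1. *)
move=> h k e e0; pose B := v l + v l' + 1.
have B0 : 0 < B by rewrite /B; have := av_ge0 hv l; have := av_ge0 hv l'; lra.
have e2 : 0 < Num.min 1 (e / (2 * B)).
  by rewrite lt_min ltr01 divr_gt0 // mulr_gt0.
have [N hN] := eventually_and (h _ e2) (k _ e2).
exists N => i /hN[]; rewrite !lt_min => /andP[a1 a2] /andP[b1 b2].
have -> : u i * u' i - l * l' = (u i - l) * (u' i - l') + l * (u' i - l') + l' * (u i - l) by ring.
have E : e = (e / (2 * B)) * B * 2 by field; rewrite gt_eqF.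
apply: le_lt_trans (av_leD hv _ _) _; apply: le_lt_trans (lerD (av_leD hv _ _) (lexx _)) _.
rewrite !(avM hv) E.
have := av_ge0 hv l; have := av_ge0 hv l'.
have := av_ge0 hv (u i - l); have := av_ge0 hv (u' i - l').
set d := e / (2 * B) in a2 b2 *; move=> ? ? ? ?; rewrite /B; nra.
Qed.

Lemma cvg_av u l e : cvg_abs u l -> 0 < e -> exists N : nat, forall i,
  (N <= i)%N -> `|v (u i) - v l| < e.
Proof.
move=> h e0; have [N hN] := h e e0; exists N => i /hN.
exact: le_lt_trans (av_dist hv _ _).
Qed.
End Cauchy.

Section RealSeq.
Import numFieldNormedType.Exports.
Variable R : realType.
Lemma normr_abs_value : is_abs_value (fun x : R => `|x|).
Proof.
split => [x|x|x y|x y]; [exact: normr_ge0| |exact: normrM|exact: ler_normD].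
by split => [/eqP|->]; rewrite ?normr0 // normr_eq0 => /eqP.
Qed.

Lemma real_complete : complete_abs (fun x : R => `|x|).
Proof.
move=> u' hu; pose u : nat -> R := u'; rewrite -/u in hu *.
have /cauchy_cvgP : cauchy (u @ \oo).
  apply: cauchy_exP => e e0; have [N hN] := hu e e0; exists (u N); exists N => // i /= hi.
  by rewrite /ball /=; apply: hN.
move=> /cvg_ex[l /cvgrPdist_lt h]; exists l => e e0.
have [N _ hN] := h e e0; exists N => i hi; rewrite distrC; exact: (hN i hi).
Qed.

Lemma cvg_real_le (u u' : nat -> R) (l l' : R) : cvg_abs Num.norm u l -> cvg_abs Num.norm u' l' ->
  (forall i, u i <= u' i) -> l <= l'.
Proof.
move=> h h' H; apply/ler_addgt0Pr => e e0.
have e2 : 0 < e / 2 by rewrite divr_gt0.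
have [N hN] := eventually_and (h _ e2) (h' _ e2).
have [] := hN N (leqnn N); have := H N; rewrite !ltr_norml => ? /andP[? ?] /andP[? ?]; lra.
Qed.
End RealSeq.

Lemma inv_succ_small (R : realType) (e : R) : 0 < e ->
  exists N : nat, forall i, (N <= i)%N -> i.+1%:R^-1 < e.
Proof.
move=> e0; have /archi_boundP := ltW (divr_gt0 ltr01 e0); set m := Num.bound _ => hm.
exists m => i mi; rewrite -[e]invrK ltf_pV2 ?posrE ?invr_gt0 ?ltr0Sn //.
rewrite -[e^-1]mul1r; apply: lt_le_trans hm _; rewrite ler_nat; lia.
Qed.

Lemma dense_seq (R : realType) (E : Type) (d : E -> R) :
  (forall e, 0 < e -> exists x, d x < e) ->
  exists u : nat -> E, forall e, 0 < e -> exists N : nat, forall i, (N <= i)%N -> d (u i) < e.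
Proof.
move=> h; have h' i : exists x, d x < i.+1%:R^-1 by apply: h; rewrite invr_gt0.
have [u hu] := choice h'; exists u => e e0; have [N hN] := inv_succ_small e0.
by exists N => i /hN; exact: lt_trans (hu i).
Qed.

(** * Completions *)

Section Completion.
Variables (R : realType) (F : fieldType) (v : F -> R).
Hypothesis hv : is_abs_value v.

Lemma cauchy_bounded u : cauchy_abs v u -> exists2 B : R, 0 < B & forall i, v (u i) <= B.
Proof.
move=> hu; have [N hN] := hu 1 ltr01.
pose B := v (u N) + 1 + \sum_(i < N) v (u i); have s0 : 0 <= \sum_(i < N) v (u i).
  by apply: sumr_ge0 => i _; exact: av_ge0.
exists B => [|i]; first by rewrite /B; have := av_ge0 hv (u N); lra.
have [iN|Ni] := ltnP i N; last first.
  have := hN i N Ni (leqnn N); have := av_leD hv (u i - u N) (u N).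
  rewrite subrK /B; lra.
rewrite /B (bigD1 (Ordinal iN)) //=; set S := \sum_(_ < _ | _) _.
have : 0 <= S by apply: sumr_ge0 => ? _; exact: av_ge0.
have := av_ge0 hv (u N); lra.
Qed.

(** The proof that [v] is an absolute value is an argument of the predicate because the ring
    instances attached to it depend on that proof. *)
Definition cauchy_pred of is_abs_value v : {pred nat -> F} := fun u => `[< cauchy_abs v u >].

Lemma cauchy_subring : subring_closed (cauchy_pred hv).
Proof.
split=> [|u u'|u u'].
- by apply/asboolP => e e0; exists 0%N => i j _ _; rewrite subrr av0.
- move=> /asboolP h /asboolP k; apply/asboolP => e e0.
  have e2 : 0 < e / 2 by rewrite divr_gt0.
  have [N hN] := h _ e2; have [M hM] := k _ e2; exists (maxn N M) => i j.
  rewrite !geq_max => /andP[a b] /andP[c d].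
  have := hN i j a c; have := hM i j b d; have := av_leB hv (u i - u j) (u' i - u' j).
  have -> : (u - u') i - (u - u') j = u i - u j - (u' i - u' j) by have bE k0 : (u - u') k0 = u k0 - u' k0 by []; rewrite !bE; ring.
  lra.
move=> /asboolP h /asboolP k; apply/asboolP => e e0.
have [B B0 hB] := cauchy_bounded h; have [C C0 hC] := cauchy_bounded k.
have e2 : 0 < e / (B + C) by rewrite divr_gt0 // addr_gt0.
have [N hN] := h _ e2; have [M hM] := k _ e2; exists (maxn N M) => i j.
rewrite !geq_max => /andP[a b] /andP[c d].
have := hN i j a c; have := hM i j b d; rewrite !ltr_pdivlMr ?addr_gt0 // => h1 h2.
have -> : (u * u') i - (u * u') j = u i * (u' i - u' j) + (u i - u j) * u' j.
  by have mE k0 : (u * u') k0 = u k0 * u' k0 by []; rewrite !mE; ring.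
apply: le_lt_trans (av_leD hv _ _) _; rewrite !(avM hv).
have := hB i; have := hC j; have := av_ge0 hv (u i); have := av_ge0 hv (u' j).
have := av_ge0 hv (u i - u j); have := av_ge0 hv (u' i - u' j) => ? ? ? ? ? ?.
apply: (@le_lt_trans _ _ (B * v (u' i - u' j) + v (u i - u j) * C)); last by nra.
by apply: lerD; [exact: ler_wpM2r|exact: ler_wpM2l].
Qed.

HB.instance Definition _ := GRing.isSubringClosed.Build (nat -> F) (cauchy_pred hv) cauchy_subring.

Record cauchy_seq := CauchySeq { cauchy_val :> nat -> F; _ : cauchy_val \in cauchy_pred hv }.
HB.instance Definition _ := [isSub for cauchy_val].
HB.instance Definition _ := [Choice of cauchy_seq by <:].
HB.instance Definition _ := [SubChoice_isSubComNzRing of cauchy_seq by <:].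

Lemma cauchy_seqP (u : cauchy_seq) : cauchy_abs v u.
Proof. by case: u => u /= /asboolP. Qed.

Definition null_pred : {pred cauchy_seq} := fun u => `[< cvg_abs v u 0 >].
Lemma null_ideal : idealr_closed null_pred.
Proof.
split.
- by apply/asboolP => e e0; exists 0%N => i _; rewrite subrr av0.
- apply/negP => /asboolP /(_ 1 ltr01)[N /(_ N (leqnn N))].
  by rewrite subr0 /= (av1 hv) ltxx.
move=> a u u' /asboolP h /asboolP k; apply/asboolP => e e0.
have [B B0 hB] := cauchy_bounded (@cauchy_seqP a).
have e2 : 0 < e / 2 by rewrite divr_gt0.
have e3 : 0 < e / 2 / B by rewrite !divr_gt0.
have [N hN] := eventually_and (h _ e3) (k _ e2).
exists N => i /hN[]; rewrite !subr0 ltr_pdivlMr // => h1 h2.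
have -> : (a * u + u' : cauchy_seq) i = a i * u i + u' i by [].
apply: le_lt_trans (av_leD hv _ _) _; rewrite (avM hv).
have := ler_wpM2r (av_ge0 hv (u i)) (hB i); lra.
Qed.
HB.instance Definition _ := isIdealr.Build cauchy_seq null_pred null_ideal.

Definition completion := {ideal_quot null_pred}.
HB.instance Definition _ := GRing.ComNzRing.on completion.
End Completion.

Section CompletionField.
Variables (R : realType) (F : fieldType) (v : F -> R).
Hypothesis hv : is_abs_value v.
Notation T := (completion hv).
Notation S := (cauchy_seq hv).
Local Open Scope quotient_scope.

Definition cpi (u : S) : T := \pi u.

Lemma cpi_surj (x : T) : exists u, x = cpi u.
Proof. by exists (repr x); rewrite /cpi reprK. Qed.

Lemma cpi_eq (u u' : S) : cpi u = cpi u' <-> cvg_abs v (fun i => u i - u' i) 0.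
Proof.
have h : (u - u' \in @null_pred _ _ _ hv) = (cpi u == cpi u') by exact: Quotient.idealrBE.
by split=> [/eqP|] H; [rewrite -h in H; move/asboolP: H|apply/eqP; rewrite -h; apply/asboolP].
Qed.

Lemma cpiD u u' : cpi u + cpi u' = cpi (u + u').
Proof. by rewrite /cpi !piE. Qed.
Lemma cpiM u u' : cpi u * cpi u' = cpi (u * u').
Proof. by rewrite /cpi !piE. Qed.
Lemma cpiN u : - cpi u = cpi (- u).
Proof. by rewrite /cpi !piE. Qed.
Lemma cpi1 : 1 = cpi 1.
Proof. by rewrite /cpi !piE. Qed.
Lemma cpi0 : 0 = cpi 0.
Proof. by rewrite /cpi !piE. Qed.

Lemma mk_seq u : cauchy_abs v u -> exists s : S, forall i, s i = u i.
Proof.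
by move=> hu; have h : u \in cauchy_pred hv by [apply/asboolP]; exists (CauchySeq h).
Qed.

(** A Cauchy sequence that does not tend to 0 has arbitrarily late terms of size at least some [e],
    and all late terms are within [e / 2] of these. *)
Lemma not_null_lower (u : S) : cpi u != 0 ->
  exists2 e, 0 < e & exists N : nat, forall i, (N <= i)%N -> e <= v (u i).
Proof.
move=> u0; have : ~ cvg_abs v (fun i => u i - (0 : S) i) 0.
  by move=> /cpi_eq; rewrite -cpi0; apply/eqP.
move=> /existsNP[e] /not_implyP[e0 H].
exists (e / 2); first by rewrite divr_gt0.
have [|N hN] := @cauchy_seqP _ _ _ hv u (e / 2); first by rewrite divr_gt0.
exists N => i hi.
have /existsNP[k /not_implyP[hk /negP]] : ~ forall k, (N <= k)%N -> v (u k - 0 - 0) < e.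
  by move=> h; apply: H; exists N.
rewrite !subr0 -leNgt; have := hN k i hk hi.
have := av_leD hv (u k - u i) (u i); rewrite subrK; lra.
Qed.

(** A representative is inverted term by term. Vanishing terms get the value 0, which is harmless
    since only finitely many vanish; later on [1/u_i - 1/u_j = (u_j - u_i)/(u_i u_j)] has
    denominators bounded below. The two clauses are the two field axioms to be supplied. *)
Lemma completion_inv (x : T) : exists y, (x != 0 -> y * x = 1) /\ (x = 0 -> y = 0).
Proof.
have [->|x0] := eqVneq x 0; first by exists 0; split.
have [u xu] := cpi_surj x; have [e e0 [N hN]] := not_null_lower (u := u) ltac:(by rewrite -xu).
have [|y hy] := @mk_seq (fun i => (u i)^-1).
  move=> d d0; have [|M hM] := @cauchy_seqP _ _ _ hv u (d * e ^+ 2).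
    by rewrite mulr_gt0 // exprn_gt0.
  exists (maxn N M) => i j; rewrite !geq_max => /andP[a b] /andP[c f].
  have hi := hN i a; have hj := hN j c.
  have vi : 0 < v (u i) by exact: lt_le_trans hi.
  have vj : 0 < v (u j) by exact: lt_le_trans hj.
  have -> : (u i)^-1 - (u j)^-1 = (u j - u i) / (u i * u j).
    by field; rewrite -!(av_gt0 hv) vi vj.
  rewrite (av_div hv) (avM hv) ltr_pdivrMr ?mulr_gt0 //.
  apply: lt_le_trans (hM j i f b) _.
  by rewrite ler_pM2l // expr2 ler_pM // ltW.
exists (cpi y); split=> [_|x00]; last by rewrite x00 eqxx in x0.
rewrite xu cpiM cpi1; apply/cpi_eq => d d0; exists N => i hi.
have -> : (y * u : S) i = y i * u i by [].
have ui : u i != 0 by rewrite -(av_gt0 hv) (lt_le_trans e0) ?hN.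
by rewrite hy mulVf // subrr subr0 (av0 hv).
Qed.

Definition completion_invr (x : T) : T := projT1 (cid (completion_inv x)).
Lemma completion_mulVf (x : T) : x != 0 -> completion_invr x * x = 1.
Proof. by rewrite /completion_invr; case: cid => y /= []. Qed.
Lemma completion_invr0 : completion_invr 0 = 0.
Proof. by rewrite /completion_invr; case: cid => y /= [_]; exact. Qed.

HB.instance Definition _ :=
  GRing.ComNzRing_isField.Build T completion_mulVf completion_invr0.

(** The limit is asserted for all representatives at once, so that the value chosen from it does not
    depend on a representative. *)
Lemma cnorm_ex (x : T) : exists l : R, forall u, x = cpi u ->
  cvg_abs (F := R) Num.norm (fun i => v (u i)) l.
Proof.
have [u xu] := cpi_surj x.
have [|l hl] := @real_complete R (fun i => v (u i)).
  move=> e e0; have [N hN] := @cauchy_seqP _ _ _ hv u e e0; exists N => i j hi hj.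
  exact: le_lt_trans (av_dist hv _ _) (hN i j hi hj).
exists l => u'; rewrite xu => /cpi_eq h e e0.
have e2 : 0 < e / 2 by rewrite divr_gt0.
have [N hN] := eventually_and (h _ e2) (hl _ e2).
exists N => i /hN[]; rewrite subr0 => h1 h2.
have := av_dist hv (u i) (u' i); have := ler_distD (v (u i)) (v (u' i)) l.
rewrite (distrC (v (u' i)) (v (u i))); lra.
Qed.

Definition cnorm (x : T) : R := projT1 (cid (cnorm_ex x)).
Lemma cnormP (u : S) : cvg_abs (F := R) Num.norm (fun i => v (u i)) (cnorm (cpi u)).
Proof. by rewrite /cnorm; case: cid => l /=; exact. Qed.

Lemma cnorm_eq (u : S) l : cvg_abs (F := R) Num.norm (fun i => v (u i)) l -> cnorm (cpi u) = l.
Proof. exact: (cvg_uniq (normr_abs_value R) (cnormP u)). Qed.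

Lemma cnorm_le (u : S) B : (exists N : nat, forall i, (N <= i)%N -> v (u i) <= B) -> cnorm (cpi u) <= B.
Proof.
move=> [N hN]; apply/ler_addgt0Pr => e e0; have [M hM] := cnormP u e0.
have := hN (maxn N M) (leq_maxl _ _); have := hM (maxn N M) (leq_maxr _ _).
by rewrite ltr_norml => /andP[? ?]; lra.
Qed.

Lemma cnorm_abs : is_abs_value cnorm.
Proof.
have cst0 : cvg_abs (F := R) Num.norm (fun=> 0) 0 by exact: (cvg_const (normr_abs_value R)).
split => [x|x|x y|x y].
- have [u ->] := cpi_surj x; apply: (cvg_real_le cst0 (cnormP u)) => i; exact: av_ge0.
- split=> [|->]; last first.
    by rewrite cpi0; apply: cnorm_eq; apply: eq_cvg_abs cst0 => i /=; rewrite (av0 hv).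
  have [u ->] := cpi_surj x; move=> h; rewrite cpi0; apply/cpi_eq => e e0.
  have [N hN] := cnormP u e0; exists N => i /hN; rewrite h !subr0.
  by rewrite ger0_norm ?av_ge0.
- have [u ->] := cpi_surj x; have [u' ->] := cpi_surj y; rewrite cpiM; apply: cnorm_eq.
  apply: eq_cvg_abs (cvgM_abs (normr_abs_value R) (cnormP u) (cnormP u')) => i /=.
  by rewrite -(avM hv).
- have [u ->] := cpi_surj x; have [u' ->] := cpi_surj y; rewrite cpiD.
  apply: (cvg_real_le (cnormP (u + u')) (cvgD_abs (normr_abs_value R) (cnormP u) (cnormP u'))) => i /=.
  exact: av_leD.
Qed.

Definition cconst_seq (x : F) : S := projT1 (cid (mk_seq (cvg_cauchy hv (cvg_const hv x)))).
Lemma cconst_seqE x i : cconst_seq x i = x.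
Proof. by rewrite /cconst_seq; case: cid. Qed.
Definition cemb (x : F) : T := cpi (cconst_seq x).

Lemma eq_cpi (u u' : S) : u =1 u' -> cpi u = cpi u'.
Proof.
by move=> h; apply/cpi_eq => e e0; exists 0%N => i _; rewrite h subrr subr0 (av0 hv).
Qed.

Lemma cemb_zmod : zmod_morphism cemb.
Proof.
move=> x y; rewrite cpiN cpiD; apply: eq_cpi => i.
by rewrite (_ : (_ + _ : S) i = cconst_seq x i - cconst_seq y i) // !cconst_seqE.
Qed.
Lemma cemb_monoid : monoid_morphism cemb.
Proof.
split; first by rewrite cpi1; apply: eq_cpi => i; rewrite cconst_seqE.
move=> x y; rewrite cpiM; apply: eq_cpi => i.
by rewrite (_ : (_ * _ : S) i = cconst_seq x i * cconst_seq y i) // !cconst_seqE.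
Qed.
HB.instance Definition _ := GRing.isZmodMorphism.Build F T cemb cemb_zmod.
HB.instance Definition _ := GRing.isMonoidMorphism.Build F T cemb cemb_monoid.

Lemma cnorm_cemb x : cnorm (cemb x) = v x.
Proof.
apply: cnorm_eq; apply: eq_cvg_abs (cvg_const (normr_abs_value R) (v x)) => i /=.
by rewrite cconst_seqE.
Qed.

Lemma cnorm_approx (u : S) e : 0 < e -> exists N : nat, forall i, (N <= i)%N ->
  cnorm (cpi u - cemb (u i)) < e.
Proof.
move=> e0; have e2 : 0 < e / 2 by rewrite divr_gt0.
have [N hN] := @cauchy_seqP _ _ _ hv u _ e2; exists N => i hi.
rewrite cpiN cpiD; apply: (@le_lt_trans _ _ (e / 2)); last by lra.
apply: cnorm_le; exists N => k hk.
rewrite (_ : (_ + _ : S) k = u k - cconst_seq (u i) k) // cconst_seqE ltW //; exact: hN.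
Qed.

Lemma cemb_dense (x : T) e : 0 < e -> exists a : F, cnorm (x - cemb a) < e.
Proof.
move=> e0; have [u ->] := cpi_surj x; have [N hN] := cnorm_approx u e0.
by exists (u N); exact: hN.
Qed.

(** Diagonal argument: the i-th term is replaced by an element of [F] at distance less than
    [1/(i+1)], and the class of the resulting Cauchy sequence is the limit. *)
Lemma completion_complete : complete_abs cnorm.
Proof.
move=> x hx.
have h i : exists a : F, cnorm (x i - cemb a) < i.+1%:R^-1.
  by apply: cemb_dense; rewrite invr_gt0.
have [a ha] := choice h.
have [|u hu] := @mk_seq a.
  move=> e e0; have e3 : 0 < e / 3 by rewrite divr_gt0.
  have [N hN] := hx _ e3; have [M hM] := inv_succ_small e3; exists (maxn N M) => i j.
  rewrite !geq_max => /andP[ai b] /andP[c d].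
  have := hN i j ai c; have := hM i b; have := hM j d; have := ha i; have := ha j.
  rewrite -cnorm_cemb rmorphB /=.
  have := av_tri cnorm_abs (x i) (cemb (a i)) (cemb (a j)).
  have := av_tri cnorm_abs (x j) (x i) (cemb (a j)).
  rewrite (avBC cnorm_abs (cemb (a i)) (x i)); set ii := i.+1%:R^-1; set jj := j.+1%:R^-1; lra.
exists (cpi u) => e e0; have e3 : 0 < e / 2 by rewrite divr_gt0.
have [N hN] := eventually_and (cnorm_approx u e3) (inv_succ_small e3); exists N => i /hN[].
rewrite hu; have := ha i; have := av_tri cnorm_abs (cemb (a i)) (x i) (cpi u).
rewrite (avBC cnorm_abs (cpi u)); set ii := i.+1%:R^-1; lra.
Qed.
End CompletionField.

Lemma completion_exists (R : realType) (F : fieldType) (v : F -> R) (hv : is_abs_value v) :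
  exists (E : fieldType) (w : E -> R) (j : {rmorphism F -> E}),
  [/\ is_abs_value w, complete_abs w, (forall x, w (j x) = v x)
    & forall z e, 0 < e -> exists x : F, w (z - j x) < e].
Proof.
exists (completion hv), (@cnorm _ _ _ hv), (@cemb _ _ _ hv); split.
- exact: cnorm_abs.
- exact: completion_complete.
- exact: cnorm_cemb.
- exact: cemb_dense.
Qed.

(** * Extension of isometries; finite-dimensional spaces over a complete field *)

Section IsometryExtension.
Variables (R : realType) (E F1 F2 : fieldType) (v : E -> R) (w1 : F1 -> R) (w2 : F2 -> R).
Hypotheses (h1 : is_abs_value w1) (h2 : is_abs_value w2) (c2 : complete_abs w2).
Variables (j : {rmorphism E -> F1}) (f : {rmorphism E -> F2}).
Hypotheses (jv : forall x, w1 (j x) = v x) (fv : forall x, w2 (f x) = v x).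
Hypothesis jdense : forall z e, 0 < e -> exists x, w1 (z - j x) < e.

(** The extension is the closure of the set of pairs [(j x, f x)]: pairs of limits along one
    sequence of [E]. This relation is stable under the ring operations and preserves the norm, hence
    is single-valued. *)
Let graph z y := exists u : nat -> E,
  cvg_abs w1 (fun i => j (u i)) z /\ cvg_abs w2 (fun i => f (u i)) y.

Let graph_ex z : exists y, graph z y.
Proof.
have [u hu] := @dense_seq _ _ (fun x => w1 (z - j x)) (jdense z).
have cu : cvg_abs w1 (fun i => j (u i)) z.
  by move=> e /hu[N hN]; exists N => i /hN; rewrite (avBC h1).
have [e e0|y hy] := c2 (u := fun i => f (u i)); last by exists y, u.
have [N hN] := cvg_cauchy h1 cu e0; exists N => i k hi hk.
by rewrite -rmorphB fv -jv rmorphB; exact: hN.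
Qed.

Let graph_norm z y : graph z y -> w2 y = w1 z.
Proof.
move=> [u [a b]]; apply: (cvg_uniq (normr_abs_value R) (u := fun i => v (u i))).
  by move=> e e0; have [N hN] := cvg_av h2 b e0; exists N => i /hN; rewrite fv.
by move=> e e0; have [N hN] := cvg_av h1 a e0; exists N => i /hN; rewrite jv.
Qed.

Let graphB z y z' y' : graph z y -> graph z' y' -> graph (z - z') (y - y').
Proof.
move=> [u [a b]] [u' [a' b']]; exists (fun i => u i - u' i); split.
  have aN := cvgM_abs h1 (cvg_const h1 (-1)) a'.
  rewrite -[- z']mulN1r; apply: eq_cvg_abs (cvgD_abs h1 a aN) => i.
  by rewrite /= rmorphB mulN1r.
have bN := cvgM_abs h2 (cvg_const h2 (-1)) b'.
rewrite -[- y']mulN1r; apply: eq_cvg_abs (cvgD_abs h2 b bN) => i.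
by rewrite /= rmorphB mulN1r.
Qed.

Let graphM z y z' y' : graph z y -> graph z' y' -> graph (z * z') (y * y').
Proof.
move=> [u [a b]] [u' [a' b']]; exists (fun i => u i * u' i); split.
  by apply: eq_cvg_abs (cvgM_abs h1 a a') => i; rewrite rmorphM.
by apply: eq_cvg_abs (cvgM_abs h2 b b') => i; rewrite rmorphM.
Qed.

Let graphj x : graph (j x) (f x).
Proof. by exists (fun=> x); split; apply: cvg_const. Qed.

Let graph_uniq z y y' : graph z y -> graph z y' -> y = y'.
Proof.
move=> a b; apply/eqP; rewrite -subr_eq0 -(av_eq0 h2) (graph_norm (graphB a b)).
by rewrite subrr (av0 h1).
Qed.

Lemma isometry_extension : exists i : {rmorphism F1 -> F2},
  (forall z, w2 (i z) = w1 z) /\ forall x, i (j x) = f x.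
Proof.
have [g hg] := choice graph_ex.
have gB : zmod_morphism g by move=> x y; exact: graph_uniq (hg _) (graphB (hg x) (hg y)).
have gM : monoid_morphism g.
  split=> [|x y]; last by exact: graph_uniq (hg _) (graphM (hg x) (hg y)).
  by apply: graph_uniq (hg _) _; rewrite -(rmorph1 j) -[X in graph _ X](rmorph1 f).
pose gA := GRing.isZmodMorphism.Build _ _ g gB.
pose gR := GRing.isMonoidMorphism.Build _ _ g gM.
pose G : {rmorphism F1 -> F2} := HB.pack g gA gR.
exists G; split => [z|x]; first exact: graph_norm (hg z).
exact: graph_uniq (hg _) (graphj x).
Qed.
End IsometryExtension.

Lemma isometry_closed_image (R : realType) (F1 F2 : fieldType) (w1 : F1 -> R) (w2 : F2 -> R)
    (i : {rmorphism F1 -> F2}) (z : F2) :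
  is_abs_value w1 -> is_abs_value w2 -> complete_abs w1 -> (forall x, w2 (i x) = w1 x) ->
  (forall e, 0 < e -> exists x, w2 (z - i x) < e) -> exists x, z = i x.
Proof.
move=> h1 h2 c1 iw hz; have [u hu] := @dense_seq _ _ (fun x => w2 (z - i x)) hz.
have cu : cvg_abs w2 (fun k => i (u k)) z.
  by move=> e /hu[N hN]; exists N => k /hN; rewrite (avBC h2).
have [e e0|x hx] := c1 u.
  have [N hN] := cvg_cauchy h2 cu e0; exists N => k l hk hl.
  by rewrite -iw rmorphB; exact: hN.
exists x; apply: (cvg_uniq h2 cu) => e e0; have [N hN] := hx e e0; exists N => k /hN.
by rewrite -iw rmorphB.
Qed.

Section FiniteDim.
Variables (R : realType) (k F : fieldType) (wk : k -> R) (w : F -> R).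
Hypotheses (hk : is_abs_value wk) (hw : is_abs_value w) (ck : complete_abs wk).
Variable i : {rmorphism k -> F}.
Hypothesis iw : forall x, w (i x) = wk x.
Variable b : nat -> F.

(** Coefficients are indexed by [nat], so that a combination of the first [d] vectors can be
    extended or truncated without casts. *)
Let comb d (c : nat -> k) := \sum_(l < d) i (c l) * b l.
Let bounded_coords d := exists2 C, 0 < C & forall c l, (l < d)%N -> wk (c l) <= C * w (comb d c).

Let combB d c c' : comb d c - comb d c' = comb d (fun l => c l - c' l).
Proof. by rewrite -sumrB; apply: eq_bigr => l _; rewrite rmorphB mulrBl. Qed.

Let combZ d a c : i a * comb d c = comb d (fun l => a * c l).
Proof. by rewrite mulr_sumr; apply: eq_bigr => l _; rewrite rmorphM mulrA. Qed.

(** The coordinates of approximating combinations are Cauchy because the norm bounds them; their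
    limits are the coordinates of [z]. *)
Let comb_closed d z : bounded_coords d ->
  (forall e, 0 < e -> exists c, w (z - comb d c) < e) -> exists c, z = comb d c.
Proof.
move=> [C C0 hC] hz; have [u hu] := @dense_seq _ _ (fun c => w (z - comb d c)) hz.
have cu : cvg_abs w (fun n => comb d (u n)) z.
  by move=> e /hu[N hN]; exists N => l /hN; rewrite (avBC hw).
have hlim l : exists a, (l < d)%N -> cvg_abs wk (fun n => u n l) a.
  have [ld|dl] := ltnP l d; last by exists 0.
  have [e e0|a ha] := ck (u := fun n => u n l); last by exists a.
  have [N hN] := cvg_cauchy hw cu (divr_gt0 e0 C0); exists N => n m hn hm.
  apply: le_lt_trans (hC (fun l => u n l - u m l) l ld) _.
  by rewrite -combB mulrC -ltr_pdivlMr //; exact: hN.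
have [a ha] := choice hlim; exists a; apply: (cvg_uniq hw cu).
rewrite /comb; have : (d <= d)%N by []; elim: {-2}d => [_|m IH md].
  by apply: eq_cvg_abs (cvg_const hw _) => n; rewrite !big_ord0.
rewrite big_ord_recr /=; apply: (@eq_cvg_abs _ _ _ (fun n =>
  (\sum_(l < m) i (u n l) * b l) + i (u n m) * b m)).
  by move=> n; rewrite big_ord_recr.
apply: (cvgD_abs hw); first by apply: IH; exact: ltnW.
apply: (cvgM_abs hw) (cvg_const hw _) => e e0.
by have [N hN] := ha m md e e0; exists N => n /hN; rewrite -iw rmorphB.
Qed.

(** Equivalence of norms in finite dimension over a complete field, by induction on [d]. The span of
    the first [d] vectors is closed, so [b d] lies at a positive distance [e] from it, which bounds
    the last coordinate by [e^-1] times the norm. *)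
Lemma coords_bounded d :
  (forall c : nat -> k, \sum_(l < d) i (c l) * b l = 0 -> forall l, (l < d)%N -> c l = 0) ->
  exists2 C, 0 < C & forall (c : nat -> k) l, (l < d)%N -> wk (c l) <= C * w (\sum_(l < d) i (c l) * b l).
Proof.
elim: d => [|d IH] free; first by exists 1.
have {}IH : bounded_coords d.
  apply: IH => c c0 l ld; pose c' l := if (l < d)%N then c l else 0.
  have := free c' _ l (ltnW ld); rewrite /c' ld; apply.
  rewrite big_ord_recr /= ltnn rmorph0 mul0r addr0 -[RHS]c0.
  by apply: eq_bigr => m _; rewrite ltn_ord.
have [e e0 he] : exists2 e, 0 < e & forall c, e <= w (b d - comb d c).
  apply/not_exists2P => H; have [e e0|c bc] := comb_closed (z := b d) IH.
    have /not_andP[/(_ e0)//|/existsNP[c /negP]] : ~ (0 < e /\ forall c, e <= w (b d - comb d c)).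
      by move=> [x y]; have [] := H e.
    by rewrite -ltNge; exists c.
  pose c' l := if (l < d)%N then c l else -1.
  have := free c' _ d (ltnSn d); rewrite /c' ltnn => h.
  have /eqP : -1 = 0 :> k.
    apply: h; rewrite big_ord_recr /= ltnn rmorphN1 mulN1r bc.
    by apply/eqP; rewrite subr_eq0; apply/eqP/eq_bigr => m _; rewrite ltn_ord.
  by rewrite oppr_eq0 oner_eq0.
have [C C0 hC] := IH.
have last c : e * wk (c d) <= w (comb d.+1 c).
  have [->|cd0] := eqVneq (c d) 0; first by rewrite (av0 hk) mulr0 av_ge0.
  have -> : comb d.+1 c = i (c d) * (b d - comb d (fun l => - (c l / c d))).
    rewrite mulrBr combZ /comb big_ord_recr /= addrC; congr (_ + _).
    rewrite -sumrN; apply: eq_bigr => l _.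
    by rewrite mulrN rmorphN mulNr opprK mulrCA mulfV // mulr1.
  by rewrite (avM hw) iw mulrC ler_wpM2l ?av_ge0.
(* The earlier coordinates are those of the vector minus its last term, whose size is at most
   [1 + e^-1 * w (b d)] times that of the vector; the summand [e^-1] serves the last coordinate. *)
pose B := e^-1 + C * (1 + e^-1 * w (b d)).
have wb := av_ge0 hw (b d).
have ei : 0 < e^-1 by rewrite invr_gt0.
have B1 : 0 < C * (1 + e^-1 * w (b d)).
  by rewrite mulr_gt0 // ltr_pwDl // mulr_ge0 // ltW.
exists B; first by rewrite addr_gt0.
move=> c l; have lst : wk (c d) <= e^-1 * w (comb d.+1 c).
  by rewrite mulrC ler_pdivlMr // mulrC.
have W := av_ge0 hw (comb d.+1 c).
rewrite ltnS leq_eqVlt => /orP[/eqP->|ld].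
  apply: le_trans lst _; rewrite ler_wpM2r // /B; lra.
apply: le_trans (hC c l ld) _.
have -> : comb d c = comb d.+1 c - i (c d) * b d by rewrite /comb big_ord_recr /= addrK.
apply: (@le_trans _ _ (C * (1 + e^-1 * w (b d)) * w (comb d.+1 c))).
  rewrite -mulrA ler_wpM2l ?(ltW C0) //.
  apply: le_trans (av_leB hw _ _) _; rewrite (avM hw) iw mulrDl mul1r lerD2l.
  by rewrite mulrAC ler_wpM2r.
by rewrite ler_wpM2r // /B; lra.
Qed.

Lemma span_closed d z :
  (forall c : nat -> k, \sum_(l < d) i (c l) * b l = 0 -> forall l, (l < d)%N -> c l = 0) ->
  (forall e, 0 < e -> exists c : nat -> k, w (z - \sum_(l < d) i (c l) * b l) < e) ->
  exists c : nat -> k, z = \sum_(l < d) i (c l) * b l.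
Proof. by move=> /coords_bounded; exact: comb_closed. Qed.
End FiniteDim.

(** * Absolute values on Qbar *)

Section ValuationRing.
Variables (p : nat) (p_prime : prime p).
Local Notation pp := (p%:R : algC).

Let pp0 : pp != 0. Proof. by rewrite pnatr_eq0 -lt0n prime_gt0. Qed.

Definition is_subring (V : set algC) : Prop :=
  [/\ V 1, forall x y, V x -> V y -> V (x - y) & forall x y, V x -> V y -> V (x * y)].

Lemma maximal_subring : exists V : set algC, [/\ is_subring V, ~ V pp^-1 &
  forall W : set algC, is_subring W -> V `<=` W -> ~ W pp^-1 -> W `<=` V].
Proof.
pose P (V : set algC) := V = set0 \/ (is_subring V /\ ~ V pp^-1).
have [F FP tot|V [PV maxV]] := @Zorn_bigcup algC P.
  have [[V FV [x Vx]]|empty] := pselect (exists2 V, F V & V !=set0); last first.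
    left; rewrite -subset0 => x [V FV Vx]; apply: empty; exists V => //; by exists x.
  have sub W y : F W -> W y -> is_subring W /\ ~ W pp^-1.
    by move=> FW Wy; have [W0|//] := FP W FW; rewrite W0 in Wy.
  have two y z : (\bigcup_(X in F) X) y -> (\bigcup_(X in F) X) z ->
      exists2 X, F X & X y /\ X z.
    move=> [X FX Xy] [Y FY Yz]; have [XY|YX] := tot X Y FX FY.
      by exists Y => //; split=> //; apply: XY.
    by exists X => //; split=> //; apply: YX.
  right; split; last by move=> [X FX Xp]; have [_] := sub X _ FX Xp.
  split.
  - by exists V => //; have [[]] := sub V x FV Vx.
  - move=> y z /two /[apply] -[X FX [Xy Xz]]; exists X => //.
    by have [[_ B _] _] := sub X y FX Xy; apply: B.
  - move=> y z /two /[apply] -[X FX [Xy Xz]]; exists X => //.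
    by have [[_ _ M] _] := sub X y FX Xy; apply: M.
case: PV => [V0|[Vr Vp]].
  exfalso; apply: (maxV [set x | exists a : int, x = a%:~R]).
    rewrite V0; split; last by move=> /(_ 1); apply; exists 1.
    exact: sub0set.
  right; split; first split.
  - by exists 1.
  - by move=> x y [a ->] [b ->]; exists (a - b); rewrite rmorphB.
  - by move=> x y [a ->] [b ->]; exists (a * b); rewrite rmorphM.
  move=> [a ha]; have /eqP : (a * p%:Z)%:~R = 1 :> algC.
    by rewrite intrM -ha mulVf.
  rewrite -(rmorph1 (intmul 1)) eqr_int => /eqP E.
  have /eqP := congr1 absz E; rewrite abszM /= => /eqP h.
  have : (p %| 1)%N by rewrite -h dvdn_mull.
  by rewrite dvdn1 => /eqP p1; move: p_prime; rewrite p1.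
exists V; split=> // W Wr VW Wp x Wx; apply: contrapT => nVx.
by apply: (maxV W); [split=> // WV; apply/nVx/WV|right].
Qed.

Variable V : set algC.
Hypotheses (Vr : is_subring V) (Vp : ~ V pp^-1).
Hypothesis Vmax : forall W : set algC, is_subring W -> V `<=` W -> ~ W pp^-1 -> W `<=` V.

Let V1 : V 1. Proof. by case: Vr. Qed.
Let VB x y : V x -> V y -> V (x - y). Proof. by case: Vr => _ + _; apply. Qed.
Let VM x y : V x -> V y -> V (x * y). Proof. by case: Vr => _ _; apply. Qed.
Let V0 : V 0. Proof. by rewrite -(subrr 1); apply: VB. Qed.
Let VN x : V x -> V (- x). Proof. by move=> h; rewrite -sub0r; apply: VB. Qed.
Let VD x y : V x -> V y -> V (x + y). Proof. by move=> h k; rewrite -[y]opprK; apply/VB/VN. Qed.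
Let VX x n : V x -> V (x ^+ n). Proof. by move=> h; elim: n => // n IH; rewrite exprS; apply: VM. Qed.
Let Vnat n : V n%:R. Proof. by elim: n => // n IH; rewrite -addn1 natrD; apply: VD. Qed.
Let Vsum (I : Type) (r : seq I) (Q : pred I) (f : I -> algC) :
  (forall i, Q i -> V (f i)) -> V (\sum_(i <- r | Q i) f i).
Proof. by move=> h; elim/big_ind: _ => //; exact: VD. Qed.

Let adjoin x : set algC := [set y | exists h : {poly algC}, (forall i, V h`_i) /\ y = h.[x]].

(** Maximality: the ring [V[x]] is strictly larger than [V], so it contains [1/p]. *)
Let adjoin_p x : ~ V x -> adjoin x pp^-1.
Proof.
move=> nVx; apply: contrapT => h; apply/nVx/(Vmax _ _ h).
- split.
  + by exists 1; split=> [i|]; rewrite ?hornerC // coef1; case: (i == 0)%N.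
  + move=> y z [g [Vg ->]] [k [Vk ->]]; exists (g - k); split=> [i|]; rewrite ?hornerD ?hornerN //.
    by rewrite coefB; apply: VB.
  + move=> y z [g [Vg ->]] [k [Vk ->]]; exists (g * k); split=> [i|]; rewrite ?hornerM //.
    by rewrite coefM; apply: Vsum => l _; apply: VM.
- by move=> y Vy; exists y%:P; split=> [i|]; rewrite ?hornerC // coefC; case: (i == 0)%N.
- by exists 'X; split=> [i|]; rewrite ?hornerX // coefX; case: (i == 1)%N.
Qed.

(** Says that p lies in every maximal ideal of [V]. If the inverse of [u = 1 + p c] were not in [V],
    then [1/p] would be a polynomial in [u^-1] over [V]; multiplying by a power of [u], again of the
    form [1 + p c'], would put [1/p] in [V]. *)
Let unit1p c : V c -> 1 + pp * c != 0 /\ V (1 + pp * c)^-1.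
Proof.
move=> Vc; set u := 1 + _.
have u0 : u != 0.
  apply/eqP => h; apply: Vp; have -> : pp^-1 = - c; last exact: VN.
  apply: (mulfI pp0); rewrite mulfV // mulrN; move/eqP: h.
  by rewrite addr_eq0 => /eqP.
split=> //; apply: contrapT => /adjoin_p[h [Vh hE]]; apply: Vp.
have [c' Vc' uc'] : exists2 c', V c' & u ^+ (size h) = 1 + pp * c'.
  elim: (size h) => [|n [c' Vc' IH]]; first by exists 0; rewrite ?mulr0 ?addr0.
  exists (c' + c + pp * c * c'); first by do ?[apply: VD => //]; do ?[apply: VM => //].
  by rewrite exprS IH /u; ring.
have Vs : V (u ^+ size h / pp).
  rewrite hE horner_coef mulr_sumr; apply: Vsum => i _.
  have -> : u ^+ size h = u ^+ (size h - i) * u ^+ i.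
    by rewrite -exprD subnK // ltnW.
  rewrite mulrCA -mulrA -exprMn mulfV // expr1n mulr1; apply: VM => //; apply: VX.
  by apply: VD => //; apply: VM.
have -> : pp^-1 = u ^+ size h / pp - c'.
  by rewrite uc' mulrDl mul1r [pp * _]mulrC mulfK // addrK.
exact: VB.
Qed.

Let rel m x := exists g : {poly algC}, [/\ forall i, V g`_i, (size g <= m.+1)%N & 1 = pp * g.[x]].

(** Chevalley's descent on the degrees of two relations [1 = p g(x)] and [1 = p k(1/x)]. The one of
    smaller degree eliminates the top term of the other; in degree 0 a relation says that [1/p] is
    in [V]. *)
Let no_relations N m l x : x != 0 -> (m + l <= N)%N -> rel m x -> rel l x^-1 -> False.
Proof.
elim: N m l x => [|N IH] m l x x0.
  rewrite leqn0 addn_eq0 => /andP[/eqP-> _] [g [Vg sg gE]] _; apply: Vp.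
  have -> : pp^-1 = g`_0; last exact: Vg.
  apply: (mulfI pp0); rewrite mulfV // [LHS]gE; congr (_ * _).
  by rewrite (horner_coef_wide _ sg) big_ord1 expr0 mulr1.
wlog lm : m l x x0 / (l <= m)%N.
  move=> H mlN rm rl; have [lm|/ltnW ml] := leqP l m; first exact: (H m l x).
  by apply: (H l m x^-1); rewrite ?invr_eq0 ?invrK // addnC.
move=> mlN [g [Vg sg gE]] rl; have [k [Vk sk kE]] := rl.
have [l0|l0] := posnP l.
  apply: Vp; have -> : pp^-1 = k`_0; last exact: Vk.
  apply: (mulfI pp0); rewrite mulfV // [LHS]kE; congr (_ * _).
  by rewrite l0 in sk; rewrite (horner_coef_wide _ sk) big_ord1 expr0 mulr1.
case: m lm mlN sg => [|m] lm mlN sg; first by lia.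
have [e0 Ve] := unit1p (VN (Vk 0%N)); set e := (_^-1) in Ve.
(* The second relation gives [(1 - p k_0) x^(m+1) = p (k_1 x^m + k_2 x^(m-1) + ...)], where
   [1 - p k_0] has the inverse [e] in [V]; this replaces the top power of [x] in [g]. *)
pose g' := \poly_(i < m.+1) (g`_i + pp * e * g`_m.+1 * k`_(m.+1 - i)).
apply: (IH m l x) => //.
exists g'; split; last 1 first.
- rewrite horner_poly; under eq_bigr => i _ do rewrite mulrDl.
  rewrite big_split /= [LHS]gE (horner_coef_wide _ sg) big_ord_recr /=; congr (_ * (_ + _)).
  rewrite (reindex_inj rev_ord_inj) /=.
  have E : 1 - pp * k`_0 = pp * \sum_(i < m.+1) k`_i.+1 * x^-1 ^+ i.+1.
    rewrite [X in X - _]kE (@horner_coef_wide _ m.+2); last by lia.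
    by rewrite big_ord_recl expr0 mulr1 mulrDr /= addrC addKr.
  have eE : e * (1 - pp * k`_0) = 1 by rewrite /e -mulrN mulVf.
  rewrite -[LHS]mulr1 -[X in _ * X = _]eE E !mulr_sumr; apply: eq_bigr => i _.
  rewrite (_ : m.+1 - (m.+1 - i.+1) = i.+1)%N; last by have := ltn_ord i; lia.
  have -> : x ^+ m.+1 = x ^+ (m.+1 - i.+1) * x ^+ i.+1.
    by rewrite -exprD subnK //; exact: ltn_ord.
  have : x ^+ i.+1 * x^-1 ^+ i.+1 = 1 by rewrite -exprMn mulfV // expr1n.
  set a := x ^+ (_ - _); set b := x ^+ _; set c := x^-1 ^+ _ => bc.
  by transitivity (pp * e * g`_m.+1 * k`_i.+1 * a * (b * c)); [ring|rewrite bc; ring].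
- move=> i; rewrite coef_poly; case: ifP => // _.
  by apply: VD => //; do ?[apply: VM => //].
- exact: size_poly.
Qed.

Lemma valuation_ring x : x != 0 -> V x \/ V x^-1.
Proof.
move=> x0; apply: contrapT => /not_orP[/adjoin_p[g [Vg gE]] /adjoin_p[k [Vk kE]]].
apply: (@no_relations _ (size g) (size k) x x0 (leqnn _)).
  by exists g; rewrite -gE mulfV.
by exists k; rewrite -kE mulfV.
Qed.

Let unit y := V y /\ V y^-1.
Let unitM x y : unit x -> unit y -> unit (x * y).
Proof. by move=> [a b] [c d]; split; rewrite ?invfM; apply: VM. Qed.
Let unitV x : unit x -> unit x^-1.
Proof. by move=> [a b]; split; rewrite ?invrK. Qed.
Let unitX x n : unit x -> unit (x ^+ n).
Proof. by move=> [a b]; split; rewrite -?exprVn; apply: VX. Qed.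

(** Bezout: [n a = 1 + p b], and [1 + p b] is a unit. *)
Let unit_coprime (n : nat) : coprime n p -> unit n%:R.
Proof.
move=> np; have n0 : (0 < n)%N.
  case: n np => //; rewrite /coprime gcd0n => /eqP p1; move: p_prime; by rewrite p1.
split; first exact: Vnat.
have [[a b] /= ab] := @coprimeP n p n0 np.
have E : n%:R * a%:R = 1 + pp * b%:R.
  by rewrite -!natrM -[1]/(1%:R) -natrD; congr _%:R; lia.
have [u0 Vu] := unit1p (Vnat b).
have a0 : a%:R != 0 :> algC by move: u0; rewrite -E mulf_eq0 negb_or => /andP[].
have -> : n%:R^-1 = a%:R * (1 + pp * b%:R)^-1 by rewrite -E invfM mulrCA mulfV ?mulr1.
exact: VM.
Qed.

Let unit_nat (n : nat) : (0 < n)%N -> unit (n%:R / pp ^+ logn p n).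
Proof.
move=> n0; have [m pm nE] := pfactor_coprime p_prime n0.
rewrite {1}nE natrM natrX mulfK ?expf_neq0 //; apply: unit_coprime.
by rewrite coprime_sym.
Qed.

Let unit_rat (q : rat) : q != 0 ->
  unit (ratr q * pp ^+ logn p `|denq q| / pp ^+ logn p `|numq q|).
Proof.
move=> q0; have [a0 b0] : (0 < `|numq q|)%N /\ (0 < `|denq q|)%N.
  by rewrite !absz_gt0 numq_eq0 q0 denq_neq0.
have := unitM (unit_nat a0) (unitV (unit_nat b0)).
have -> : (`|numq q|%:R / pp ^+ logn p `|numq q|) * (`|denq q|%:R / pp ^+ logn p `|denq q|)^-1
    = `|numq q|%:R / `|denq q|%:R * pp ^+ logn p `|denq q| / pp ^+ logn p `|numq q| :> algC.
  by rewrite invfM invrK; ring.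
have -> : `|denq q|%:R = (denq q)%:~R :> algC by rewrite -{2}absz_denq.
have [qp|qn] := leP 0 (numq q).
  have -> : `|numq q|%:R = (numq q)%:~R :> algC by rewrite -{2}(gez0_abs qp).
  by [].
have -> : `|numq q|%:R = - (numq q)%:~R :> algC.
  by rewrite -rmorphN -(ltz0_abs qn).
rewrite !mulNr; have unitN y : unit (- y) -> unit y.
  by move=> [/VN a /VN b]; move: a b; rewrite opprK invrN opprK; split.
exact: unitN.
Qed.

(** Divisibility in a valuation ring is a total preorder, so a finite family has a term that divides
    all the others. *)
Let dominant n (T : nat -> algC) : (exists2 i, (i < n)%N & T i != 0) ->
  exists i, [/\ (i < n)%N, T i != 0 & forall j, (j < n)%N -> V (T j / T i)].
Proof.
elim: n => [|n IH]; first by case.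
have [/IH[i [hi Ti domi]]|none] := pselect (exists2 i, (i < n)%N & T i != 0); last first.
  move=> [i]; rewrite ltnS leq_eqVlt => /orP[/eqP->|hi] Ti; last by case: none; exists i.
  exists n; split=> // j; rewrite ltnS leq_eqVlt => /orP[/eqP->|hj]; first by rewrite mulfV.
  have -> : T j = 0 by apply/eqP; apply: contrapT => /negP h; apply: none; exists j.
  by rewrite mul0r.
move=> _; have [Tn|Tn] := eqVneq (T n) 0.
  exists i; split=> //; first exact: ltnW.
  by move=> j; rewrite ltnS leq_eqVlt => /orP[/eqP->|/domi//]; rewrite Tn mul0r.
have [|Vni|] := @valuation_ring (T n / T i); first by rewrite mulf_neq0 ?invr_eq0.
  exists i; split=> //; first exact: ltnW.
  by move=> j; rewrite ltnS leq_eqVlt => /orP[/eqP->|/domi].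
rewrite invfM invrK mulrC => Vin; exists n; split=> // j.
rewrite ltnS leq_eqVlt => /orP[/eqP->|/domi h]; first by rewrite mulfV.
have -> : T j / T n = T j / T i * (T i / T n) by field; rewrite Ti Tn.
exact: VM.
Qed.

(** The maximal ideal of [V]. The guard [y != 0] admits 0, whose inverse is 0 by convention and
    hence lies in [V]. *)
Let nonunit y := V y /\ (y != 0 -> ~ V y^-1).
Let nonunitD x y : nonunit x -> nonunit y -> nonunit (x + y).
Proof.
have [->|x0] := eqVneq x 0; first by rewrite add0r.
have [->|y0] := eqVneq y 0; first by rewrite addr0.
move=> [Vx nx] [Vy ny]; split=> [|xy0 Vxy]; first exact: VD.
have [|h|] := @valuation_ring (x / y); first by rewrite mulf_neq0 ?invr_eq0.
  apply: (ny y0); have -> : y^-1 = (x / y + 1) * (x + y)^-1 by field; rewrite xy0.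
  by apply: VM => //; apply: VD.
rewrite invfM invrK mulrC => h.
apply: (nx x0); have -> : x^-1 = (y / x + 1) * (x + y)^-1 by field; rewrite xy0.
by apply: VM => //; apply: VD.
Qed.

(** Shows that the values are rational multiples of the value of p. Among the terms of the minimal
    equation of [x], divided by a dominant one, another must be a unit, since otherwise -1 would be
    a sum of non-units; comparing the two terms makes a power of [x] a unit times a rational
    number. *)
Let unit_power x : x != 0 -> exists m a b, (0 < m)%N /\ unit (x ^+ m * pp ^+ a / pp ^+ b).
Proof.
move=> x0; have [P [PE Pm] _] := minCpolyP x.
pose T i := ratr P`_i * x ^+ i : algC.
have sT : \sum_(i < size P) T i = 0.
  have := root_minCpoly x; rewrite /root PE => /eqP h; rewrite -[RHS]h.
  rewrite (@horner_coef_wide _ (size P)) ?size_map_poly //.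
  by apply: eq_bigr => i _; rewrite coef_map.
have P0 : P != 0 by exact: monic_neq0.
have s0 : (0 < size P)%N by rewrite size_poly_gt0.
have [|i [hi Ti dom]] := @dominant (size P) T.
  exists (size P).-1; first by rewrite ltn_predL.
  rewrite mulf_neq0 ?expf_neq0 // fmorph_eq0.
  by rewrite -[_`__]/(lead_coef P) lead_coef_eq0.
have Pi : P`_i != 0 by move: Ti; rewrite /T mulf_eq0 negb_or fmorph_eq0 => /andP[].
have [[j [hj ji Tj uj]]|none] := pselect (exists j, [/\ (j < size P)%N, j != i, T j != 0 & unit (T j / T i)]).
  have Pj : P`_j != 0 by move: Tj; rewrite /T mulf_eq0 negb_or fmorph_eq0 => /andP[].
  have gap k l : (k < l)%N -> P`_k != 0 -> P`_l != 0 -> unit (T l / T k) ->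
      exists m a b, (0 < m)%N /\ unit (x ^+ m * pp ^+ a / pp ^+ b).
    move=> kl Pk Pl u; set q := P`_k / P`_l.
    have q0 : q != 0 by rewrite mulf_neq0 ?invr_eq0.
    exists (l - k)%N, (logn p `|denq q|), (logn p `|numq q|); split; first by rewrite subn_gt0.
    have := unitM u (unit_rat q0); congr (unit _).
    have -> : T l = ratr P`_l * (x ^+ (l - k) * x ^+ k) by rewrite -exprD subnK // ltnW.
    have -> : ratr q = ratr P`_k / ratr P`_l :> algC by rewrite /q rmorphM fmorphV.
    rewrite /T; have : x ^+ k != 0 by rewrite expf_neq0.
    have : ratr P`_l != 0 :> algC by rewrite fmorph_eq0.
    have : ratr P`_k != 0 :> algC by rewrite fmorph_eq0.
    have : pp ^+ logn p `|numq q| != 0 by rewrite expf_neq0.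
    move: (pp ^+ logn p `|numq q|) (pp ^+ _) (ratr _) (ratr _) (x ^+ _) (x ^+ _).
    by move=> d1 d2 d3 d4 d5 d6 *; field; apply/and4P; split.
  case: (ltngtP i j) ji => // ij _; first exact: (gap i j).
  by apply: (gap j i) => //; have := unitV uj; rewrite invfM invrK mulrC.
have nu j : (j < size P)%N -> j != i -> nonunit (T j / T i).
  move=> hj ji; split=> [|t0 Vt]; first exact: dom.
  apply: none; exists j; split=> //; last by split=> //; exact: dom.
  by move: t0; rewrite mulf_eq0 negb_or => /andP[].
have : nonunit (-1).
  have -> : -1 = \sum_(j < size P | j != Ordinal hi) T j / T i.
    apply/eqP; rewrite eq_sym -addr_eq0 -mulr_suml; apply/eqP.
    rewrite -[X in _ + X](mulfV Ti) -mulrDl addrC -[RHS](mul0r (T i)^-1) -[X in _ = X / _]sT; congr (_ / _).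
    by rewrite [RHS](bigD1 (Ordinal hi)).
  elim/big_ind: _ => [|y z|j ji]; first by split; rewrite ?eqxx.
    exact: nonunitD.
  exact: nu.
by move=> [_]; rewrite oppr_eq0 oner_eq0 invrN1 => h; case: (h isT (VN V1)).
Qed.

Lemma valuation_ringP : [/\ forall x, x != 0 -> V x \/ V x^-1,
  forall q : rat, q != 0 ->
    unit (ratr q * pp ^+ logn p `|denq q| / pp ^+ logn p `|numq q|) &
  forall x, x != 0 -> exists m a b, (0 < m)%N /\ unit (x ^+ m * pp ^+ a / pp ^+ b)].
Proof. by split; [exact: valuation_ring|exact: unit_rat|exact: unit_power]. Qed.
End ValuationRing.

(** * The p-adic absolute value on Qbar *)

Section PadicExtension.
Variables (R : realType) (p : nat) (p_prime : prime p).
Local Notation pp := (p%:R : algC).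
Let pp0 : pp != 0. Proof. by rewrite pnatr_eq0 -lt0n prime_gt0. Qed.
Let p1 : 1 < p%:R :> R. Proof. by rewrite ltr1n prime_gt1. Qed.
Let p0 : 0 < p%:R :> R. Proof. exact: lt_trans ltr01 p1. Qed.

Variable V : set algC.
Hypotheses (Vr : is_subring V) (Vp : ~ V pp^-1).
Hypothesis V_val : forall x, x != 0 -> V x \/ V x^-1.
Let unit y := V y /\ V y^-1.
Hypothesis unit_rat : forall q : rat, q != 0 ->
    unit (ratr q * pp ^+ logn p `|denq q| / pp ^+ logn p `|numq q|).
Hypothesis unit_power : forall x, x != 0 ->
  exists m a b, (0 < m)%N /\ unit (x ^+ m * pp ^+ a / pp ^+ b).

Let V1 : V 1. Proof. by case: Vr. Qed.
Let VB x y : V x -> V y -> V (x - y). Proof. by case: Vr => _ + _; apply. Qed.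
Let VM x y : V x -> V y -> V (x * y). Proof. by case: Vr => _ _; apply. Qed.
Let V0 : V 0. Proof. by rewrite -(subrr 1); apply: VB. Qed.
Let VN x : V x -> V (- x). Proof. by move=> h; rewrite -sub0r; apply: VB. Qed.
Let VD x y : V x -> V y -> V (x + y). Proof. by move=> h k; rewrite -[y]opprK; apply/VB/VN. Qed.
Let VX x n : V x -> V (x ^+ n). Proof. by move=> h; elim: n => // n IH; rewrite exprS; apply: VM. Qed.
Let Vpp : V pp. Proof. by elim: p => // n IH; rewrite -addn1 natrD; apply: VD. Qed.
Let unitM x y : unit x -> unit y -> unit (x * y).
Proof. by move=> [a b] [c d]; split; rewrite ?invfM; apply: VM. Qed.
Let unitV x : unit x -> unit x^-1.
Proof. by move=> [a b]; split; rewrite ?invrK. Qed.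
Let unitX x n : unit x -> unit (x ^+ n).
Proof. by move=> [a b]; split; rewrite -?exprVn; apply: VX. Qed.

Let V_ppow a b : V (pp ^+ a / pp ^+ b) -> (b <= a)%N.
Proof.
move=> h; rewrite leqNgt; apply/negP => ab; apply: Vp.
have -> : pp^-1 = pp ^+ a / pp ^+ b * pp ^+ (b - a.+1).
  have -> : pp ^+ b = pp ^+ a * pp * pp ^+ (b - a.+1) by rewrite -exprSr -exprD subnKC.
  have : pp ^+ (b - a.+1) != 0 by rewrite expf_neq0.
  have : pp ^+ a != 0 by rewrite expf_neq0.
  by move: pp0; move: pp (pp ^+ a) (pp ^+ _) => x y z *; field; apply/and3P.
by apply: VM => //; apply: VX.
Qed.

(* [val x r] reads |x| = p^r. *)
Let val (x : algC) (r : R) := exists m a b, [/\ (0 < m)%N,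
  unit (x ^+ m * pp ^+ a / pp ^+ b) & r = (a%:R - b%:R) / m%:R].

Let val_ex x : x != 0 -> exists r, val x r.
Proof. by move=> /unit_power[m [a [b [m0 u]]]]; exists ((a%:R - b%:R) / m%:R), m, a, b. Qed.

Let neq0_pow n : pp ^+ n != 0. Proof. exact: expf_neq0. Qed.

Let valM x y r s : val x r -> val y s -> val (x * y) (r + s).
Proof.
move=> [m [a [b [m0 u ->]]]] [m' [a' [b' [m0' u' ->]]]].
exists (m * m')%N, (a * m' + a' * m)%N, (b * m' + b' * m)%N; split.
- by rewrite muln_gt0 m0.
- have := unitM (unitX m' u) (unitX m u'); congr (unit _).
  rewrite !expr_div_n !exprMn -!exprM !exprD (mulnC m' m) invfM.
  move: (x ^+ _) (y ^+ _) (_ ^-1) (_ ^-1) (pp ^+ _) (pp ^+ _) => x1 x2 x3 x4 x5 x6.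
  by ring.
have mR : m%:R != 0 :> R by rewrite pnatr_eq0 -lt0n.
have mR' : m'%:R != 0 :> R by rewrite pnatr_eq0 -lt0n.
by rewrite !natrD !natrM; field; rewrite mR mR'.
Qed.

Let valV x r : val x r -> val x^-1 (- r).
Proof.
move=> [m [a [b [m0 u ->]]]]; exists m, b, a; split=> //.
  by have := unitV u; rewrite !invfM invrK exprVn; congr (unit _); ring.
by rewrite -mulNr opprB.
Qed.

Let val_V x r : x != 0 -> val x r -> V x <-> r <= 0.
Proof.
move=> x0 [m [a [b [m0 u ->]]]].
have mR : 0 < m%:R :> R by rewrite ltr0n.
rewrite pmulr_lle0 ?invr_gt0 // subr_le0 ler_nat; split => [Vx|ab].
  apply: (@V_ppow b a); have [_] := u; rewrite !invfM invrK => h.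
  have -> : pp ^+ b / pp ^+ a = x ^+ m * ((x ^+ m)^-1 / pp ^+ a * pp ^+ b).
    have := neq0_pow a; have : x ^+ m != 0 by rewrite expf_neq0.
    by move: (pp ^+ a) (pp ^+ b) (x ^+ m) => *; field; apply/andP.
  by apply: VM; first exact: VX.
have Vxm : V (x ^+ m).
  have -> : x ^+ m = x ^+ m * pp ^+ a / pp ^+ b * pp ^+ (b - a).
    have -> : pp ^+ b = pp ^+ (b - a) * pp ^+ a by rewrite -exprD subnK.
    have := neq0_pow a; have := neq0_pow (b - a).
    by move: (pp ^+ a) (pp ^+ _) (x ^+ m) => *; field; apply/andP.
  by apply: VM; [have [] := u|exact: VX].
(* A valuation ring is closed under m-th roots: if [1/x] is in [V], then so is
   [x = x^m (1/x)^(m-1)]. *)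
have [//|Vi] := V_val x0.
case: m m0 Vxm {u mR} => // m _ Vxm.
have -> : x = x ^+ m.+1 * x^-1 ^+ m by rewrite exprS -mulrA -exprMn mulfV // expr1n mulr1.
by apply: VM => //; apply: VX.
Qed.

Let val_uniq x r s : x != 0 -> val x r -> val x s -> r = s.
Proof.
move=> x0 h k; have H y t : val y t -> y = 1 -> t = 0.
  move=> hy y1; apply/eqP; rewrite eq_le.
  have := val_V _ hy; rewrite y1 oner_eq0 => /(_ isT)[-> //] _.
  have := val_V _ (valV hy); rewrite y1 invr1 oner_eq0 oppr_le0 => /(_ isT)[-> //].
by apply/eqP; rewrite -subr_eq0; apply/eqP/(H (x / x)); [exact: valM (valV _)|rewrite mulfV].
Qed.

Let ex_w : exists w : algC -> R, w 0 = 0 /\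
  forall x, x != 0 -> exists2 r, val x r & w x = p%:R `^ r.
Proof.
have h x : exists y, (x = 0 -> y = 0) /\ (x != 0 -> exists2 r, val x r & y = p%:R `^ r).
  have [->|x0] := eqVneq x 0; first by exists 0; split.
  have [r hr] := val_ex x0; exists (p%:R `^ r); split=> [/eqP|_]; first by rewrite (negPf x0).
  by exists r.
have [w hw] := choice h; exists w; split=> [|x x0]; first by case: (hw 0) => h0 _; exact: h0.
by case: (hw x) => _; exact.
Qed.

Let p0n : p%:R != 0 :> R. Proof. by rewrite gt_eqF. Qed.
Let lnp0 : 0 < ln p%:R :> R. Proof. exact: ln_gt0. Qed.
Let powp_le1 (r : R) : (p%:R `^ r <= 1) = (r <= 0).
Proof.
rewrite -[X in _ <= X](@powRr0 _ p%:R); apply/idP/idP => h; last by apply: ler_powR => //; exact: ltW.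
move: h; rewrite -[X in is_true X -> _]ler_ln ?posrE ?powR_gt0 //.
by rewrite !ln_powR mul0r pmulr_lle0.
Qed.

Lemma padic_extension_of_valuation : exists w : algC -> R,
  [/\ is_abs_value w, forall q : rat, w (ratr q) = padic_abs R p q &
      forall x y, w (x + y) <= Num.max (w x) (w y)].
Proof.
have [w [w0 wE]] := ex_w.
have wpos x : x != 0 -> 0 < w x.
  by move=> /wE[r _ ->]; rewrite powR_gt0.
have wge0 x : 0 <= w x.
  by have [->|/wpos/ltW//] := eqVneq x 0; rewrite w0.
have wM x y : w (x * y) = w x * w y.
  have [->|x0] := eqVneq x 0; first by rewrite mul0r w0 mul0r.
  have [->|y0] := eqVneq y 0; first by rewrite mulr0 w0 mulr0.
  have [r hr ->] := wE _ x0; have [s hs ->] := wE _ y0.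
  have xy0 : x * y != 0 by rewrite mulf_neq0.
  have [t ht ->] := wE _ xy0; rewrite (val_uniq xy0 ht (valM hr hs)).
  by rewrite powRD ?p0n ?implybT.
have wV x : w x <= 1 <-> V x.
  have [->|x0] := eqVneq x 0; first by rewrite w0 ler01.
  by have [r hr ->] := wE _ x0; rewrite powp_le1; split=> /(val_V x0 hr).
(* The ultrametric inequality is closure of [V] under adding 1, applied to [x / y]. *)
have ultra x y : w x <= w y -> w (x + y) <= w y.
  have [->|y0] := eqVneq y 0; first by rewrite w0 addr0.
  move=> xy; have -> : x + y = (x / y + 1) * y by field.
  rewrite wM; apply: ler_piMl => //; apply/wV/VD => //; apply/wV.
  rewrite -(ler_pM2r (wpos _ y0)) -wM mulfVK ?mul1r //.
have wmax x y : w (x + y) <= Num.max (w x) (w y).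
  rewrite /Num.max; case: ifP => [/ltW/ultra//|/negbT]; rewrite -leNgt addrC; exact: ultra.
exists w; split=> //.
  split=> // [x|x y].
    split=> [h|->//]; apply/eqP; apply: contrapT => /negP/wpos; by rewrite h ltxx.
  by apply: le_trans (wmax x y) _; rewrite ge_max lerDl lerDr !wge0.
move=> q; rewrite /padic_abs; have [->|q0] := eqVneq q 0; first by rewrite rmorph0.
have rq0 : ratr q != 0 :> algC by rewrite fmorph_eq0.
have [r hr ->] := wE _ rq0.
have -> : r = (logn p `|denq q|)%:R - (logn p `|numq q|)%:R.
  apply: (val_uniq rq0 hr); exists 1%N, (logn p `|denq q|), (logn p `|numq q|).
  by split=> //; rewrite ?divr1 // expr1; exact: unit_rat.
by rewrite powRB ?p0n ?implybT ?powR_mulrn ?(ltW p0).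
Qed.
End PadicExtension.

Lemma padic_extension (R : realType) p : prime p -> exists w : algC -> R,
  [/\ is_abs_value w, forall q : rat, w (ratr q) = padic_abs R p q &
      forall x y, w (x + y) <= Num.max (w x) (w y)].
Proof.
move=> pp; have [V [Vr Vp Vmax]] := maximal_subring pp.
have [h1 h2 h3] := valuation_ringP pp Vr Vp Vmax.
exact: (padic_extension_of_valuation R pp Vr Vp h1 h2 h3).
Qed.

(** * The archimedean absolute value on Qbar *)

Section ArchimedeanExtension.
Variable R : realType.

Lemma algC_rat_approx (x : algC) (e : rat) : 0 <= x -> 0 < e ->
  exists2 q : rat, 0 <= q & ratr q <= x < ratr (q + e).
Proof.
move=> x0 e0; have re0 : 0 < ratr e :> algC by rewrite ltr0q.
have /truncn_itv/andP[] : 0 <= x / ratr e by rewrite divr_ge0 // ltW.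
rewrite ler_pdivlMr // ltr_pdivrMr //; set n := Num.trunc _ => h1 h2.
exists (n%:R * e); first by rewrite mulr_ge0 ?ler0n // ltW.
have E : ratr (n%:R * e) = n%:R * ratr e :> algC by rewrite rmorphM /= ratr_nat.
rewrite rmorphD /= E h1 /=; apply: lt_le_trans h2 _.
by rewrite -[n.+1]addn1 natrD mulrDl mul1r.
Qed.

(** The modulus on [algC] has its values in [algC] itself. It is transported to [R] through its
    Dedekind cut, the set of rationals below it. *)
Let cut (x : algC) : set R := [set ratr q | q in [set q : rat | ratr q <= `|x|]].
Let w x := sup (cut x).

Let cut_sup x : has_sup (cut x).
Proof.
split; first by exists (ratr 0), 0 => //=; rewrite rmorph0.
have [q _ /andP[_ h]] := algC_rat_approx (normr_ge0 x) (e := 1) ltr01.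
exists (ratr (q + 1)) => _ [r /= rx <-]; rewrite ler_rat -(ler_rat algC).
exact: le_trans rx (ltW h).
Qed.

Let w_lo x q : ratr q <= `|x| -> ratr q <= w x.
Proof. by move=> h; apply: ub_le_sup; [case: (cut_sup x)|exists q]. Qed.

Let w_up x q : `|x| <= ratr q -> w x <= ratr q.
Proof.
move=> h; apply: ge_sup; first by case: (cut_sup x).
by move=> _ [r /= rx <-]; rewrite ler_rat -(ler_rat algC); exact: le_trans rx h.
Qed.

Let w_approx x (e : rat) : 0 < e -> exists q : rat,
  [/\ 0 <= q, ratr q <= `|x|, `|x| < ratr (q + e) & (ratr q : R) <= w x <= ratr q + ratr e].
Proof.
move=> e0; have [q q0 /andP[a b]] := algC_rat_approx (normr_ge0 x) e0.
by exists q; split=> //; rewrite w_lo //= -rmorphD w_up // ltW.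
Qed.

Let rat_small (e : R) : 0 < e -> exists2 r : rat, 0 < r & 0 < (ratr r : R) < e.
Proof.
move=> e0; have [q] := rat_in_itvoo e0.
by rewrite in_itv /= => /andP[q0 qe]; exists q; [rewrite -(ltr0q R)|rewrite q0].
Qed.

Lemma archimedean_extension : exists w : algC -> R,
  is_abs_value w /\ forall q : rat, w (ratr q) = `|ratr q|.
Proof.
exists w; have wge0 x : 0 <= w x.
  by have [q [q0 _ _ /andP[h _]]] := w_approx x ltr01; apply: le_trans h; rewrite ler0q.
have wq q : w (ratr q) = `|ratr q|.
  rewrite -ratr_norm; apply/eqP; rewrite eq_le; apply/andP; split.
    by apply: w_up; rewrite -ratr_norm.
  by apply: w_lo; rewrite -ratr_norm.
split=> //; split=> // [x|x y|x y].
- split=> [|->]; last by rewrite -(rmorph0 ratr) wq rmorph0 normr0.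
  move=> wx; apply/eqP; rewrite -normr_eq0 eq_le normr_ge0 andbT.
  apply/negPn/negP => h; have x0 : 0 < `|x| by rewrite lt0r normr_ge0 andbT; apply: contra h => /eqP->.
  have [q q0 /andP[_ hq]] := algC_rat_approx (x := `|x|^-1) (e := 1) (ltW (etrans (invr_gt0 _) x0)) ltr01.
  have q1 : 0 < q + 1 by rewrite ltr_pwDr.
  have : ratr (q + 1)^-1 <= `|x|.
    rewrite fmorphV -[leRHS]invrK lef_pV2 ?posrE ?invr_gt0 ?ltr0q //; exact: ltW.
  by move/w_lo; rewrite wx leNgt ltr0q invr_gt0 q1.
- apply/eqP; rewrite -subr_eq0 -normr_le0; apply/ler_addgt0Pr => e e0; rewrite add0r.
  (* With rational approximations within [r < 1], the product is off by at most
     [r (w x + w y + r + 1)]; hence the 2. *)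
  pose B := w x + w y + 2; have B0 : 0 < B.
    by rewrite /B; have := wge0 x; have := wge0 y; lra.
  have [|r r0] := @rat_small (Num.min 1 (e / B)); first by rewrite lt_min ltr01 divr_gt0.
  rewrite lt_min (ltr_pdivlMr (ratr r) e B0) => /and3P[rr r1 re].
  have [q1 [p1 a1 b1 /andP[c1 d1]]] := w_approx x r0.
  have [q2 [p2 a2 b2 /andP[c2 d2]]] := w_approx y r0.
  have [q [p a b /andP[c d]]] := w_approx (x * y) r0.
  have u1 : q <= (q1 + r) * (q2 + r).
    rewrite -(ler_rat algC) rmorphM; apply: le_trans a _; rewrite normrM.
    by apply: ler_pM => //; exact: ltW.
  have u2 : q1 * q2 <= q + r.
    rewrite -(ler_rat algC); apply: le_trans (ltW b); rewrite normrM rmorphM.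
    by apply: ler_pM; rewrite ?ler0q.
  move: u1 u2 p1 p2 p; rewrite -!(ler_rat R) !(rmorphM, rmorphD) !rmorph0 /=.
  move: (ratr q) (ratr q1) (ratr q2) (ratr r) c d c1 d1 c2 d2 rr r1 re => Q Q1 Q2 E.
  move=> c d c1 d1 c2 d2 E0 E1 Ee u1 u2 p1 p2 p.
  move: (w (x * y)) (w x) (w y) (wge0 x) (wge0 y) @B Ee B0 c d c1 d1 c2 d2 => W X Y X0 Y0 B Ee B0 c d c1 d1 c2 d2.
  have : E * B <= e by exact: ltW.
  rewrite ler_norml /B => h.
  have h1 : W <= (X + E) * (Y + E) + E.
    apply: le_trans d _; rewrite lerD2r; apply: le_trans u1 _; apply: ler_pM; lra.
  have h2 : X * Y <= (Q1 + E) * (Q2 + E) by apply: ler_pM; lra.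
  have h3 : E * (Q1 + Q2) <= E * (X + Y) by apply: ler_wpM2l; lra.
  have h4 : E * E <= E * 1 by apply: ler_wpM2l; lra.
  by apply/andP; split; lra.
apply/ler_addgt0Pr => e e0.
have [|r r0 /andP[rr re]] := @rat_small (e / 3); first by rewrite divr_gt0.
have [q1 [p1 a1 b1 /andP[c1 d1]]] := w_approx x r0.
have [q2 [p2 a2 b2 /andP[c2 d2]]] := w_approx y r0.
have [q [p a b /andP[c d]]] := w_approx (x + y) r0.
have : q <= (q1 + r) + (q2 + r).
  rewrite -(ler_rat algC) rmorphD; apply: le_trans a _; apply: le_trans (ler_normD _ _) _.
  by apply: lerD => //; exact: ltW.
rewrite -(ler_rat R) !rmorphD /=; lra.
Qed.
End ArchimedeanExtension.

(** * Weak approximation *)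

(* The prime [p] stands for the [p]-adic place of Q and [0] for the archimedean one. *)
Definition base_abs (R : realType) (b : nat) : rat -> R :=
  if b == 0%N then fun q => `|ratr q| else padic_abs R b.

Definition is_base (b : nat) : bool := (b == 0%N) || prime b.

Definition ultrametric (R : realType) (F : fieldType) (v : F -> R) :=
  forall x y, v (x + y) <= Num.max (v x) (v y).

(** The ultrametric inequality is recorded in the choice, since the construction provides it; the
    default value is never reached when [is_base b] holds. *)
Definition wabs (R : realType) (b : nat) : algC -> R :=
  xget (fun=> 0) [set w | [/\ is_abs_value w, forall q : rat, w (ratr q) = base_abs R b q
                          & (0 < b)%N -> ultrametric w]].

Section Bases.
Variables (R : realType) (b : nat) (hb : is_base b).

Let wabsP : [/\ is_abs_value (wabs R b), forall q : rat, wabs R b (ratr q) = base_abs R b q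
                          & (0 < b)%N -> ultrametric (wabs R b)].
Proof.
rewrite /wabs; case: xgetP => [w _ //|none]; exfalso.
move: hb => /orP[/eqP b0|bp].
  have [w [hw wE]] := archimedean_extension R; apply: (none w).
  by split; rewrite ?b0.
have [w [hw wE wu]] := padic_extension R bp; apply: (none w); split=> // q.
by rewrite wE /base_abs; case: eqP bp => // ->.
Qed.

Lemma wabs_abs : is_abs_value (wabs R b). Proof. by case: wabsP. Qed.
Lemma wabs_rat q : wabs R b (ratr q) = base_abs R b q. Proof. by case: wabsP. Qed.
Lemma wabs_ultra : (0 < b)%N -> ultrametric (wabs R b). Proof. by case: wabsP. Qed.

Lemma base_abs_abs : is_abs_value (base_abs R b).
Proof.
have := is_abs_value_comp (ratr : {rmorphism rat -> algC}) wabs_abs.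
by congr is_abs_value; apply: funext => q /=; rewrite wabs_rat.
Qed.
End Bases.

Lemma padic_abs_prime (R : realType) p r : prime p -> prime r ->
  padic_abs R p r%:R = if p == r then p%:R^-1 else 1.
Proof.
move=> pp rp; have r0 : r%:R != 0 :> rat by rewrite pnatr_eq0 -lt0n prime_gt0.
rewrite /padic_abs (negPf r0).
have [-> ->] : numq r%:R = r /\ denq r%:R = 1.
  by rewrite -[r%:R]/(r%:~R) numq_int denq_int.
by rewrite /= logn1 expr0 (logn_prime _ rp) div1r; case: eqP => _ /=; rewrite ?invr1.
Qed.

Lemma base_abs_prime (R : realType) b r : is_base b -> prime r ->
  base_abs R b r%:R = if b == 0%N then r%:R else if b == r then r%:R^-1 else 1.
Proof.
rewrite /is_base /base_abs => /orP[/eqP->|bp] rp.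
  by rewrite eqxx ratr_nat ger0_norm.
have -> : (b == 0)%N = false by case: eqP bp => // ->.
by rewrite padic_abs_prime //; case: eqP => // ->.
Qed.

(** Evaluation at the larger index, a prime [b], distinguishes the places: the [b]-adic value is
    [1/b], the archimedean one is [b], and every other is 1. *)
Lemma base_abs_inj (R : realType) b b' : is_base b -> is_base b' ->
  base_abs R b = base_abs R b' -> b = b'.
Proof.
wlog: b b' / (b' <= b)%N.
  move=> H hb hb' e; have [le|/ltnW le] := leqP b' b; first exact: H.
  by apply/esym/H.
move=> le hb hb' e; have [b0|b0] := posnP b; first by move: le; rewrite b0 leqn0 => /eqP.
have bp : prime b by move: hb; rewrite /is_base; case: eqP b0 => // ->.
have := congr1 (fun f => f b%:R) e; rewrite /= !base_abs_prime // eqxx.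
have -> : (b == 0)%N = false by rewrite gtn_eqF.
have b1 : 1 < b%:R :> R by rewrite ltr1n prime_gt1.
have : b%:R^-1 < 1 :> R by rewrite invf_lt1 // (lt_trans ltr01).
case: (b' == 0)%N => [h1 h2|]; first by move: h1; rewrite h2 ltNge ltW.
by case: eqP => // _ h1 h2; move: h1; rewrite h2 ltxx.
Qed.

Lemma base_nontrivial (R : realType) b : is_base b -> exists c, 1 < base_abs R b c.
Proof.
move=> hb; have [b0|b0] := posnP b.
  by exists 2%:R; rewrite base_abs_prime // b0 /= ltr1n.
have bp : prime b by move: hb; rewrite /is_base; case: eqP b0 => // ->.
exists (b%:R^-1); rewrite (avV (base_abs_abs R hb)) base_abs_prime // eqxx gtn_eqF //.
by rewrite invrK ltr1n prime_gt1.
Qed.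

Lemma eventually_all n (P : nat -> nat -> Prop) :
  (forall i, (i < n)%N -> exists N : nat, forall m, (N <= m)%N -> P i m) ->
  exists N : nat, forall m, (N <= m)%N -> forall i, (i < n)%N -> P i m.
Proof.
elim: n => [|n IH] h; first by exists 0%N.
have [|N hN] := eventually_and (IH _) (h n (ltnSn n)); first by move=> i hi; apply/h/ltnW.
exists N => m /hN[a b] i; rewrite ltnS leq_eqVlt => /orP[/eqP->//|]; exact: a.
Qed.

Lemma powers_eventually_large (R : realType) (a C : R) : 1 < a ->
  exists N : nat, forall m, (N <= m)%N -> C < a ^+ m.
Proof.
move=> a1; have [N hN] := powers_unbounded C a1; exists N => m hm.
by apply: lt_le_trans hN _; rewrite ler_weXn2l // ltW.
Qed.

Lemma powers_eventually_small (R : realType) (a e : R) : 0 <= a < 1 -> 0 < e ->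
  exists N : nat, forall m, (N <= m)%N -> a ^+ m < e.
Proof.
move=> /andP[a0 a1] e0; have [|N hN] := @small_powers _ a e _ e0; first by rewrite a0.
by exists N => m hm; apply: le_lt_trans hN; rewrite ler_wiXn2l // ltW.
Qed.

Definition extends (R : realType) (F : fieldType) (a : rat -> R) (v : F -> R) := is_abs_value v /\ forall q, v (ratr q) = a q.

Section WeakApproximation.
Variables (R : realType) (F : fieldType) (io : {rmorphism rat -> F}) (a : rat -> R).
Hypothesis a_nontrivial : exists c, 1 < a c.

Local Notation extends := (extends a).

(** A rational number, on which both absolute values agree, can separate them once squeezed between
    their values. It is sought among the powers of one [c] with [C = v c > 1]: they form a geometric
    progression of ratio [C], and [m] is so large that the gap exceeds the factor [C]. *)
Let rat_between (v w : F -> R) x : extends v -> extends w -> v x < w x ->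
  exists m q, v x ^+ m < v (ratr q) < w x ^+ m.
Proof.
move=> [hv vE] [hw wE] vwx; have [c c1] := a_nontrivial; rewrite -vE in c1.
have x0 : x != 0 by rewrite -(av_gt0 hw); apply: le_lt_trans vwx; exact: av_ge0.
have vx : 0 < v x by rewrite av_gt0.
have [|m hm] := @powers_unbounded _ (w x / v x) (v (ratr c)); first by rewrite ltr_pdivlMr ?mul1r.
have vm0 : 0 < v x ^+ m by rewrite exprn_gt0.
rewrite expr_div_n ltr_pdivlMr // in hm.
(* The shift by [n] brings negative powers of [c] into play and makes the least exponent [j]
   positive, so that its predecessor exists. *)
have [n hn] := powers_unbounded (v x ^+ m)^-1 c1; set C := v (ratr c) in c1 hm hn *.
have C0 : 0 < C by exact: lt_trans ltr01 c1.
have ex : exists j, v x ^+ m * C ^+ n < C ^+ j by have [j] := powers_unbounded (v x ^+ m * C ^+ n) c1; exists j.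
case: (ex_minnP ex) => j hj minj; exists m, (c ^+ j / c ^+ n).
rewrite -!(fmorph_eq_rat io) rmorphM fmorphV !rmorphXn /= !(fmorph_eq_rat io) (av_div hv) !(avX hv) -/C.
rewrite ltr_pdivlMr ?exprn_gt0 // hj /= ltr_pdivrMr ?exprn_gt0 //.
case: j hj minj => [|j] hj minj.
  by move: hn; rewrite -(ltr_pM2l vm0) mulfV ?gt_eqF // => /lt_trans/(_ hj); rewrite expr0 ltxx.
have Cj : C ^+ j <= v x ^+ m * C ^+ n.
  by rewrite leNgt; apply/negP => /minj; rewrite ltnn.
rewrite exprS; apply: (@le_lt_trans _ _ (C * (v x ^+ m * C ^+ n))).
  by rewrite ler_pM2l.
by rewrite mulrA ltr_pM2r ?exprn_gt0.
Qed.

Lemma separate (v w : F -> R) : extends v -> extends w -> v <> w -> exists y, 1 < v y /\ w y < 1.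
Proof.
move=> ev ew vw; have [hv vE] := ev; have [hw wE] := ew.
have [x /eqP] : exists x, v x <> w x by apply/existsNP => h; apply/vw/funext.
rewrite neq_lt => /orP[] /rat_between.
  move=> /(_ ev ew)[m [q /andP[h1 h2]]].
  have q0 : 0 < v (ratr q) by apply: le_lt_trans h1; rewrite exprn_ge0 ?av_ge0.
  exists (ratr q / x ^+ m); rewrite (av_div hv) (av_div hw) (avX hv) (avX hw) wE -vE.
  have w0 : 0 < w x ^+ m by apply: lt_trans h2.
  have x0 : 0 < v x ^+ m.
    by rewrite -avX // av_gt0 // -(av_gt0 hw) avX.
  by rewrite ltr_pdivlMr // ltr_pdivrMr // !mul1r.
move=> /(_ ew ev)[m [q /andP[h1 h2]]].
have q0 : 0 < w (ratr q) by apply: le_lt_trans h1; rewrite exprn_ge0 ?av_ge0.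
exists (x ^+ m / ratr q); rewrite (av_div hv) (av_div hw) (avX hv) (avX hw) vE -wE.
by rewrite ltr_pdivlMr // ltr_pdivrMr // !mul1r.
Qed.

(** Induction on the number of competitors, as in the theorem of Artin and Whaples: [x] handles the
    earlier ones and [y] the last one. *)
Lemma weak_approximation (v : F -> R) n (w : nat -> F -> R) : extends v ->
  (forall i, (i < n)%N -> extends (w i) /\ w i <> v) ->
  exists x, 1 < v x /\ forall i, (i < n)%N -> w i x < 1.
Proof.
move=> ev; have [hv _] := ev; elim: n => [|n IH] hw.
  have [c c1] := a_nontrivial; exists (ratr c); split=> //; by case: ev => _ ->.
have [|x [vx wx]] := IH; first by move=> i hi; apply/hw/ltnW.
have [ewn wnv] := hw n (ltnSn n); have [hwn _] := ewn.
have [y [vy wy]] := separate ev ewn (nesym wnv).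
have hwi i : (i < n)%N -> is_abs_value (w i) by move=> hi; have [[]] := hw i (ltnW hi).
(* In the first case a power of [x] does not increase the last value of [y], and it overwhelms [y]
   at the earlier competitors. *)
have [le1|gt1] := leP (w n x) 1.
  have [|N hN] := @eventually_all n (fun i m => w i x ^+ m < (w i y + 1)^-1).
    move=> i hi; apply: powers_eventually_small; first by rewrite av_ge0 ?wx //; exact: hwi.
    by rewrite invr_gt0 ltr_wpDl // av_ge0 //; exact: hwi.
  exists (x ^+ N * y); split.
    by rewrite (avM hv) (avX hv); apply: lt_le_trans vy _; rewrite ler_peMl ?av_ge0 ?exprn_ege1 // ltW.
  move=> i; rewrite ltnS leq_eqVlt => /orP[/eqP->|hi].
    rewrite (avM hwn) (avX hwn); apply: le_lt_trans wy.
    by rewrite ler_piMl ?av_ge0 // exprn_ile1 // av_ge0.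
  have hi' := hwi i hi; rewrite (avM hi') (avX hi'); have := hN N (leqnn N) i hi.
  have wiy := av_ge0 hi' y; have p0 : 0 < w i y + 1 by rewrite ltr_wpDl.
  rewrite -(ltr_pM2r p0) mulVf ?gt_eqF //; apply: le_lt_trans.
  by rewrite ler_wpM2l ?exprn_ge0 ?av_ge0 // lerDl.
(* Here [x^m / (1 + x^m)] tends to 1 in size where [x] is large, namely at [v] and at the last
   competitor, and to 0 at the earlier ones; [N1], [N2] and [N3] make the three estimates survive
   multiplication by [y]. *)
have [N1 h1] := powers_eventually_large (v y - 1)^-1 vx.
have [N2 h2] := powers_eventually_large (1 - w n y)^-1 gt1.
have [|N3 h3] := @eventually_all n (fun i m => w i x ^+ m < (w i y + 1)^-1).
  move=> i hi; apply: powers_eventually_small; first by rewrite av_ge0 ?wx //; exact: hwi.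
  by rewrite invr_gt0 ltr_wpDl // av_ge0 //; exact: hwi.
have [m [m1 m2 m3 m4]] : exists m, [/\ (N1 <= m)%N, (N2 <= m)%N, (N3 <= m)%N & (0 < m)%N].
  by exists (N1 + N2 + N3).+1; split; lia.
have {}h1 := h1 m m1; have {}h2 := h2 m m2; have {}h3 := h3 m m3.
set X := x ^+ m; have vX : v X = v x ^+ m by rewrite avX.
have vX1 : 1 < v X by rewrite vX exprn_egt1 // -lt0n.
have X1 : 1 + X != 0.
  apply/eqP => h; move: vX1; rewrite (_ : X = -1) ?(avN hv) ?(av1 hv) ?ltxx //.
  by apply/eqP; rewrite -addr_eq0 addrC h.
exists (X / (1 + X) * y); split.
  have vX0 : 0 < v (1 + X) by rewrite av_gt0.
  rewrite (avM hv) (av_div hv) mulrAC ltr_pdivlMr // mul1r.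
  apply: le_lt_trans (av_leD hv _ _) _; rewrite (av1 hv).
  have vy1 : 0 < v y - 1 by rewrite subr_gt0.
  move: h1; rewrite -vX -(ltr_pM2r vy1) mulVf ?gt_eqF //; lra.
move=> i; rewrite ltnS leq_eqVlt => /orP[/eqP->|hi].
  have w0 : 0 < w n (1 + X) by rewrite av_gt0.
  rewrite (avM hwn) (av_div hwn) mulrAC ltr_pdivrMr // mul1r.
  have : w n X - 1 <= w n (1 + X).
    rewrite lerBlDr -(av1 hwn); apply: le_trans (av_leB hwn _ _).
    by rewrite (addrC 1) addrK.
  have wy1 : 0 < 1 - w n y by rewrite subr_gt0.
  move: h2; rewrite -(avX hwn) -/X -(ltr_pM2r wy1) mulVf ?gt_eqF //; lra.
have hi' := hwi i hi.
have w0 : 0 < w i (1 + X) by rewrite av_gt0.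
rewrite (avM hi') (av_div hi') mulrAC ltr_pdivrMr // mul1r.
have : 1 - w i X <= w i (1 + X).
  rewrite lerBlDr -(av1 hi'); apply: le_trans (av_leB hi' _ _).
  by rewrite addrK.
have := h3 i hi; have wiy := av_ge0 hi' y; have p0 : 0 < w i y + 1 by rewrite ltr_wpDl.
rewrite -(avX hi') -/X -(ltr_pM2r p0) mulVf ?gt_eqF //; lra.
Qed.
End WeakApproximation.

(** * Embeddings of a number field *)

(* [e] enumerates the embeddings of L = Q(theta), with minimal polynomial [p], into Qbar. *)
Definition embedding_data (L : fieldExtType rat) (theta : L) (p : {poly rat})
    (e : 'I_(\dim {:L}) -> {rmorphism L -> algC}) : Prop :=
  [/\ p \is monic,
      forall x : L, exists2 h : {poly rat}, (size h <= \dim {:L})%N &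
        x = (map_poly (in_alg L) h).[theta],
      forall q : {poly rat}, root (map_poly (in_alg L) q) theta = (p %| q),
      map_poly ratr p = \prod_i ('X - (e i theta)%:P)
    & injective (fun i => e i theta)].

Lemma pchar_numfield (L : fieldExtType rat) : [pchar L] =i pred0.
Proof. by move=> q; rewrite (pchar_lalg L) pchar_num. Qed.

Lemma primitive_element (L : fieldExtType rat) : exists theta : L, <<1; theta>>%VS = fullv.
Proof.
have sep : separable 1 {:L}.
  by apply/separableP => u _; apply: pcharf0_separable; exact: pchar_numfield.
by exists (separable_generator 1 {:L}); rewrite -eq_adjoin_separable_generator ?sub1v.
Qed.

(** Each root [z] of the minimal polynomial of a primitive element gives the embedding sending
    [h(theta)] to [h(z)], well defined because a polynomial vanishing at [theta] is a multiple of
    [p]. Separability in characteristic 0 makes the roots distinct. *)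
Lemma embeddings_exist (L : fieldExtType rat) : exists theta p e, @embedding_data L theta p e.
Proof.
have [theta gen] := primitive_element L.
have dimN : adjoin_degree 1 theta = \dim {:L}.
  by rewrite -gen dim_Fadjoin dimv1 muln1.
have /polyOver1P[p pE] := minPolyOver 1 theta.
have szp : size p = (\dim {:L}).+1.
  by rewrite -(size_map_poly (in_alg L)) -pE size_minPoly dimN.
have pm : p \is monic by rewrite -(map_monic (in_alg L)) -pE monic_minPoly.
have proot q : root (map_poly (in_alg L) q) theta = (p %| q).
  rewrite -(dvdp_map (in_alg L)) -pE; apply/idP/idP => h.
    by apply: minPoly_dvdp => //; apply/polyOver1P; exists q.
  by rewrite -dvdp_XsubCl (dvdp_trans _ h) // dvdp_XsubCl root_minPoly.
have repr (x : L) : exists h : {poly rat}, (size h <= \dim {:L})%N /\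
    x = (map_poly (in_alg L) h).[theta].
  have /polyOver1P[h hE] := Fadjoin_polyOver 1 theta x.
  exists h; rewrite -(size_map_poly (in_alg L)) -hE -dimN size_Fadjoin_poly; split=> //.
  by rewrite Fadjoin_poly_eq // gen memvf.
have [h hP] := choice repr.
have [rs rsE] := closed_field_poly_normal (map_poly ratr p : {poly algC}).
rewrite lead_coef_map (eqP pm) rmorph1 scale1r in rsE.
have szrs : size rs = \dim {:L}.
  by apply: succn_inj; rewrite -szp -(size_map_poly (ratr : {rmorphism rat -> algC})) rsE size_prod_XsubC.
have usr : uniq rs.
  rewrite -separable_prod_XsubC -rsE separable_map -(separable_map (in_alg L)) -pE.
  exact: (@pcharf0_separable _ L 1%AS (pchar_numfield L) theta).
have rootz z : z \in rs -> root (map_poly ratr p) z by rewrite rsE root_prod_XsubC.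
have vanish z (q : {poly rat}) : z \in rs -> (map_poly (in_alg L) q).[theta] = 0 ->
    (map_poly ratr q).[z] = 0 :> algC.
  move=> zrs q0; have : root (map_poly (in_alg L) q) theta by apply/rootP.
  rewrite proot -(dvdp_map (ratr : {rmorphism rat -> algC})) => dv.
  by apply/rootP; rewrite -dvdp_XsubCl (dvdp_trans _ dv) // dvdp_XsubCl rootz.
have cong z (q q' : {poly rat}) : z \in rs ->
    (map_poly (in_alg L) q).[theta] = (map_poly (in_alg L) q').[theta] ->
    (map_poly ratr q).[z] = (map_poly ratr q').[z] :> algC.
  move=> zrs /eqP; rewrite -subr_eq0 -hornerN -hornerD -rmorphB => /eqP/(vanish z _ zrs)/eqP.
  by rewrite rmorphB hornerD hornerN subr_eq0 => /eqP.
have emb z : z \in rs -> exists f : {rmorphism L -> algC}, f theta = z.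
  move=> zrs; pose g (x : L) : algC := (map_poly ratr (h x)).[z].
  have gB : zmod_morphism g.
    move=> x y; rewrite /g (cong z _ (h x - h y)) //; first by rewrite rmorphB hornerD hornerN.
    by rewrite rmorphB hornerD hornerN -!(hP _).2.
  have gM : monoid_morphism g.
    split=> [|x y]; rewrite /g.
      by rewrite (cong z _ 1) // ?rmorph1 ?hornerC // -(hP _).2.
    rewrite (cong z _ (h x * h y)) //; first by rewrite rmorphM hornerM.
    by rewrite rmorphM hornerM -!(hP _).2.
  pose gA := GRing.isZmodMorphism.Build _ _ g gB.
  pose gR := GRing.isMonoidMorphism.Build _ _ g gM.
  pose G : {rmorphism L -> algC} := HB.pack g gA gR.
  exists G; rewrite /= /g (cong z _ 'X) // ?map_polyX ?hornerX //.
  by rewrite -(hP _).2.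
have emb' (i : 'I_(\dim {:L})) : exists f : {rmorphism L -> algC}, f theta = rs`_i.
  by apply: emb; rewrite mem_nth ?szrs.
have [e eE] := choice emb'.
exists theta, p, e; split=> //.
- by move=> x; have [a b] := hP x; exists (h x).
- rewrite rsE (big_nth 0) szrs big_mkord; apply: eq_bigr => i _; by rewrite eE.
- move=> i j; rewrite !eE => /eqP; rewrite nth_uniq ?szrs // => /eqP; exact: val_inj.
Qed.

Section Embeddings.
Variables (L : fieldExtType rat) (theta : L) (p : {poly rat}).
Variable e : 'I_(\dim {:L}) -> {rmorphism L -> algC}.
Hypothesis hE : embedding_data theta p e.
Local Notation N := (\dim {:L}).

Lemma emb_horner (f : {rmorphism L -> algC}) (h : {poly rat}) x :
  f (map_poly (in_alg L) h).[x] = (map_poly ratr h).[f x].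
Proof.
rewrite -horner_map -map_poly_comp; congr _.[_]; apply: eq_map_poly => q /=.
by rewrite alg_num_field fmorph_rat.
Qed.

(** Multiplication by [x] in the basis of powers of [theta] has a rational matrix [M]; the
    Vandermonde matrix of the conjugates of [theta], invertible since these are distinct,
    diagonalizes it with the entries [e i x]. *)
Lemma embedding_charpoly (x : L) : exists2 P : {poly rat}, P \is monic &
  map_poly ratr P = \prod_i ('X - (e i x)%:P).
Proof.
have [pm rep proot pE inj] := hE.
have hex k : exists h : {poly rat}, (size h <= N)%N /\ x * theta ^+ k = (map_poly (in_alg L) h).[theta].
  by have [h] := rep (x * theta ^+ k); exists h.
have [h hP] := choice hex.
pose M : 'M[rat]_N := \matrix_(k, l) (h k)`_l.
pose E : 'M[algC]_N := Vandermonde N (\row_i e i theta).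
pose D : 'rV[algC]_N := \row_i e i x.
pose Mc := map_mx (ratr : {rmorphism rat -> algC}) M.
have ME : Mc *m E = E *m diag_mx D.
  apply/matrixP => k i; rewrite mul_mx_diag !mxE.
  have := congr1 (e i) (hP k).2; rewrite rmorphM rmorphXn /= emb_horner mulrC => ->.
  rewrite (@horner_coef_wide _ N) ?size_map_poly ?(hP k).1 //.
  by apply: eq_bigr => l _; rewrite !mxE coef_map.
have detE : \det E != 0.
  rewrite det_Vandermonde; apply/prodf_neq0 => i _; apply/prodf_neq0 => j ij.
  rewrite !mxE subr_eq0; apply: contraTneq ij => /inj->; by rewrite ltnn.
exists (char_poly M); first exact: char_poly_monic.
rewrite (map_char_poly (ratr : {rmorphism rat -> algC})) -/Mc.
have := congr1 (map_mx polyC) ME; rewrite !map_mxM map_diag_mx => ME'.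
have : char_poly_mx Mc *m map_mx polyC E = map_mx polyC E *m ('X%:M - diag_mx (map_mx polyC D)).
  by rewrite /char_poly_mx mulmxBl mulmxBr ME' mul_scalar_mx mul_mx_scalar.
move/(congr1 determinant); rewrite !det_mulmx mulrC => /mulfI.
rewrite det_map_mx polyC_eq0 => /(_ detE) detXM; rewrite /char_poly detXM.
have -> : 'X%:M - diag_mx (map_mx polyC D) = diag_mx (\row_i ('X - (e i x)%:P)).
  by apply/matrixP => i j; rewrite !mxE -mulrnBl.
by rewrite det_diag; apply: eq_bigr => i _; rewrite mxE.
Qed.
End Embeddings.

(** Every coefficient but the leading one is a sum of products containing a root; [2 ^+ size zs]
    bounds the number of terms, as needed in the archimedean case. *)
Lemma coef_prod_XsubC_small (R : realType) (F : fieldType) (w : F -> R) (eps : R) (zs : seq F) :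
  is_abs_value w -> 0 <= eps <= 1 -> (forall z, z \in zs -> w z <= eps) ->
  forall k, w (\prod_(z <- zs) ('X - z%:P))`_k <= 2 ^+ size zs *
    (if (k < size zs)%N then eps else 1).
Proof.
move=> hw /andP[e0 e1]; elim: zs => [|z zs IH] hz k.
  by rewrite big_nil coef1 expr0 mul1r; case: (k == 0)%N; rewrite ?(av1 hw) ?(av0 hw).
have {}IH := IH (fun y yz => hz y (mem_behead (s := z :: zs) yz)).
have wz : w z <= eps by apply: hz; rewrite mem_head.
have p0 : 0 <= 2 ^+ size zs :> R by rewrite exprn_ge0.
rewrite big_cons mulrBl coefB coefXM coefCM; set Q := \prod_(_ <- _) _ in IH *.
apply: le_trans (av_leB hw _ _) _; rewrite (avM hw) /= exprS -mulrA mulr_natl mulr2n.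
have b1 k' : w Q`_k' <= 2 ^+ size zs.
  by apply: le_trans (IH k') _; rewrite ler_piMr //; case: ifP.
apply: lerD.
  case: k => [|k] /=; last by rewrite ltnS; exact: IH.
  by rewrite (av0 hw) mulr_ge0.
apply: (@le_trans _ _ (eps * 2 ^+ size zs)); first by rewrite ler_pM ?av_ge0.
by rewrite mulrC ler_wpM2l //; case: ifP.
Qed.

Section PlacesAreEmbeddings.
Variables (R : realType) (L : fieldExtType rat) (theta : L) (p : {poly rat}).
Variable e : 'I_(\dim {:L}) -> {rmorphism L -> algC}.
Hypothesis hE : embedding_data theta p e.
Local Notation N := (\dim {:L}).
Variables (b : nat) (hb : is_base b).

Lemma dim_field_gt0 : (0 < N)%N.
Proof. by rewrite adim_gt0. Qed.

Lemma extends_embedding (f : {rmorphism L -> algC}) : extends (base_abs R b) (wabs R b \o f).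
Proof.
split; first by apply: is_abs_value_comp; exact: wabs_abs.
by move=> q /=; rewrite fmorph_rat wabs_rat.
Qed.

Lemma root_charpoly (x : L) (P : {poly rat}) :
  map_poly ratr P = \prod_i ('X - (e i x)%:P) -> (map_poly (in_alg L) P).[x] = 0.
Proof.
move=> PE; pose i0 := Ordinal dim_field_gt0; apply: (fmorph_inj (e i0)).
rewrite emb_horner rmorph0 PE horner_prod (bigD1 i0) //=.
by rewrite hornerXsubC subrr mul0r.
Qed.

(** Otherwise weak approximation would give an [x] large at [v] with all conjugates small. The lower
    coefficients of the characteristic polynomial of a power of [x] are then rational and small, so
    the leading term of its equation cannot be compensated at [v]. *)
Lemma place_embedding (v : L -> R) : extends (base_abs R b) v ->
  exists i, v = wabs R b \o e i.
Proof.
move=> ev; have [hv vE] := ev; apply: contrapT => none.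
pose w i : L -> R := if insub i is Some j then wabs R b \o e j else v.
have [|x [vx wx]] := @weak_approximation R L (in_alg L) (base_abs R b) (base_nontrivial R hb) v N w ev.
  move=> i hi; rewrite /w insubT; split; first exact: extends_embedding.
  by move=> h; apply: none; exists (Ordinal hi).
have hw := wabs_abs R hb.
have wx' i : wabs R b (e i x) < 1.
  by have := wx i (ltn_ord i); rewrite /w valK.
(* Chosen so that [N * 2 ^+ N * eps < 1], to beat the sum of the [N] lower terms. *)
pose eps : R := (N%:R * 2 ^+ N + 1)^-1.
have N2 : 0 <= N%:R * 2 ^+ N :> R by rewrite mulr_ge0 ?exprn_ge0.
have eps0 : 0 < eps by rewrite invr_gt0 ltr_wpDl.
have [|m hm] := @eventually_all N (fun i m => w i x ^+ m < eps).
  move=> i hi; apply: powers_eventually_small => //; rewrite wx // andbT.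
  by rewrite /w insubT; exact: (av_ge0 (proj1 (extends_embedding _))).
have {}hm := hm m.+1 (leqnSn m).
pose y := x ^+ m.+1; have vy : 1 < v y by rewrite (avX hv) exprn_egt1.
have [P Pm PE] := embedding_charpoly hE y.
have szP : size P = N.+1.
  by rewrite -(size_map_poly (ratr : {rmorphism rat -> algC})) PE size_prod_XsubC /index_enum -enumT size_enum_ord.
have small k : (k < N)%N -> v (in_alg L P`_k) <= 2 ^+ N * eps.
  move=> kN; rewrite (fmorph_eq_rat (in_alg L)) vE -(wabs_rat R hb).
  rewrite -[ratr _](coef_map (ratr : {rmorphism rat -> algC})) PE.
  have := @coef_prod_XsubC_small R algC _ eps [seq e i y | i <- index_enum _] hw _ _ k.
  rewrite big_map size_map /index_enum -enumT size_enum_ord kN; apply.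
    by rewrite (ltW eps0) /= /eps invf_le1 ?lerDr // ltr_wpDl.
  move=> z /mapP[i _ ->]; rewrite rmorphXn (avX hw); have := hm i (ltn_ord i).
  by rewrite /w valK => /ltW.
have := root_charpoly PE; rewrite (@horner_coef_wide _ N.+1) ?size_map_poly ?szP //.
rewrite big_ord_recr /= coef_map /=.
have -> : P`_N = 1 by have := eqP Pm; rewrite /lead_coef szP.
rewrite scale1r mul1r => /eqP; rewrite addrC addr_eq0 => /eqP yN.
have := lexx (v (y ^+ N)); rewrite {2}yN (avN hv) leNgt => /negP; apply.
have vyN : 0 < v y ^+ N by rewrite exprn_gt0 // (lt_trans ltr01).
apply: (@le_lt_trans _ _ (\sum_(i < N) 2 ^+ N * eps * v y ^+ N)).
  apply: le_trans (av_leD_sum hv _ _ _) _; apply: ler_sum => i _.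
  rewrite (avM hv) (avX hv) coef_map; apply: ler_pM; rewrite ?exprn_ge0 ?(av_ge0 hv) //.
    exact: small.
  by apply: ler_weXn2l; [exact: ltW|exact: ltnW].
rewrite sumr_const card_ord -[ltLHS]mulr_natl mulrA mulrA (avX hv) -[ltRHS]mul1r ltr_pM2r //.
by rewrite /eps ltr_pdivrMr ?mul1r ?ltrDl // ltr_wpDl.
Qed.
End PlacesAreEmbeddings.

(** * Conjugates of an algebraic number *)

Section ConjugateMultiset.
Variables (L : fieldExtType rat) (theta : L) (p : {poly rat}).
Variable e : 'I_(\dim {:L}) -> {rmorphism L -> algC}.
Hypothesis hE : embedding_data theta p e.
Local Notation N := (\dim {:L}).

Definition conjugates (alpha : algC) : seq algC :=
  projT1 (closed_field_poly_normal (minCpoly alpha)).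

Lemma conjugatesE alpha : minCpoly alpha = \prod_(z <- conjugates alpha) ('X - z%:P).
Proof.
rewrite /conjugates; case: closed_field_poly_normal => r /= {1}->.
by rewrite (eqP (minCpoly_monic alpha)) scale1r.
Qed.

(** Irreducibility of [q] appears as: [q] divides every rational polynomial sharing a root with it.
    So [q] divides a nonconstant [P], and the quotient satisfies the same hypotheses. *)
Lemma power_of_irreducible (q P : {poly rat}) : q \is monic -> (1 < size q)%N ->
  (forall r, (exists2 z : algC, root (map_poly ratr r) z & root (map_poly ratr q) z) -> q %| r) ->
  P \is monic -> (forall z : algC, root (map_poly ratr P) z -> root (map_poly ratr q) z) ->
  exists m, P = q ^+ m.
Proof.
move=> qm q1 qirr; have [n] := ubnP (size P); elim: n P => // n IH P sP Pm hP.
have [sP1|sP1] := eqVneq (size P) 1%N.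
  exists 0%N; rewrite expr0; move: Pm; have /eqP/size_poly1P[c c0 ->] := sP1.
  by rewrite monicE lead_coefC => /eqP->; rewrite polyC1.
have /closed_rootP[z rz] : size (map_poly ratr P : {poly algC}) != 1%N by rewrite size_map_poly.
have /qirr : exists2 z, root (map_poly ratr P : {poly algC}) z & root (map_poly ratr q) z.
  by exists z => //; exact: hP.
rewrite dvdp_eq => /eqP PE; move: (P %/ q) PE => Q PE.
have Qm : Q \is monic by rewrite -(monicMr _ qm) -PE.
have [|||m QE] := IH Q.
- have : (size Q < size P)%N.
    rewrite PE size_monicM ?monic_neq0 //; have := monic_neq0 Qm.
    move=> Q0; have sQ : (0 < size Q)%N by rewrite size_poly_gt0.
    by move: (size Q) (size q) sQ q1 => a c; lia.
  by move=> h; apply: leq_trans h _; rewrite -ltnS.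
- exact: Qm.
- by move=> y ry; apply: hP; rewrite PE rmorphM rootM ry.
by exists m.+1; rewrite PE QE exprSr.
Qed.

(** The characteristic polynomial of [x] has only roots of its minimal polynomial, hence is a power
    of it. *)
Lemma embeddings_conjugates (f : {rmorphism L -> algC}) (x : L) :
  exists2 m, (0 < m)%N & perm_eq [seq e i x | i : 'I_N] (flatten (nseq m (conjugates (f x)))).
Proof.
have [P Pm PE] := embedding_charpoly hE x.
have [q [qE qm] qmin] := minCpolyP (f x).
have q1 : (1 < size q)%N.
  by rewrite -(size_map_poly (ratr : {rmorphism rat -> algC})) -qE size_minCpoly.
have qx : (map_poly (in_alg L) q).[x] = 0.
  by apply: (fmorph_inj f); rewrite emb_horner rmorph0 -qE; apply/rootP/root_minCpoly.
have [m Pq] : exists m, P = q ^+ m.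
  apply: power_of_irreducible => // [r [z rz qz]|z].
    (* A common root makes the gcd nonconstant; [f x] is a root of [g] or of [q / g], and the latter
       has too small a degree. *)
    pose g := gcdp q r; have gq : g %| q by rewrite dvdp_gcdl.
    have gz : root (map_poly ratr g : {poly algC}) z by rewrite gcdp_map root_gcd qz.
    have q0 : q != 0 by rewrite monic_neq0.
    have g0 : g != 0 by apply: contraNneq q0 => g0; move: gq; rewrite g0 dvd0p.
    have : root (map_poly ratr (g * (q %/ g))) (f x) by rewrite mulrC divpK // -qE root_minCpoly.
    rewrite rmorphM rootM !qmin => /orP[qg|]; first by apply: dvdp_trans qg (dvdp_gcdr _ _).
    have d0 : q %/ g != 0 by rewrite divp_eq0 negb_or q0 negb_or g0 -leqNgt dvdp_leq.
    move=> /(dvdp_leq d0); rewrite size_divp // leqNgt => /negP[].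
    have g1 : (1 < size g)%N.
      rewrite -(size_map_poly (ratr : {rmorphism rat -> algC})); apply: root_size_gt1 gz.
      by rewrite map_poly_eq0.
    have : (size g <= size q)%N by exact: dvdp_leq.
    by move: (size g) (size q) g1 => a c; lia.
  rewrite PE => /rootP; rewrite horner_prod => /eqP; rewrite prodf_seq_eq0 => /hasP[i _ /=].
  rewrite hornerXsubC subr_eq0 => /eqP->; apply/rootP.
  by rewrite -emb_horner qx rmorph0.
have N0 := dim_field_gt0 L.
exists m.
  rewrite lt0n; apply/eqP => m0; move: PE; rewrite Pq m0 expr0 rmorph1 => /(congr1 (fun h : {poly algC} => size h)).
  by rewrite size_poly1 size_prod_XsubC /index_enum -enumT size_enum_ord => -[N00]; rewrite -N00 in N0.
apply: prod_XsubC_eq; rewrite big_map enumT -PE Pq rmorphXn /= -qE conjugatesE.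
elim: m {Pq} => [|m IH] /=; first by rewrite expr0 big_nil.
by rewrite exprS big_cat IH.
Qed.
End ConjugateMultiset.

(** * Local degrees *)

Lemma isometry_uniq (R : realType) (E F1 F2 : fieldType) (w1 : F1 -> R) (w2 : F2 -> R)
    (j : E -> F1) (f g : {rmorphism F1 -> F2}) :
  is_abs_value w1 -> is_abs_value w2 ->
  (forall z e, 0 < e -> exists x, w1 (z - j x) < e) ->
  (forall z, w2 (f z) = w1 z) -> (forall z, w2 (g z) = w1 z) ->
  (forall x, f (j x) = g (j x)) -> f =1 g.
Proof.
move=> h1 h2 dense fw gw fg z; apply/eqP; rewrite -subr_eq0 -(av_eq0 h2) eq_le av_ge0 // andbT.
apply/ler_addgt0Pr => e e0; rewrite add0r; have [x hx] := dense z _ (divr_gt0 e0 (ltr0Sn _ 1)).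
have := av_tri h2 (f (j x)) (f z) (g z); rewrite {2}fg -!rmorphB fw gw (avBC h1 (j x)); lra.
Qed.

(** Invariance of dimension through matrices, since [F] is related to [k] by a ring morphism only
    and not by a vector space structure. *)
Lemma basis_size_le (k F : fieldType) (i : {rmorphism k -> F}) d d' (b : 'I_d -> F) (b' : 'I_d' -> F) :
  (forall x, exists c, x = \sum_l i (c l) * b l) ->
  (forall x, exists c, x = \sum_l i (c l) * b' l) ->
  (forall c c', \sum_l i (c l) * b l = \sum_l i (c' l) * b l -> c = c') -> (d <= d')%N.
Proof.
move=> sp sp' free; have [A hA] := choice (fun l => sp' (b l)).
have [B hB] := choice (fun l => sp (b' l)).
apply: (@mulmx1_min k d d' (\matrix_(l, m) A l m) (\matrix_(l, m) B l m)).
apply/matrixP => l m; rewrite !mxE; under eq_bigr => n _ do rewrite !mxE.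
have := free (fun m => \sum_n A l n * B n m) (fun m => (l == m)%:R).
move=> /(_ _)/(congr1 (fun c => c m)); apply.
transitivity (b l); last first.
  rewrite (bigD1 l) //= eqxx rmorph1 mul1r big1 ?addr0 // => n nl.
  by rewrite eq_sym (negPf nl) rmorph0 mul0r.
rewrite [RHS]hA; under [RHS]eq_bigr => n _ do rewrite hB mulr_sumr.
rewrite exchange_big /=; apply: eq_bigr => n _; rewrite rmorph_sum mulr_suml /=.
by apply: eq_bigr => n' _; rewrite rmorphM mulrA.
Qed.

Section LocalDegree.
Variables (R : realType) (L : fieldExtType rat) (theta : L) (p : {poly rat}).
Variable e : 'I_(\dim {:L}) -> {rmorphism L -> algC}.
Hypothesis hE : embedding_data theta p e.
Local Notation N := (\dim {:L}).
Variables (b : nat) (hb : is_base b).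
Variable v : L -> R.
Hypothesis ev : extends (base_abs R b) v.

(* The completion of Q. *)
Variables (k : fieldType) (wk : k -> R) (jk : {rmorphism rat -> k}).
Hypotheses (hwk : is_abs_value wk) (ck : complete_abs wk)
  (jkE : forall q, wk (jk q) = base_abs R b q)
  (jk_dense : forall z e, 0 < e -> exists x, wk (z - jk x) < e).

(* The completion of Qbar. *)
Variables (Om : fieldType) (wO : Om -> R) (jO : {rmorphism algC -> Om}).
Hypotheses (hwO : is_abs_value wO) (cO : complete_abs wO)
  (jOE : forall q, wO (jO q) = wabs R b q).

Variables (F : fieldType) (w : F -> R) (j : {rmorphism L -> F}).
Hypothesis comp : is_completion v w j.

Let hw : is_abs_value w. Proof. by case: comp. Qed.
Let cw : complete_abs w. Proof. by case: comp. Qed.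
Let jE x : w (j x) = v x. Proof. by case: comp. Qed.
Let j_dense z eps : 0 < eps -> exists x : L, w (z - j x) < eps. Proof. by case: comp => _ _ _; apply. Qed.

Let iF_ex : exists i : {rmorphism k -> F}, (forall z, w (i z) = wk z) /\ forall q, i (jk q) = (j \o in_alg L) q.
Proof.
apply: (isometry_extension hwk hw cw jkE _ jk_dense) => q.
by rewrite /= alg_num_field jE (proj2 ev).
Qed.

Let iO_ex : exists i : {rmorphism k -> Om}, (forall z, wO (i z) = wk z) /\
  forall q, i (jk q) = (jO \o ratr) q.
Proof.
apply: (isometry_extension hwk hwO cO jkE _ jk_dense) => q.
by rewrite /= jOE wabs_rat.
Qed.

Section WithMaps.
Variables (iF : {rmorphism k -> F}) (iO : {rmorphism k -> Om}).
Hypotheses (iFE : forall z, w (iF z) = wk z) (iFj : forall q, iF (jk q) = (j \o in_alg L) q).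
Hypotheses (iOE : forall z, wO (iO z) = wk z) (iOj : forall q, iO (jk q) = (jO \o ratr) q).

(** Identifies the closure of Q in [F] with the image of the completion [k], so that coefficients
    can be taken in [k]. *)
Let rat_closureE z : rat_closure w z <-> exists x, z = iF x.
Proof.
have ratE q : ratr q = iF (jk q) by rewrite iFj /= alg_num_field fmorph_rat.
split=> [hz|[x ->] eps e0].
  apply: (isometry_closed_image hwk hw ck iFE) => eps /hz[q].
  by rewrite ratE; exists (jk q).
by have [q hq] := jk_dense x e0; exists q; rewrite ratE -rmorphB iFE.
Qed.

Local Notation ev_F g := ((map_poly iF g).[j theta]).

Let jk_poly (h : {poly rat}) : ev_F (map_poly jk h) = j (map_poly (in_alg L) h).[theta].
Proof.
rewrite -map_poly_comp -horner_map -map_poly_comp; congr _.[_].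
by apply: eq_map_poly => q; exact: iFj.
Qed.

Lemma completion_minpoly_exists : exists g : {poly k}, [/\ g \is monic, ev_F g = 0 &
  forall h : {poly k}, ev_F h = 0 -> g %| h].
Proof.
have [pm _ proot _ _] := hE.
have ex : exists n, `[< exists g : {poly k}, [/\ g != 0, ev_F g = 0 & size g = n] >].
  exists (size (map_poly jk p)); apply/asboolP; exists (map_poly jk p); split=> //.
    by rewrite map_poly_eq0 monic_neq0.
  by rewrite jk_poly (eqP (_ : root _ _)) ?rmorph0 // proot.
case: (ex_minnP ex) => n /asboolP[g [g0 gz gn]] gmin.
have lc : lead_coef g != 0 by rewrite lead_coef_eq0.
exists ((lead_coef g)^-1 *: g); split.
- by rewrite monicE lead_coefZ mulVf.
- by rewrite map_polyZ hornerZ gz mulr0.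
move=> h hz; rewrite dvdpZl ?invr_eq0 //; apply/eqP.
apply: contrapT => /eqP m0; have : ev_F (h %% g) = 0.
  have := hz; rewrite {1}(divp_eq h g) rmorphD rmorphM /= hornerD hornerM gz mulr0 add0r.
  exact.
move=> mz; have /gmin : `[< exists f : {poly k}, [/\ f != 0, ev_F f = 0 & size f = size (h %% g)] >].
  by apply/asboolP; exists (h %% g).
by rewrite leqNgt -gn ltn_modp g0.
Qed.

Section WithMinpoly.
Variable g : {poly k}.
Hypotheses (gm : g \is monic) (gz : ev_F g = 0) (gmin : forall h : {poly k}, ev_F h = 0 -> g %| h).
Let d := (size g).-1.
Let szg : size g = d.+1.
Proof. by rewrite prednK // size_poly_gt0 monic_neq0. Qed.

Let free (c : nat -> k) : \sum_(l < d) iF (c l) * j theta ^+ l = 0 -> forall l, (l < d)%N -> c l = 0.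
Proof.
move=> c0 l ld; pose h := \poly_(m < d) c m.
have /gmin gh : ev_F h = 0.
  rewrite (@horner_coef_wide _ d) ?size_map_poly ?size_poly // -[RHS]c0.
  by apply: eq_bigr => m _; rewrite coef_map coef_poly ltn_ord.
have [h0|h0] := eqVneq h 0.
  by have := coef_poly d c l; rewrite -/h h0 coef0 ld.
by have := dvdp_leq h0 gh; rewrite szg leqNgt ltnS size_poly.
Qed.

Let span_L (x : L) : exists r : {poly k}, [/\ (size r <= d)%N, j x = ev_F r &
  exists2 h : {poly rat}, x = (map_poly (in_alg L) h).[theta] & (g %| map_poly jk h - r)].
Proof.
have [_ rep _ _ _] := hE; have [h _ xh] := rep x.
exists (map_poly jk h %% g); split.
- by rewrite -ltnS -szg ltn_modp monic_neq0.
- rewrite xh -jk_poly {1}(divp_eq (map_poly jk h) g) rmorphD rmorphM /=.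
  by rewrite hornerD hornerM gz mulr0 add0r.
- exists h => //; rewrite {1}(divp_eq (map_poly jk h) g) addrK; exact: dvdp_mull.
Qed.

(** The span of the powers of [j theta] contains the dense image of [L], and it is closed because it
    is finite-dimensional over a complete field. *)
Let span z : exists c : nat -> k, z = \sum_(l < d) iF (c l) * j theta ^+ l.
Proof.
apply: (span_closed hwk hw ck iFE (b := fun l => j theta ^+ l) free) => eps e0.
have [x hx] := j_dense z e0; have [r [sr xr _]] := span_L x.
exists (fun l => r`_l); have -> : \sum_(l < d) iF r`_l * j theta ^+ l = j x; last by [].
rewrite xr (@horner_coef_wide _ d) ?size_map_poly //.
by apply: eq_bigr => m _; rewrite coef_map.
Qed.

Let basis_F (x : F) : exists! c : 'I_d -> F,
  (forall i, rat_closure w (c i)) /\ x = \sum_(i < d) c i * j theta ^+ i.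
Proof.
have [c xc] := span x; exists (fun i => iF (c i)); split.
  by split=> // i; apply/rat_closureE; exists (c i).
move=> c' [c'rat xc']; have [a ha] := choice (fun i => proj1 (rat_closureE (c' i)) (c'rat i)).
apply: funext => i; rewrite ha; congr (iF _).
pose A l := if insub l is Some m then a m else 0.
have : \sum_(l < d) iF (c l - A l) * j theta ^+ l = 0.
  under eq_bigr => l _ do rewrite rmorphB mulrBl.
  rewrite sumrB -xc xc'; apply/eqP; rewrite subr_eq0; apply/eqP/eq_bigr => l _.
  by rewrite /A valK -ha.
move=> h; have /eqP := free (c := fun l => c l - A l) h (ltn_ord i).
by rewrite subr_eq0 /A valK => /eqP.
Qed.

(** If the conjugate is a root of [g], evaluating coordinates at it gives
    [wabs R b (e i x) <= C' * v x]; powers remove [C'] and inversion gives equality. Conversely, an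
    isometric embedding of [L] in [Om] extends to [F] and carries the equation [g (j theta) = 0] to
    the conjugate. *)
Let rootO i : root (map_poly iO g) (jO (e i theta)) <-> wabs R b \o e i = v.
Proof.
split=> [rt|wv].
  have [C C0 hC] := coords_bounded hwk hw ck iFE (b := fun l => j theta ^+ l) free.
  pose C' := \sum_(l < d) C * wO (jO (e i theta)) ^+ l.
  have bound x : wabs R b (e i x) <= C' * v x.
    have [r [sr xr [h xh gh]]] := span_L x.
    have -> : wabs R b (e i x) = wO (\sum_(l < d) iO r`_l * jO (e i theta) ^+ l).
      rewrite -jOE; congr wO; rewrite xh emb_horner -horner_map -map_poly_comp.
      have -> : map_poly (jO \o ratr) h = map_poly iO (map_poly jk h).
        by rewrite -map_poly_comp; apply: eq_map_poly => q; rewrite /= iOj.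
      have -> : map_poly iO (map_poly jk h) = map_poly iO (map_poly jk h - r) + map_poly iO r.
        by rewrite -rmorphD subrK.
      rewrite hornerD (rootP _) ?add0r; last first.
        by apply: root_dvdp rt; rewrite dvdp_map.
      rewrite (@horner_coef_wide _ d) ?size_map_poly //.
      by apply: eq_bigr => m _; rewrite coef_map.
    apply: le_trans (av_leD_sum hwO _ _ _) _; rewrite mulr_suml; apply: ler_sum => l _.
    rewrite (avM hwO) (avX hwO) iOE -jE mulrAC ler_wpM2r ?exprn_ge0 ?(av_ge0 hwO) //.
    apply: le_trans (hC (fun l => r`_l) l (ltn_ord l)) _; rewrite le_eqVlt; apply/orP; left.
    rewrite xr (@horner_coef_wide _ d) ?size_map_poly //; apply/eqP; congr (_ * w _).
    by apply: eq_bigr => m _; rewrite coef_map.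
  have le x : wabs R b (e i x) <= v x.
    apply: (@le_of_powers_le _ _ _ C'); [exact/av_ge0/wabs_abs|exact: av_ge0 (proj1 ev) _|].
    move=> m; rewrite -(avX (wabs_abs R hb)) -(avX (proj1 ev)) -rmorphXn; exact: bound.
  apply: funext => x /=; apply/eqP; rewrite eq_le le /=.
  have [->|x0] := eqVneq x 0.
    by rewrite rmorph0 (av0 (wabs_abs R hb)) (av0 (proj1 ev)).
  have := le x^-1; rewrite fmorphV (avV (wabs_abs R hb)) (avV (proj1 ev)).
  by rewrite lef_pV2 ?posrE ?(av_gt0 (wabs_abs R hb)) ?(av_gt0 (proj1 ev)) ?fmorph_eq0.
have [|Phi [PhiE Phij]] := isometry_extension hw hwO cO (v := v) (j := j) (f := jO \o e i) jE _ j_dense.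
  by move=> x /=; rewrite jOE -wv.
have PhiF : Phi \o iF =1 iO.
  apply: (isometry_uniq hwk hwO jk_dense) => [z|//|q].
    by rewrite /= PhiE.
  by rewrite /= iFj iOj /= Phij /= alg_num_field !fmorph_rat.
have <- : Phi (j theta) = jO (e i theta) by rewrite Phij.
rewrite -(eq_map_poly PhiF) map_poly_comp; apply/rootP.
by rewrite horner_map gz rmorph0.
Qed.

(** Over [Om] the polynomial [g] divides the image of [p], a product of distinct linear factors, so
    its degree is the number of conjugates that are roots of it. *)
Let size_minpoly : d = #|[pred i | `[< wabs R b \o e i = v >]]|.
Proof.
have [pm _ proot pE inj] := hE.
have gp : g %| map_poly jk p.
  by apply: gmin; rewrite jk_poly (eqP (_ : root _ _)) ?rmorph0 // proot.
have : map_poly iO g %| \prod_(i <- index_enum 'I_N) ('X - (jO (e i theta))%:P).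
  have -> : \prod_(i <- index_enum 'I_N) ('X - (jO (e i theta))%:P) = map_poly iO (map_poly jk p).
    rewrite -(map_prod_XsubC jO) -pE -!map_poly_comp.
    by apply: eq_map_poly => q; rewrite /= iOj.
  by rewrite dvdp_map.
move=> /dvdp_prod_XsubC[m gE].
have := eqp_size gE; rewrite size_map_poly size_prod_XsubC szg => -[->].
rewrite -(card_uniqP _); last by rewrite mask_uniq // index_enum_uniq.
apply: eq_card => i; rewrite !inE.
have -> : (i \in mask m (index_enum 'I_N)) = root (map_poly iO g) (jO (e i theta)).
  rewrite (eqp_root gE) -(big_map (fun i => jO (e i theta)) xpredT (fun z => 'X - z%:P)).
  rewrite root_prod_XsubC (mem_map (f := fun i => jO (e i theta))) // => x y /fmorph_inj; exact: inj.
by apply/idP/asboolP => /rootO.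
Qed.

Let local_basis : exists2 bs : 'I_d -> F, (forall x : F, exists! c : 'I_d -> F,
   (forall i, rat_closure w (c i)) /\ x = \sum_(i < d) c i * bs i) &
   d = #|[pred i | `[< wabs R b \o e i = v >]]|.
Proof. by exists (fun l => j theta ^+ l); [exact: basis_F|exact: size_minpoly]. Qed.

(** An equivalence, because [local_degree] picks some length for which a basis exists: that this one
    occurs and that no other does are both needed. *)
Lemma local_degree_with_minpoly d' : (exists bs : 'I_d' -> F, forall x : F, exists! c : 'I_d' -> F,
   (forall i, rat_closure w (c i)) /\ x = \sum_(i < d') c i * bs i) <->
  d' = #|[pred i | `[< wabs R b \o e i = v >]]|.
Proof.
have [bs hbs dE] := local_basis; rewrite -dE; split=> [[bs' hbs']|->]; last by exists bs.
have span_of n (B : 'I_n -> F) : (forall x : F, exists! c : 'I_n -> F,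
   (forall i, rat_closure w (c i)) /\ x = \sum_(i < n) c i * B i) ->
   forall x, exists c, x = \sum_l iF (c l) * B l.
  move=> hB x; have [c [[crat xc] _]] := hB x.
  have [a ha] := choice (fun i => proj1 (rat_closureE (c i)) (crat i)).
  by exists a; rewrite xc; apply: eq_bigr => l _; rewrite ha.
have free_of n (B : 'I_n -> F) : (forall x : F, exists! c : 'I_n -> F,
   (forall i, rat_closure w (c i)) /\ x = \sum_(i < n) c i * B i) ->
   forall c c', \sum_l iF (c l) * B l = \sum_l iF (c' l) * B l -> c = c'.
  move=> hB c c' cc'; have [a [_ au]] := hB (\sum_l iF (c l) * B l).
  have h1 := au (iF \o c) (conj (fun i => proj2 (rat_closureE _) (ex_intro _ (c i) erefl)) erefl).
  have h2 := au (iF \o c') (conj (fun i => proj2 (rat_closureE _) (ex_intro _ (c' i) erefl)) cc').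
  apply: funext => l; apply: (fmorph_inj iF).
  by have := congr1 (fun f => f l) (etrans (esym h1) h2).
apply/eqP; rewrite eqn_leq; apply/andP; split.
  exact: (basis_size_le (span_of _ _ hbs') (span_of _ _ hbs) (free_of _ _ hbs')).
exact: (basis_size_le (span_of _ _ hbs) (span_of _ _ hbs') (free_of _ _ hbs)).
Qed.
End WithMinpoly.
End WithMaps.

Lemma completion_degree d : (exists bs : 'I_d -> F, forall x : F, exists! c : 'I_d -> F,
   (forall i, rat_closure w (c i)) /\ x = \sum_(i < d) c i * bs i) <->
  d = #|[pred i | `[< wabs R b \o e i = v >]]|.
Proof.
have [iF [iFE iFj]] := iF_ex; have [iO [iOE iOj]] := iO_ex.
have [g [gm gz gmin]] := completion_minpoly_exists iFj.
exact: (local_degree_with_minpoly iFE iFj iOE iOj gm gz gmin).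
Qed.
End LocalDegree.

Theorem local_degreeE (R : realType) (L : fieldExtType rat) theta p e b (v : L -> R) :
  embedding_data theta p e -> is_base b -> extends (base_abs R b) v ->
  local_degree v = #|[pred i | `[< wabs R b \o e i = v >]]|.
Proof.
move=> hE hb ev; have [hv _] := ev.
have [k [wk [jk [hwk ck jkE jkd]]]] := completion_exists (base_abs_abs R hb).
have [Om [wO [jO [hwO cO jOE _]]]] := completion_exists (wabs_abs R hb).
have H F w j (hc : @is_completion R L v F w j) :=
  completion_degree hE hb ev hwk ck jkE jkd hwO cO jOE hc.
rewrite /local_degree; case: xgetP => [d _ [F [w [j [hc hd]]]]|none].
  exact/(H F w j hc).
have [F [w [j [h1 h2 h3 h4]]]] := completion_exists hv.
have hc : is_completion v w j by split.
by exfalso; apply: (none #|[pred i | `[< wabs R b \o e i = v >]]|);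
  exists F, w, j; split=> //; apply/(H F w j hc).
Qed.

(** * Heights as averages over embeddings *)

Lemma placesE (R : realType) (L : fieldExtType rat) (v : L -> R) :
  places v <-> exists2 b, is_base b & extends (base_abs R b) v.
Proof.
split=> [[hv [h|[r rp h]]]|[b hb [hv h]]].
- by exists 0%N.
- exists r; first by rewrite /is_base rp orbT.
  split=> // q; rewrite h /base_abs; case: eqP rp => // ->; by [].
split=> //; move: hb => /orP[/eqP b0|bp]; [left|right; exists b] => // q; rewrite h /base_abs.
  by rewrite b0.
by case: eqP bp => // ->.
Qed.

(** The index 0 is always kept, so every truncation contains the archimedean place. *)
Definition bases (P : nat) : seq nat := [seq b <- iota 0 P.+1 | is_base b].

Lemma mem_bases P b : b \in bases P = is_base b && (b <= P)%N.
Proof. by rewrite mem_filter mem_iota add0n ltnS. Qed.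

Section PlacesSum.
Variables (R : realType) (L : fieldExtType rat) (theta : L) (p : {poly rat}).
Variable e : 'I_(\dim {:L}) -> {rmorphism L -> algC}.
Hypothesis hE : embedding_data theta p e.
Local Notation N := (\dim {:L}).

Lemma same_base b b' i i' : is_base b -> is_base b' ->
  wabs R b \o e i = wabs R b' \o e i' -> b = b'.
Proof.
move=> hb hb' h; apply: (base_abs_inj (R := R)) => //; apply: funext => q.
have [_ <-] := extends_embedding R hb (e i); have [_ <-] := extends_embedding R hb' (e i').
by rewrite h.
Qed.

(** A place occurs among the [wabs R b \o e i] as often as its local degree, so weighting by the
    degree amounts to summing over embeddings. The vanishing of [G] beyond [P] makes the support
    finite. *)
Lemma places_sum (G : (L -> R) -> R) P :
  (forall b i, is_base b -> b \notin bases P -> G (wabs R b \o e i) = 0) ->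
  \sum_(v \in @places R L) (local_degree v)%:R / N%:R * G v =
  N%:R^-1 * \sum_(b <- bases P) \sum_i G (wabs R b \o e i).
Proof.
move=> G0.
pose V := undup [seq wabs R b \o e i | b <- bases P, i <- enum 'I_N].
have VP v : v \in V <-> exists2 b, b \in bases P & exists i, v = wabs R b \o e i.
  rewrite mem_undup; split=> [/allpairsP[[b i] /= [h1 _ ->]]|[b bP [i ->]]].
    by exists b => //; exists i.
  by apply/allpairsP; exists (b, i); rewrite /= mem_enum.
have Vplaces v : v \in V -> places v.
  move=> /VP[b bP [i ->]]; apply/placesE; exists b; first by move: bP; rewrite mem_bases => /andP[].
  by apply: extends_embedding; move: bP; rewrite mem_bases => /andP[].
rewrite (fsbigE V) ?undup_uniq //; last first.
  move=> v /placesE[b hb ev] vV; have [i vE] := place_embedding hE hb ev.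
  rewrite vE G0 ?mulr0 //; apply/negP => bP; move: vV; rewrite (_ : v \in V = true) //.
  by apply/VP; exists b => //; exists i.
rewrite big_seq_cond (eq_bigl (fun v => v \in V)); last first.
  by move=> v; rewrite /= andb_idr // => /Vplaces h; rewrite in_setE.
rewrite -big_seq.
transitivity (\sum_(v <- V) \sum_(b <- bases P) \sum_i
    (N%:R^-1 * if `[< wabs R b \o e i = v >] then G (wabs R b \o e i) else 0)).
  rewrite big_seq [RHS]big_seq; apply: eq_bigr => v vV.
  have [b bP [i0 vE]] := proj1 (VP v) vV; have hb : is_base b by move: bP; rewrite mem_bases => /andP[].
  have ev : extends (base_abs R b) v by rewrite vE; apply: extends_embedding.
  rewrite (local_degreeE hE hb ev) (bigD1_seq b) ?filter_uniq ?iota_uniq //=.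
  rewrite [X in _ + X]big1_seq ?addr0; last first.
    move=> b' /andP[b'b b'P]; apply: big1 => i _; case: asboolP => [h|_]; last by rewrite mulr0.
    have hb' : is_base b' by move: b'P; rewrite mem_bases => /andP[].
    by move: b'b; rewrite (@same_base b' b i i0 hb' hb) ?eqxx // h.
  rewrite -mulr_sumr mulrAC [LHS]mulrC; congr (_ * _).
  rewrite -big_mkcond (eq_bigr (fun=> G v)) => [|i /asboolP-> //].
  by rewrite sumr_const mulr_natl.
rewrite exchange_big mulr_sumr big_seq [RHS]big_seq; apply: eq_bigr => b bP.
rewrite exchange_big mulr_sumr; apply: eq_bigr => i _ /=.
rewrite -mulr_sumr; congr (_ * _).
have h : wabs R b \o e i \in V by apply/VP; exists b => //; exists i.
rewrite (bigD1_seq _ h) ?undup_uniq //=; case: asboolP => // _.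
rewrite big1 ?addr0 // => v /eqP hv; case: asboolP => // /esym h'; by case: hv.
Qed.
End PlacesSum.

Lemma ultra_sum (R : realType) (F : fieldType) (w : F -> R) (B : R) (I : Type) (r : seq I) (f : I -> F) :
  is_abs_value w -> ultrametric w -> 0 <= B -> (forall i, w (f i) <= B) ->
  w (\sum_(i <- r) f i) <= B.
Proof.
move=> hw uw B0 hB; elim/big_ind: _ => [|x y hx hy|i _]; first by rewrite (av0 hw).
  by apply: le_trans (uw x y) _; rewrite ge_max hx.
exact: hB.
Qed.

(** At a prime dividing no denominator of the minimal polynomial, [x] is integral: if its absolute
    value exceeded 1, the leading term would dominate all others. *)
Lemma wabs_le1_eventually (R : realType) (x : algC) :
  exists P0, forall b, (P0 < b)%N -> is_base b -> wabs R b x <= 1.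
Proof.
have [P [PE Pm] _] := minCpolyP x.
exists (\max_(k < size P) `|denq P`_k|)%N => b hP hb.
have b0 : (0 < b)%N by apply: leq_ltn_trans hP.
have hw := wabs_abs R hb; have uw := wabs_ultra R hb b0.
have bp : prime b by move: hb; rewrite /is_base; case: eqP b0 => // ->.
have coef k : wabs R b (ratr P`_k) <= 1.
  rewrite wabs_rat // /base_abs gtn_eqF // /padic_abs; case: eqP => // /eqP Pk.
  have kP : (k < size P)%N by rewrite ltnNge; apply: contra Pk => /(nth_default 0)->.
  have -> : logn b `|denq P`_k| = 0%N.
    apply/eqP; rewrite -leqn0 leqNgt logn_gt0 mem_primes bp absz_gt0 denq_neq0 /=.
    apply/negP => /dvdn_leq; rewrite absz_gt0 denq_neq0 => /(_ isT).
    rewrite leqNgt => /negP; apply; apply: leq_ltn_trans hP.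
    exact: (leq_bigmax (Ordinal kP)).
  rewrite expr0 div1r invf_le1 ?exprn_ege1 ?exprn_gt0 //; last by rewrite ltr0n.
  by rewrite ler1n prime_gt0.
rewrite leNgt; apply/negP => x1.
have [n sP] : exists n, size P = n.+2.
  have := size_minCpoly x; rewrite PE size_map_poly; case: (size P) => [|[|n]] //; by exists n.
have := root_minCpoly x; rewrite /root PE (@horner_coef_wide _ n.+2) ?size_map_poly ?sP //.
rewrite big_ord_recr /= coef_map /=.
have -> : P`_n.+1 = 1 by have := eqP Pm; rewrite /lead_coef sP.
rewrite rmorph1 mul1r addrC addr_eq0 => /eqP xn.
have : wabs R b (x ^+ n.+1) <= wabs R b x ^+ n.
  rewrite xn (avN hw); apply: ultra_sum => // [|i]; first by rewrite exprn_ge0 ?(av_ge0 hw).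
  rewrite (avM hw) coef_map (avX hw) -[leRHS]mul1r.
  apply: ler_pM; rewrite ?exprn_ge0 ?(av_ge0 hw) //; first exact: coef.
  by apply: ler_weXn2l; [exact: ltW|rewrite -ltnS; exact: ltn_ord].
rewrite (avX hw) exprS leNgt => /negP; apply.
by rewrite ltr_pMl ?exprn_gt0 // (lt_trans ltr01).
Qed.

Lemma wabs_le1_eventually_seq (R : realType) (I : finType) (x : I -> algC) :
  exists P0, forall b, (P0 < b)%N -> is_base b -> forall i, wabs R b (x i) <= 1.
Proof.
have [f hf] := choice (fun i => wabs_le1_eventually R (x i)).
exists (\max_i f i)%N => b hb bb i; apply: hf => //; apply: leq_ltn_trans hb.
exact: leq_bigmax.
Qed.

Lemma ln_prodr (R : realType) (I : Type) (r : seq I) (P : pred I) (f : I -> R) :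
  (forall i, P i -> 0 < f i) -> ln (\prod_(i <- r | P i) f i) = \sum_(i <- r | P i) ln (f i).
Proof.
move=> h; have : 0 < \prod_(i <- r | P i) f i /\ ln (\prod_(i <- r | P i) f i) = \sum_(i <- r | P i) ln (f i).
  elim/big_rec2: _ => [|i y z Pi [z0 <-]]; first by rewrite ltr01 ln1.
  by rewrite mulr_gt0 ?h // lnM ?posrE ?h.
by case.
Qed.

(** [logn q n] is 0 when [q] is not prime, so the sum may run over all integers up to [P]. *)
Lemma ln_nat_primes (R : realType) n P : (0 < n <= P)%N ->
  ln (n%:R : R) = \sum_(0 <= q < P.+1) (logn q n)%:R * ln q%:R.
Proof.
move=> /andP[n0 nP]; have := widen_partn predT nP; rewrite partnT // => {1}->.
rewrite natr_prod ln_prodr; last first.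
  move=> q _; rewrite ltr0n expn_gt0; case: q => // ; by rewrite /= lognE.
rewrite big_mkcond; apply: eq_bigr => q _ /=; rewrite natrX.
have [->|q0] := posnP q; first by rewrite lognE /= expr0 ln1 mul0r.
by rewrite lnXn ?ltr0n // mulr_natl.
Qed.

Lemma product_formula_rat (R : realType) (q : rat) : q != 0 ->
  exists P0, forall P, (P0 <= P)%N -> \sum_(b <- bases P) ln (base_abs R b q) = 0.
Proof.
move=> q0; pose a := `|numq q|%N; pose d := `|denq q|%N.
have a0 : (0 < a)%N by rewrite absz_gt0 numq_eq0.
have d0 : (0 < d)%N by rewrite absz_gt0 denq_neq0.
exists (a + d)%N => P hP.
have := @ln_nat_primes R a P; rewrite a0 => /(_ _) la.
have := @ln_nat_primes R d P; rewrite d0 => /(_ _) ld.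
have {}la := la ltac:(lia); have {}ld := ld ltac:(lia).
rewrite /bases big_filter /= big_cons /= -/(iota 1 P).
have -> : base_abs R 0 q = a%:R / d%:R.
  rewrite /base_abs /= /ratr normrM normfV -!intr_norm /a /d.
  by rewrite -!abszE.
rewrite ln_div ?posrE ?ltr0n // la ld.
have iotaE (f : nat -> R) : f 0%N = 0 -> \sum_(0 <= q0 < P.+1) f q0 = \sum_(b <- iota 1 P) f b.
  by move=> f0; rewrite big_ltn // f0 add0r /index_iota subSS subn0.
have log0 (n : nat) : (logn 0 n)%:R * ln (0%:R : R) = 0 by rewrite lognE /= mul0r.
rewrite (iotaE _ (log0 a)) (iotaE _ (log0 d)).
rewrite -sumrB [X in _ + X]big_mkcond -big_split big1_seq //= => b; rewrite mem_iota => /andP[b1 _].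
have [hb|hb] := boolP (is_base b); last first.
  have lb n : logn b n = 0%N.
    by rewrite lognE; move: hb; rewrite /is_base negb_or => /andP[_ /negPf->].
  by rewrite !lb !mul0r subrr addr0.
rewrite /base_abs gtn_eqF // /padic_abs (negPf q0) -/a -/d.
have bR : 0 < b%:R :> R by rewrite ltr0n.
by rewrite ln_div ?posrE ?exprn_gt0 // !lnXn // !mulr_natl; ring.
Qed.

(* The average over the N embeddings of a number field, summed over the places of Q. *)
Definition avg_sum (R : realType) N P (f : nat -> 'I_N -> R) : R :=
  N%:R^-1 * \sum_(b <- bases P) \sum_i f b i.

Section Heights.
Variables (R : realType) (L : fieldExtType rat) (theta : L) (p : {poly rat}).
Variable e : 'I_(\dim {:L}) -> {rmorphism L -> algC}.
Hypothesis hE : embedding_data theta p e.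
Local Notation N := (\dim {:L}).

Lemma height_inE (m : nat) (u : 'I_m -> L) : exists P0, forall P, (P0 <= P)%N ->
  height_in R u = avg_sum P (fun b i => ln (\big[Num.max/1]_(j < m) wabs R b (e i (u j)))).
Proof.
have [P0 hP0] := wabs_le1_eventually_seq R (fun x : 'I_N * 'I_m => e x.1 (u x.2)).
exists P0 => P hP; rewrite /height_in (@places_sum R L theta p e hE (fun v => ln (\big[Num.max/1]_(j < m) v (u j))) P) //.
move=> b i hb; rewrite mem_bases hb -ltnNge => Pb.
rewrite (_ : \big[Num.max/1]_(j < m) _ = 1) ?ln1 //; apply/eqP; rewrite eq_le.
rewrite bigmax_le //= ?bigmax_ge_id // => j _.
by apply: (hP0 b _ hb (i, j)); apply: leq_ltn_trans Pb.
Qed.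

(** The product of the [e i x] is the norm, up to sign the constant coefficient of the
    characteristic polynomial: a nonzero rational, to which the product formula of Q applies. *)
Lemma product_formula (x : L) : x != 0 -> exists P0, forall P, (P0 <= P)%N ->
  avg_sum P (fun b i => ln (wabs R b (e i x))) = 0.
Proof.
move=> x0; have [Q Qm QE] := embedding_charpoly hE x.
have prodE : \prod_i e i x = ratr ((-1) ^+ N * Q`_0).
  have := coef_map (ratr : {rmorphism rat -> algC}) Q 0; rewrite QE => h.
  rewrite rmorphM rmorphXn rmorphN1 -[X in _ = _ * X]h.
  have := coef0_prod_XsubC [seq e i x | i <- index_enum 'I_N].
  rewrite !big_map size_map /index_enum -enumT size_enum_ord => ->.
  by rewrite mulrA -exprMn mulrNN mulr1 expr1n mul1r enumT.
set c := _ * Q`_0 in prodE.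
have c0 : c != 0.
  rewrite -(fmorph_eq0 (ratr : {rmorphism rat -> algC})) -[X in X != _]prodE.
  by apply/prodf_neq0 => i _; rewrite fmorph_eq0.
have [P0 hP0] := product_formula_rat R c0; exists P0 => P hP.
rewrite /avg_sum (_ : \sum_(b <- _) _ = 0) ?mulr0 // -[RHS](hP0 P hP) big_seq [RHS]big_seq.
apply: eq_bigr => b; rewrite mem_bases => /andP[hb _].
rewrite -wabs_rat // -prodE (av_prod (wabs_abs R hb)) ln_prodr // => i _.
by rewrite (av_gt0 (wabs_abs R hb)) fmorph_eq0.
Qed.
End Heights.

(** The truncated height written with the conjugates only; two number fields containing [alpha] are
    compared through it. *)
Definition conj_sum (R : realType) P (alpha : algC) : R :=
  (size (conjugates alpha))%:R^-1 *
  \sum_(b <- bases P) \sum_(z <- conjugates alpha) ln (Num.max 1 (wabs R b z)).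

Lemma avg_sum_conjugates (R : realType) (L : fieldExtType rat) theta p e
    (f : {rmorphism L -> algC}) (x : L) P :
  embedding_data theta p e ->
  avg_sum P (fun b i => ln (Num.max 1 (wabs R b (e i x)))) = conj_sum R P (f x).
Proof.
move=> hE; have [m m0 pe] := embeddings_conjugates hE f x.
have size_flat (T : Type) n (s : seq T) : size (flatten (nseq n s)) = (n * size s)%N.
  by elim: n => //= n IH; rewrite size_cat IH mulSn.
have NE : \dim {:L} = (m * size (conjugates (f x)))%N.
  by rewrite -size_flat -(perm_size pe) size_map size_enum_ord.
have NR : (\dim {:L})%:R^-1 = m%:R^-1 * (size (conjugates (f x)))%:R^-1 :> R by rewrite NE natrM invfM.
have mR : m%:R != 0 :> R by rewrite pnatr_eq0 -lt0n.
have sumE : \sum_(b <- bases P) \sum_i ln (Num.max 1 (wabs R b (e i x))) =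
    m%:R * \sum_(b <- bases P) \sum_(z <- conjugates (f x)) ln (Num.max 1 (wabs R b z)).
  rewrite mulr_sumr; apply: eq_bigr => b _.
  transitivity (\sum_(z <- [seq e i x | i : 'I_(\dim {:L})]) ln (Num.max 1 (wabs R b z))).
    by rewrite big_map enumT.
  rewrite (perm_big _ pe) /=.
  elim: (m) => [|n IH] /=; first by rewrite big_nil mul0r.
  by rewrite big_cat /= IH -[n.+1]addn1 natrD mulrDl mul1r addrC.
rewrite /avg_sum /conj_sum sumE NR.
by rewrite mulrACA mulVf // mul1r.
Qed.

Lemma height1E (R : realType) (L : fieldExtType rat) theta p e
    (f : {rmorphism L -> algC}) (x : L) :
  embedding_data theta p e -> exists P0, forall P, (P0 <= P)%N ->
  height1 R (f x) = avg_sum P (fun b i => ln (Num.max 1 (wabs R b (e i x)))).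
Proof.
move=> hE; have key (L' : fieldExtType rat) (f' : {rmorphism L' -> algC}) (u : 'I_1 -> L') :
    (forall i, f' (u i) = f x) -> exists P0, forall P, (P0 <= P)%N -> height_in R u = conj_sum R P (f x).
  move=> fu; have [theta' [p' [e' hE']]] := embeddings_exist L'.
  have [P0 hP0] := height_inE R hE' u; exists P0 => P hP; rewrite (hP0 P hP) -(fu ord0).
  rewrite -(avg_sum_conjugates R f' (u ord0) P hE'); congr (_ * _).
  apply: eq_bigr => b _; apply: eq_bigr => i _; congr ln.
  by rewrite big_ord_recl big_ord0 maxC.
rewrite /height1 /height; case: xgetP => [r _ [L' [f' [u [fu ->]]]]|none].
  have [P0 hP0] := key L' f' u fu; exists P0 => P hP.
  by rewrite (hP0 P hP) (avg_sum_conjugates R f x P hE).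
by exfalso; apply: (none (height_in R (fun _ : 'I_1 => x))); exists L, f, (fun=> x).
Qed.

Lemma avg_sum_le (R : realType) N P (f g : nat -> 'I_N -> R) :
  (forall b i, is_base b -> f b i <= g b i) -> avg_sum P f <= avg_sum P g.
Proof.
move=> h; rewrite ler_wpM2l ?invr_ge0 // big_seq [leRHS]big_seq; apply: ler_sum => b.
by rewrite mem_bases => /andP[hb _]; apply: ler_sum => i _; exact: h.
Qed.

Lemma avg_sumD (R : realType) N P (f g : nat -> 'I_N -> R) :
  avg_sum P (fun b i => f b i + g b i) = avg_sum P f + avg_sum P g.
Proof.
rewrite /avg_sum -mulrDr -big_split; congr (_ * _).
by apply: eq_bigr => b _; rewrite big_split.
Qed.

Lemma avg_sumZ (R : realType) N P c (f : nat -> 'I_N -> R) :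
  avg_sum P (fun b i => c * f b i) = c * avg_sum P f.
Proof.
rewrite /avg_sum mulrCA; congr (_ * _); rewrite mulr_sumr.
by apply: eq_bigr => b _; rewrite mulr_sumr.
Qed.

Lemma avg_sum_sum (R : realType) N P (I : Type) (r : seq I) (Q : pred I) (f : I -> nat -> 'I_N -> R) :
  avg_sum P (fun b i => \sum_(j <- r | Q j) f j b i) = \sum_(j <- r | Q j) avg_sum P (f j).
Proof.
rewrite /avg_sum -mulr_sumr; congr (_ * _); rewrite [RHS]exchange_big.
by apply: eq_bigr => b _ /=; rewrite exchange_big.
Qed.

(** Used for the log 2 lost in the archimedean triangle inequality. *)
Lemma avg_sum_arch (R : realType) N P (c : R) : (0 < N)%N ->
  avg_sum P (fun b (_ : 'I_N) => if b == 0%N then c else 0) = c.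
Proof.
move=> N0; rewrite /avg_sum /bases big_filter /= big_cons /= sumr_const card_ord.
rewrite big1_seq ?addr0 => [|b /andP[_]].
  by rewrite -[X in _ * X]mulr_natl mulKf // pnatr_eq0 -lt0n.
by rewrite mem_iota => /andP[/gtn_eqF-> _]; rewrite big1.
Qed.

(** * The height inequality *)

Lemma eventually_fin (I : finType) (Q : I -> nat -> Prop) :
  (forall i, exists N : nat, forall m, (N <= m)%N -> Q i m) ->
  exists N : nat, forall m, (N <= m)%N -> forall i, Q i m.
Proof.
move=> h; have [f hf] := choice h; exists (\max_i f i)%N => m hm i; apply: hf.
by apply: leq_trans hm; exact: leq_bigmax.
Qed.

Definition tri_const (R : realType) (b : nat) : R := if b == 0%N then 2 else 1.

Lemma tri_const_ge1 (R : realType) b : 1 <= tri_const R b.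
Proof. by rewrite /tri_const; case: (b == 0)%N; rewrite ?lexx // ler1n. Qed.

Lemma ln_tri_const (R : realType) b : ln (tri_const R b) = if b == 0%N then ln 2 else 0.
Proof. by rewrite /tri_const; case: (b == 0)%N; rewrite ?ln1. Qed.

Lemma wabs_leD (R : realType) b x y : is_base b ->
  wabs R b (x + y) <= tri_const R b * Num.max (wabs R b x) (wabs R b y).
Proof.
move=> hb; rewrite /tri_const; have [b0|b0] := posnP b; last first.
  by rewrite mul1r; exact: wabs_ultra.
apply: le_trans (av_leD (wabs_abs R hb) _ _) _.
by rewrite mulr_natl mulr2n lerD // le_max lexx ?orbT.
Qed.

Lemma wabs_leB (R : realType) b x y : is_base b ->
  wabs R b (x - y) <= tri_const R b * Num.max (wabs R b x) (wabs R b y).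
Proof. by move=> hb; rewrite -(avN (wabs_abs R hb) y); exact: wabs_leD. Qed.

Section LocalInequality.
Variables (R : realType) (b : nat) (hb : is_base b).
Local Notation w := (wabs R b).
Local Notation M x := (Num.max 1 (w x)).
Local Notation C := (tri_const R b).
Let hw := wabs_abs R hb.
Let C1 : 1 <= C := tri_const_ge1 R b.
Let C0 : 0 < C := lt_le_trans ltr01 C1.
Let M1 x : 1 <= M x. Proof. by rewrite le_max lexx. Qed.
Let M0 x : 0 < M x. Proof. exact: lt_le_trans ltr01 (M1 x). Qed.
Let wM x : w x <= M x. Proof. by rewrite le_max lexx orbT. Qed.

Lemma wabs_linear_forms (x y t : algC) :
  w (x - y) * M t <= C * (M x * M y) * Num.max (w (1 + x * t)) (w (1 + y * t)).
Proof.
set Lm := Num.max (w (1 + x * t)) (w (1 + y * t)).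
have Lx : w (1 + x * t) <= Lm by rewrite /Lm le_max lexx.
have Ly : w (1 + y * t) <= Lm by rewrite /Lm le_max lexx orbT.
have L0 : 0 <= Lm by apply: le_trans Lx; exact: av_ge0.
have MM : 1 <= M x * M y by rewrite mulr_ege1.
rewrite maxr_pMr ?(av_ge0 hw) // ge_max mulr1 -(avM hw); apply/andP; split.
  have -> : x - y = x * (1 + y * t) - y * (1 + x * t) by ring.
  apply: le_trans (wabs_leB R _ _ hb) _; rewrite -mulrA ler_pM2l // ge_max !(avM hw).
  apply/andP; split; apply: ler_pM; rewrite ?(av_ge0 hw) //.
    by apply: le_trans (wM x) _; rewrite ler_peMr // ltW.
  by apply: le_trans (wM y) _; rewrite ler_peMl // ltW.
have -> : (x - y) * t = (1 + x * t) - (1 + y * t) by ring.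
apply: le_trans (wabs_leB R _ _ hb) _; rewrite -/Lm -mulrA ler_pM2l //.
by rewrite ler_peMl.
Qed.

(** The logarithmic loss in comparing the larger of two forms with [max(1, |t|)]. Globally
    [ln (w (x - y))] disappears by the product formula, and the pair costs [ln 2 + h x + h y]. *)
Definition pair_defect (x y : algC) : R := ln C + ln (M x) + ln (M y) - ln (w (x - y)).

Lemma pair_defect_ge0 x y : x != y -> 0 <= pair_defect x y.
Proof.
move=> xy; have w0 : 0 < w (x - y) by rewrite (av_gt0 hw) subr_eq0.
rewrite /pair_defect subr_ge0 -!lnM ?posrE ?mulr_gt0 // ler_ln ?posrE ?mulr_gt0 //.
apply: le_trans (wabs_leB R _ _ hb) _; rewrite -mulrA ler_pM2l // ge_max.
apply/andP; split.
  by apply: le_trans (wM x) _; rewrite ler_peMr // ltW.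
by apply: le_trans (wM y) _; rewrite ler_peMl // ltW.
Qed.

Lemma pair_defectP x y t : x != y -> 1 + x * t != 0 -> 1 + y * t != 0 ->
  ln (M t) - pair_defect x y <= Num.max (ln (w (1 + x * t))) (ln (w (1 + y * t))).
Proof.
move=> xy lx ly; have w0 : 0 < w (x - y) by rewrite (av_gt0 hw) subr_eq0.
have lx0 : 0 < w (1 + x * t) by rewrite (av_gt0 hw).
have ly0 : 0 < w (1 + y * t) by rewrite (av_gt0 hw).
have L0 : 0 < Num.max (w (1 + x * t)) (w (1 + y * t)) by rewrite lt_max lx0.
have -> : Num.max (ln (w (1 + x * t))) (ln (w (1 + y * t))) = ln (Num.max (w (1 + x * t)) (w (1 + y * t))).
  by rewrite /Num.max ltr_ln ?posrE //; case: ifP.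
have := wabs_linear_forms x y t; rewrite -ler_ln ?posrE ?mulr_gt0 //.
rewrite !lnM ?posrE ?mulr_gt0 // /pair_defect; lra.
Qed.

(* At each place at most one of the linear forms [1 + A j * t] is small, and that one is
   missing from one of the two sides of the relation. *)
Lemma relation_lower_bound (J : finType) (A : J -> algC) (t : algC) (p q : J -> nat) d :
  J -> injective A -> (forall j, 1 + A j * t != 0) -> (forall j, p j = 0%N \/ q j = 0%N) ->
  (\sum_j p j = d)%N -> (\sum_j q j = d)%N ->
  \prod_j (1 + A j * t) ^+ p j = \prod_j (1 + A j * t) ^+ q j ->
  d%:R * (ln (M t) - \sum_j \sum_(k | k != j) pair_defect (A j) (A k)) <=
  \sum_j (p j)%:R * ln (w (1 + A j * t)).
Proof.
(* All defects are nonnegative, so their sum [K] dominates each of them and can serve at every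
   place. *)
move=> j0 injA l0 pq sp sq rel; set K := \sum_j _.
have wl0 j : 0 < w (1 + A j * t) by rewrite (av_gt0 hw).
have lnE (r : J -> nat) : \sum_j (r j)%:R * ln (w (1 + A j * t)) = ln (w (\prod_j (1 + A j * t) ^+ r j)).
  rewrite (av_prod hw) ln_prodr => [|j _]; last by rewrite (avX hw) exprn_gt0.
  by apply: eq_bigr => j _; rewrite (avX hw) lnXn // mulr_natl.
have K0 j k : j != k -> pair_defect (A j) (A k) <= K.
  move=> jk; have pd j' k' : k' != j' -> 0 <= pair_defect (A j') (A k').
    by move=> h; apply: pair_defect_ge0; rewrite (inj_eq injA) eq_sym.
  rewrite /K (bigD1 j) //= (bigD1 k) /=; last by rewrite eq_sym.
  rewrite -addrA lerDl addr_ge0 // ?sumr_ge0 // => [k' /andP[h _]|j' _]; first exact: pd.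
  by apply: sumr_ge0 => k' h; exact: pd.
(* [k0] is the index of the small form if there is one, and any index otherwise. *)
have [k0 hk0] : exists k0, forall j, j != k0 -> ln (M t) - K <= ln (w (1 + A j * t)).
  have [[k0 hk0]|none] := pselect (exists k0, ln (w (1 + A k0 * t)) < ln (M t) - K).
    exists k0 => j jk; have := pair_defectP (t := t) _ (l0 j) (l0 k0).
    rewrite (inj_eq injA) => /(_ jk) h.
    have : ln (M t) - K <= Num.max (ln (w (1 + A j * t))) (ln (w (1 + A k0 * t))).
      by apply: le_trans h; rewrite lerD2l lerN2; exact: K0.
    by rewrite le_max => /orP[//|]; rewrite leNgt hk0.
  exists j0 => j _; rewrite leNgt; apply/negP => h; apply: none; by exists j.
have bound (r : J -> nat) : (\sum_j r j = d)%N -> r k0 = 0%N ->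
    d%:R * (ln (M t) - K) <= \sum_j (r j)%:R * ln (w (1 + A j * t)).
  move=> <- r0; rewrite natr_sum mulr_suml; apply: ler_sum => j _.
  have [->|jk] := eqVneq j k0; first by rewrite r0 !mul0r.
  by rewrite ler_wpM2l // hk0.
by have [/(bound _ sp)//|/(bound _ sq)] := pq k0; rewrite !lnE rel.
Qed.
End LocalInequality.

Section GlobalInequality.
Variables (R : realType) (L : fieldExtType rat) (theta : L) (pol : {poly rat}).
Variable e : 'I_(\dim {:L}) -> {rmorphism L -> algC}.
Hypothesis hE : embedding_data theta pol e.
Variable f : {rmorphism L -> algC}.
Local Notation N := (\dim {:L}).
Local Notation h x := (height1 R (f x)).

Lemma avg_sumB P (F G : nat -> 'I_N -> R) :
  avg_sum P (fun b i => F b i - G b i) = avg_sum P F - avg_sum P G.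
Proof.
rewrite avg_sumD; congr (_ + _); rewrite -mulN1r -avg_sumZ; congr (_ * _).
by apply: eq_bigr => b _; apply: eq_bigr => i _; rewrite mulN1r.
Qed.

Lemma height_relation_bound (J : finType) (A : J -> L) (t : L) (p q : J -> nat) d :
  J -> injective A -> (forall j, 1 + A j * t != 0) -> (forall j, p j = 0%N \/ q j = 0%N) ->
  (\sum_j p j = d)%N -> (\sum_j q j = d)%N -> (0 < d)%N ->
  \prod_j (1 + A j * t) ^+ p j = \prod_j (1 + A j * t) ^+ q j ->
  h t <= \sum_j \sum_(k | k != j) (ln 2 + h (A j) + h (A k)).
Proof.
move=> j0 injA l0 pq sp sq d0 rel.
have [P1 ht] := height1E R f t hE.
have [P2 hA] := eventually_fin (fun j => height1E R f (A j) hE).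
have [P3 hl] := eventually_fin (fun j => product_formula R hE (l0 j)).
have [P4 hd] : exists N : nat, forall P, (N <= P)%N -> forall jk : J * J, jk.2 != jk.1 ->
    avg_sum P (fun b i => ln (wabs R b (e i (A jk.1 - A jk.2)))) = 0.
  apply: eventually_fin => -[j k] /=; have [->|jk] := eqVneq k j; first by exists 0%N.
  have [|P0 hP0] := @product_formula R L theta pol e hE (A j - A k).
    by rewrite subr_eq0 (inj_eq injA) eq_sym.
  by exists P0 => P /hP0.
pose P := (P1 + P2 + P3 + P4)%N.
have {}ht := ht P ltac:(lia); have {}hA := hA P ltac:(lia).
have {}hl := hl P ltac:(lia); have {}hd := hd P ltac:(lia).
have : avg_sum P (fun b (i : 'I_N) => d%:R * (ln (Num.max 1 (wabs R b (e i t))) -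
     \sum_j \sum_(k | k != j) pair_defect R b (e i (A j)) (e i (A k)))) <=
   avg_sum P (fun b i => \sum_j (p j)%:R * ln (wabs R b (e i (1 + A j * t)))).
  apply: avg_sum_le => b i hb.
  have lE j : e i (1 + A j * t) = 1 + e i (A j) * e i t by rewrite rmorphD rmorph1 rmorphM.
  under [leRHS]eq_bigr => j _ do rewrite lE.
  apply: (relation_lower_bound R hb j0 _ _ pq sp sq) => [j k /fmorph_inj /injA //|j|].
    by rewrite -lE fmorph_eq0.
  have := congr1 (e i) rel; rewrite !rmorph_prod /=.
  by under eq_bigr => j _ do rewrite rmorphXn lE; under [RHS]eq_bigr => j _ do rewrite rmorphXn lE.
(* The forms are nonzero, so the product formula annihilates the right-hand side, and division by
   [d] isolates the height of [t]. *)
rewrite avg_sumZ avg_sum_sum; under [leRHS]eq_bigr => j _ do rewrite avg_sumZ hl mulr0.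
rewrite [leRHS]big1 // pmulr_rle0 ?ltr0n // avg_sumB -ht subr_le0 => /le_trans; apply.
rewrite le_eqVlt; apply/orP; left; apply/eqP.
rewrite avg_sum_sum; apply: eq_bigr => j _; rewrite avg_sum_sum; apply: eq_bigr => k kj.
rewrite /pair_defect avg_sumB !avg_sumD -!hA.
have -> : avg_sum P (fun b (i : 'I_N) => ln (wabs R b (e i (A j) - e i (A k)))) = 0.
  rewrite -[RHS](hd (j, k) kj); congr (_ * _); apply: eq_bigr => b _; apply: eq_bigr => i _.
  by rewrite /= rmorphB.
rewrite subr0; congr (_ + _ + _); rewrite -[RHS](avg_sum_arch P _ (dim_field_gt0 L)).
by congr (_ * _); apply: eq_bigr => b _; apply: eq_bigr => i _; rewrite ln_tri_const.
Qed.

Lemma height1_0 : h 0 = 0.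
Proof.
have [P hP] := height1E R f 0 hE; rewrite (hP P (leqnn P)) /avg_sum big_seq big1 ?mulr0 // => b.
rewrite mem_bases => /andP[hb _]; apply: big1 => i _.
by rewrite rmorph0 (av0 (wabs_abs R hb)) /Num.max ltr10 ln1.
Qed.

(** [max(1, 1/a) = max(1, a) / a], and the denominators cancel by the product formula. *)
Lemma height1V x : h x^-1 = h x.
Proof.
have [->|x0] := eqVneq x 0; first by rewrite invr0.
have [P1 h1] := height1E R f x hE; have [P2 h2] := height1E R f x^-1 hE.
have [P3 h3] := product_formula R hE x0; pose P := (P1 + P2 + P3)%N.
rewrite (h1 P ltac:(lia)) (h2 P ltac:(lia)) -[RHS]subr0 -(h3 P ltac:(lia)) -avg_sumB.
congr (_ * _); rewrite big_seq [RHS]big_seq; apply: eq_bigr => b; rewrite mem_bases => /andP[hb _].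
apply: eq_bigr => i _; rewrite fmorphV (avV (wabs_abs R hb)); set a := wabs R b (e i x).
have a0 : 0 < a by rewrite (av_gt0 (wabs_abs R hb)) fmorph_eq0.
rewrite -ln_div ?posrE ?lt_max ?ltr01 //; congr ln.
by rewrite maxr_pMl ?invr_ge0 ?ltW // mul1r mulfV ?gt_eqF // maxC.
Qed.

Lemma height1N x : h (- x) = h x.
Proof.
have [P1 h1] := height1E R f x hE; have [P2 h2] := height1E R f (- x) hE.
pose P := (P1 + P2)%N; rewrite (h1 P ltac:(lia)) (h2 P ltac:(lia)).
congr (_ * _); rewrite big_seq [RHS]big_seq; apply: eq_bigr => b; rewrite mem_bases => /andP[hb _].
by apply: eq_bigr => i _; rewrite rmorphN (avN (wabs_abs R hb)).
Qed.

Lemma height1_affine a t : h (1 + a * t) <= ln 2 + h a + h t.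
Proof.
have [P1 h1] := height1E R f a hE; have [P2 h2] := height1E R f t hE.
have [P3 h3] := height1E R f (1 + a * t) hE; pose P := (P1 + P2 + P3)%N.
rewrite (h1 P ltac:(lia)) (h2 P ltac:(lia)) (h3 P ltac:(lia)).
rewrite -[X in X + _ + _](avg_sum_arch P _ (dim_field_gt0 L)) -!avg_sumD.
apply: avg_sum_le => b i hb; rewrite rmorphD rmorph1 rmorphM.
have hw := wabs_abs R hb; move: (e i a) (e i t) => x y.
have C1 := tri_const_ge1 R b; have C0 : 0 < tri_const R b := lt_le_trans ltr01 C1.
have M0 z : 0 < Num.max 1 (wabs R b z) by rewrite lt_max ltr01.
rewrite -ln_tri_const -!lnM ?posrE ?mulr_gt0 // ler_ln ?posrE ?mulr_gt0 //.
have M1 z : 1 <= Num.max 1 (wabs R b z) by rewrite le_max lexx.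
rewrite -mulrA ge_max; apply/andP; split.
  by rewrite !mulr_ege1.
apply: le_trans (wabs_leD R _ _ hb) _; rewrite ler_pM2l // (av1 hw) ge_max mulr_ege1 //=.
by rewrite (avM hw) ler_pM ?(av_ge0 hw) // le_max lexx orbT.
Qed.
End GlobalInequality.

Lemma height1_ge0 (R : realType) (alpha : algC) : 0 <= height1 R alpha.
Proof.
have [L [f [[|x []] // [<-] _]]] := num_field_exists [:: alpha].
have [theta [p [e hE]]] := embeddings_exist L; have [P hP] := height1E R f x hE.
rewrite (hP P (leqnn P)) mulr_ge0 ?invr_ge0 // big_seq sumr_ge0 // => b _.
by rewrite sumr_ge0 // => i _; rewrite ln_ge0 // le_max lexx.
Qed.

(** At each place, the maximum of 1 and the [|s_j|] is at most the product of the [max(1, |s_j|)].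
    The default value 0 of [height] is covered by nonnegativity of the sum. *)
Lemma height_le_sum (R : realType) m (s : 'I_m -> algC) : height R s <= \sum_j height1 R (s j).
Proof.
rewrite /height; case: xgetP => [r _ [L [f [u [fu ->]]]]|_]; last first.
  by apply: sumr_ge0 => j _; exact: height1_ge0.
have [theta [p [e hE]]] := embeddings_exist L.
have [P1 h1] := height_inE R hE u.
have [P2 h2] := eventually_fin (fun j => height1E R f (u j) hE).
pose P := (P1 + P2)%N; rewrite (h1 P ltac:(lia)); have {}h2 := h2 P ltac:(lia).
rewrite (eq_bigr _ (fun j _ => congr1 (height1 R) (esym (fu j)))) (eq_bigr _ (fun j _ => h2 j)).
rewrite -avg_sum_sum; apply: avg_sum_le => b i hb.
have M1 j : 1 <= Num.max 1 (wabs R b (e i (u j))) by rewrite le_max lexx.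
rewrite -ln_prodr => [|j _]; last exact: lt_le_trans (M1 j).
have prod1 (Q : pred 'I_m) : 1 <= \prod_(j | Q j) Num.max 1 (wabs R b (e i (u j))).
  by elim/big_ind: _ => // x y; exact: mulr_ege1.
rewrite ler_ln ?posrE; last 2 first.
- by apply: lt_le_trans (bigmax_ge_id _ _ _ _).
- exact: lt_le_trans (prod1 _).
apply: bigmax_le => [|j _]; first exact: prod1.
rewrite (bigD1 j) //=; apply: (@le_trans _ _ (Num.max 1 (wabs R b (e i (u j))))).
  by rewrite le_max lexx orbT.
by rewrite ler_peMr // (le_trans ler01).
Qed.

Lemma height1_affine_algC (R : realType) (alpha t : algC) :
  height1 R (1 + alpha * t) <= ln 2 + height1 R alpha + height1 R t.
Proof.
have [L [f [[|x [|y []]] // [<- <-] _]]] := num_field_exists [:: alpha; t].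
have [theta [p [e hE]]] := embeddings_exist L.
by rewrite -rmorphM -(rmorph1 f) -rmorphD; exact: height1_affine hE _ _ _.
Qed.

(** * Multiplicative relations on the torus *)

Section Geometry.
Variable n : nat.
Local Notation pt := ('I_n -> algC).

(** Reduces questions about lines in affine space to univariate polynomials. *)
Lemma meval_curve (g : 'I_n -> {poly algC}) (f : mpoly.mpoly n algC) :
  exists q : {poly algC}, forall t, mpoly.meval (fun i => (g i).[t]) f = q.[t].
Proof.
exists (\sum_(m <- msupp f) mcoeff m f *: \prod_i g i ^+ m i) => t.
rewrite mevalE horner_sum; apply: eq_bigr => m _; rewrite hornerZ horner_prod.
by congr (_ * _); apply: eq_bigr => i _; rewrite horner_exp.
Qed.

(** The subtori [G_m^k x 1], which form a chain of length [n] in the torus and so bound its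
    dimension from below. *)
Definition coordinate_torus (k : nat) : set pt :=
  [set x | torus x /\ forall i : 'I_n, (k <= i)%N -> x i = 1].

Lemma coordinate_torus_closed k : closed_in_torus (coordinate_torus k).
Proof.
exists [set f | exists2 i : 'I_n, (k <= i)%N & f = mpolyX algC (mnm1 i) - 1].
apply/seteqP; split=> x /= [tx hx]; split=> //.
  by move=> _ [i ki ->]; rewrite mevalB mevalXU meval1 hx // subrr.
move=> i ki; apply/eqP; rewrite -subr_eq0; apply/eqP.
by rewrite -[x i](mevalXU x) -(meval1 x) -mevalB; apply: hx; exists i.
Qed.

(** A point outside [Z1] and a point outside [Z2] are joined by a line. On it the two equations and
    the product of the coordinates are nonzero polynomials in [t], and a common nonroot gives a
    point outside both sets. *)
Lemma coordinate_torus_irreducible k : irreducible_in_torus (coordinate_torus k).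
Proof.
split; first exact: coordinate_torus_closed.
  by exists (fun=> 1); split=> // i; exact: oner_neq0.
move=> _ _ [S1 ->] [S2 ->] cover; apply: contrapT => /not_orP[n1 n2].
have pick S : ~ coordinate_torus k `<=` @torus n `&` zeros S ->
    exists x f, [/\ coordinate_torus k x, S f & mpoly.meval x f != 0].
  move=> h; apply: contrapT => none; apply: h => x hx; split; first by case: hx.
  move=> f Sf; apply/eqP; apply: contrapT => /negP fx; apply: none; by exists x, f.
have [x [f1 [[tx hx] Sf1 fx]]] := pick _ n1; have [y [f2 [[ty hy] Sf2 fy]]] := pick _ n2.
pose g i : {poly algC} := (x i)%:P + (y i - x i) *: 'X.
have gE i t : (g i).[t] = x i + (y i - x i) * t by rewrite /g hornerD hornerZ hornerX hornerC.
have g0 : (fun i => (g i).[0]) = x by apply: funext => i; rewrite gE mulr0 addr0.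
have g1 : (fun i => (g i).[1]) = y by apply: funext => i; rewrite gE mulr1 addrC subrK.
have [q1 q1E] := meval_curve g f1; have [q2 q2E] := meval_curve g f2.
have /closed_nonrootP[t] : q1 * q2 * \prod_i g i != 0.
  rewrite !mulf_neq0 //.
  - by apply: contraNneq fx => q0; rewrite -g0 q1E q0 horner0.
  - by apply: contraNneq fy => q0; rewrite -g1 q2E q0 horner0.
  apply/prodf_neq0 => i _; apply/eqP => gi; have := tx i.
  by rewrite -g0 gi horner0 eqxx.
rewrite /root !hornerM !mulf_eq0 !negb_or horner_prod => /andP[/andP[q1t q2t] /prodf_neq0 gt].
have gC : coordinate_torus k (fun i => (g i).[t]).
  split=> [i|i ki]; first exact: gt.
  by rewrite gE hx // hy // subrr mul0r addr0.
case: (cover _ gC) => -[_ z].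
  by move: q1t; rewrite -q1E z ?eqxx.
by move: q2t; rewrite -q2E z ?eqxx.
Qed.

Lemma torus_codim (G : set pt) k : (0 < k)%N -> codim_ge G k -> ~ @torus n `<=` G.
Proof.
move=> k0 cod tG; have : (n + k <= n)%N; last by lia.
apply: (cod n coordinate_torus); split=> i hi.
  by split; [exact: coordinate_torus_irreducible|move=> x [tx _]; exact: tG].
split=> [x [tx hx]|sub].
  by split=> // j ij; apply: hx; exact: ltnW.
pose x (j : 'I_n) : algC := if j == i :> nat then 2 else 1.
have /sub[_ /(_ (Ordinal hi) (leqnn i))] : coordinate_torus i.+1 x.
  split=> j; rewrite /x; first by case: (nat_of_ord j == i); rewrite ?oner_eq0 ?pnatr_eq0.
  by move=> ij; rewrite gtn_eqF.
by rewrite /x /= eqxx => /eqP; rewrite -subr_eq0 -[2]/(1 + 1) addrK oner_eq0.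
Qed.

(** Artin's argument: the relation at [x y] minus [chi m0 y] times the relation at [x] is shorter,
    the coefficient of [m] being multiplied by [chi m y - chi m0 y], nonzero for a suitable [y].
    Evaluation at the identity settles [m0]. *)
Lemma characters_independent (G : set pt) (T : eqType) (chi : T -> pt -> algC) (r : seq T) (c : T -> algC) :
  G (fun=> 1) -> (forall x y, G x -> G y -> G (fun i => x i * y i)) ->
  (forall m, chi m (fun=> 1) = 1) -> (forall m x y, chi m (fun i => x i * y i) = chi m x * chi m y) ->
  uniq r -> (forall m m', m \in r -> m' \in r -> m != m' -> exists2 x, G x & chi m x != chi m' x) ->
  (forall x, G x -> \sum_(m <- r) c m * chi m x = 0) -> forall m, m \in r -> c m = 0.
Proof.
move=> G1 GM chi1 chiM; elim: r c => [|m0 r IH] c //= /andP[m0r ur] sep rel.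
have cr m : m \in r -> c m = 0.
  move=> mr; have m0m : m0 != m by apply: contraNneq m0r => ->.
  have [|||y Gy chiy] := sep m0 m; rewrite ?mem_head ?inE ?mr ?orbT //.
  have := IH (fun m => c m * (chi m y - chi m0 y)) ur _ _ m mr.
  have h : c m * (chi m y - chi m0 y) = 0 -> c m = 0.
    by move/eqP; rewrite mulf_eq0 subr_eq0 => /orP[/eqP//|/eqP E]; rewrite E eqxx in chiy.
  move=> k; apply/h/k => [m1 m2 h1 h2|x Gx].
    by apply: sep; rewrite inE ?h1 ?h2 orbT.
  have := rel _ (GM _ _ Gx Gy); have := rel _ Gx; rewrite !big_cons => r1 r2.
  have : (c m0 * chi m0 (fun i => x i * y i) + \sum_(j <- r) c j * chi j (fun i => x i * y i))
     - chi m0 y * (c m0 * chi m0 x + \sum_(j <- r) c j * chi j x) = 0 by rewrite r1 r2 mulr0 subr0.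
  rewrite mulrDr opprD addrACA chiM (_ : _ - _ = 0) ?add0r; last by ring.
  rewrite mulr_sumr -sumrB => E; rewrite -[RHS]E; apply: eq_bigr => j _; rewrite chiM; ring.
move=> m; rewrite inE => /orP[/eqP->|]; last exact: cr.
have := rel _ G1; rewrite big_cons big_seq big1 => [|j jr]; last by rewrite cr // mul0r.
by rewrite addr0 chi1 mulr1.
Qed.

(** The characters in question are the monomials of an equation [f] of [G] that does not vanish on
    the torus: distinct on [G], they would force all coefficients of [f] to be 0. *)
Lemma proper_subgroup_relation (G : set pt) : algebraic_subgroup G -> ~ @torus n `<=` G ->
  exists m m' : 'I_n -> nat, (exists i, m i != m' i) /\
    forall x, G x -> \prod_i x i ^+ m i = \prod_i x i ^+ m' i.
Proof.
move=> [[S GE] G1 GM _] ntG.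
have [y [f [ty Sf fy]]] : exists y f, [/\ torus y, S f & mpoly.meval y f != 0].
  apply: contrapT => none; apply: ntG => x tx; rewrite GE; split=> // f Sf.
  apply/eqP; apply: contrapT => /negP fx; apply: none; by exists x, f.
pose chi (m : multinom n) (x : pt) := \prod_i x i ^+ m i.
have [[m [m' [mS mS' mm' h]]]|none] := pselect (exists m m', [/\ m \in msupp f, m' \in msupp f,
    m != m' & forall x, G x -> chi m x = chi m' x]).
  exists m, m'; split=> //; apply: contrapT => same; move/eqP: mm'; apply.
  by apply/mnmP => i; apply/eqP; apply: contrapT => /negP ne; apply: same; exists i.
exfalso; have := @characters_independent G _ chi (msupp f) (fun m => mcoeff m f) G1 GM.
move=> H; have cf m : m \in msupp f -> mcoeff m f = 0.
  apply: H => [m1|m1 x z||m1 m2 h1 h2 ne|x Gx].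
  - by rewrite /chi big1 // => i _; rewrite expr1n.
  - by rewrite /chi -big_split; apply: eq_bigr => i _; rewrite exprMn.
  - exact: msupp_uniq.
  - apply: contrapT => h; apply: none; exists m1, m2; split=> // x Gx.
    by apply/eqP; apply: contrapT => /negP nex; apply: h; exists x.
  by move: Gx; rewrite GE => -[_ /(_ f Sf)]; rewrite mevalE.
move: fy; rewrite mevalE big_seq big1 ?eqxx // => m mS.
by rewrite cf // mul0r.
Qed.

Lemma Sigma2_relation (s : pt) : Sigma2 s -> exists m m' : 'I_n -> nat,
  (exists i, m i != m' i) /\ \prod_i s i ^+ m i = \prod_i s i ^+ m' i.
Proof.
move=> [G [hG cod Gs]]; have [m [m' [mm' h]]] := proper_subgroup_relation hG (torus_codim (k := 2) isT cod).
by exists m, m'; split=> //; exact: h.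
Qed.

Lemma closed_closure (C : set pt) : closed_in_torus C -> C = @torus n `&` zariski_closure C.
Proof.
move=> [S CE]; apply/seteqP; split=> x.
  by move=> Cx; split=> [|f hf]; [move: Cx; rewrite CE => -[]|exact: hf].
move=> [tx zx]; rewrite CE; split=> // f Sf; apply: zx => y; rewrite CE => -[_]; exact.
Qed.
End Geometry.

(** * Lines through the identity *)

Lemma poly_ext (q r : {poly algC}) : (forall t, q.[t] = r.[t]) -> q = r.
Proof.
move=> h; apply/eqP; rewrite -subr_eq0; apply: contrapT => /negP/closed_nonrootP[t].
by rewrite /root hornerD hornerN h subrr eqxx.
Qed.

Section LineThroughOne.
Variables (n : nat) (K : fieldExtType rat) (iota : {rmorphism K -> algC}).
Variables (C : set ('I_n -> algC)) (x : mpoly.mpoly n K).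
Hypotheses (hC : closed_in_torus C) (hline : is_line (zariski_closure C)).
Hypothesis hs0 : C (fun=> 1).
Hypothesis hgen : forall G : set ('I_n -> algC),
  algebraic_subgroup G -> C `<=` G -> G = torus (n := n).
Hypotheses (hx : is_iso_to_A1 iota (zariski_closure C) x) (hx0 : evalK iota x (fun=> 1) = 0).

Lemma closure_sub : C `<=` zariski_closure C.
Proof. by move=> s Cs f; apply. Qed.

(** The inverse of [x] is given by polynomials of unknown degree. As its image lies on a line, they
    have the form [b_i + d_i U], and composing with the restriction [W] of [x] to the line gives
    [W(U) = X], so [U] has degree 1. The constant terms are 1 because [x] vanishes at the
    identity. *)
Lemma line_affine : exists a : 'I_n -> K, forall t,
  zariski_closure C (fun i => 1 + iota (a i) * t) /\ evalK iota x (fun i => 1 + iota (a i) * t) = t.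
Proof.
have [y [yZ yt]] := hx; pose Y i := map_poly iota (y i).
have [b [d [[i0 d0] ZE]]] := hline.
pose U := (d i0)^-1 *: (Y i0 - (b i0)%:P).
have YU i : Y i = (b i)%:P + d i *: U.
  apply: poly_ext => t; have [+ _] := yt t; rewrite ZE => -[u uE].
  have uE' k : (Y k).[t] = b k + u * d k by have := congr1 (fun f => f k) uE.
  rewrite hornerD hornerC hornerZ /U hornerZ hornerD hornerN hornerC !uE'.
  by field.
have [W WE] := meval_curve (fun i => (b i)%:P + d i *: 'X) (map_mpoly iota x).
have WU : W \Po U = 'X.
  apply: poly_ext => t; rewrite horner_comp hornerX -WE -[RHS](proj2 (yt t)) /evalK.
  congr (mpoly.meval _ _); apply: funext => i; rewrite -/(Y i) YU.
  by rewrite !hornerD !hornerZ hornerX !hornerC.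
have sU : size U = 2%N.
  have := size_comp_poly W U; rewrite WU size_polyX /= => /esym/eqP.
  rewrite muln_eq1 => /andP[_]; by case: (size U) => [|[|[|]]].
have sy i : (size (y i) <= 2)%N.
  rewrite -(size_map_poly iota) -/(Y i) YU; apply: leq_trans (size_polyD _ _) _.
  rewrite geq_max (leq_trans (size_polyC_leq1 _)) //=.
  by apply: leq_trans (size_scale_leq _ _) _; rewrite sU.
exists (fun i => (y i)`_1) => t.
have yE i u : (Y i).[u] = iota (y i)`_0 + iota (y i)`_1 * u.
  rewrite (@horner_coef_wide _ 2%N) ?size_map_poly ?sy // !big_ord_recl big_ord0 /=.
  by rewrite !coef_map expr0 expr1 mulr1 addr0.
have y0 i : iota (y i)`_0 = 1.
  have := congr1 (fun f => f i) (yZ _ (closure_sub hs0)); rewrite /= hx0 -/(Y i) yE.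
  by rewrite mulr0 addr0.
have := yt t; have -> // : (fun i => (map_poly iota (y i)).[t]) = (fun i => 1 + iota (y i)`_1 * t).
by apply: funext => i; rewrite -/(Y i) yE y0.
Qed.

Section WithSlopes.
Variable a : 'I_n -> K.
Hypothesis ha : forall t,
  zariski_closure C (fun i => 1 + iota (a i) * t) /\ evalK iota x (fun i => 1 + iota (a i) * t) = t.

Lemma closure_point s : zariski_closure C s -> s = (fun i => 1 + iota (a i) * evalK iota x s).
Proof.
move=> Zs; have [y [yZ yt]] := hx; have [Za ea] := ha (evalK iota x s).
by rewrite -[LHS](yZ _ Zs) -[RHS](yZ _ Za) ea.
Qed.

(** Applies the hypothesis on [C] to a single equation whose zeros form a subgroup; the cases of
    interest are [z_i = 1] and [z_i = z_j]. *)
Lemma curve_subgroup_eq (f : mpoly.mpoly n algC) :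
  mpoly.meval (fun=> 1) f = 0 ->
  (forall y z, mpoly.meval y f = 0 -> mpoly.meval z f = 0 -> mpoly.meval (fun i => y i * z i) f = 0) ->
  (forall y, mpoly.meval y f = 0 -> mpoly.meval (fun i => (y i)^-1) f = 0) ->
  (forall s, C s -> mpoly.meval s f = 0) -> forall y, torus y -> mpoly.meval y f = 0.
Proof.
move=> f1 fM fV fC y ty; pose G : set ('I_n -> algC) := @torus n `&` zeros [set f].
have GE z : G z <-> torus z /\ mpoly.meval z f = 0.
  by split=> -[tz hz]; split=> //; [exact: hz|move=> _ ->].
have tC s : C s -> torus s by case: hC => S ->; case.
have : G = @torus n.
  apply: hgen => [|s Cs]; last by apply/GE; split; [exact: tC|exact: fC].
  split; first by exists [set f].
  - by apply/GE; split=> // i; exact: oner_neq0.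
  - move=> u z /GE[tu fu] /GE[tz fz]; apply/GE; split; last exact: fM.
    by move=> i; rewrite mulf_neq0 ?tu ?tz.
  - by move=> u /GE[tu fu]; apply/GE; split; [move=> i; rewrite invr_eq0 tu|exact: fV].
by move=> GT; have /GE[] : G y by rewrite GT.
Qed.

(** A witness that neither [z_i = 1] nor [z_i = z_j] holds on the whole torus. *)
Lemma point_two_torus (i : 'I_n) : torus (fun j : 'I_n => if j == i then 2 else 1 : algC).
Proof. by move=> j; case: (j == i); rewrite ?oner_eq0 ?pnatr_eq0. Qed.

Lemma two_neq1 : 2 - 1 != 0 :> algC.
Proof. by rewrite -[2]/(1 + 1) addrK oner_eq0. Qed.

(** A zero slope would place [C] in the subgroup [z_i = 1]. *)
Lemma slope_neq0 i : a i != 0.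
Proof.
apply/eqP => ai.
have E s : mpoly.meval s (mpolyX algC (mnm1 i) - 1) = s i - 1 by rewrite mevalB mevalXU meval1.
have := curve_subgroup_eq (f := mpolyX algC (mnm1 i) - 1).
move=> /(_ _ _ _ _ _ (point_two_torus i)) H; have : mpoly.meval (fun j : 'I_n => if j == i then 2 else 1 : algC) (mpolyX algC (mnm1 i) - 1) = 0.
  apply: H => [|y z|y|s Cs]; rewrite !E.
  - exact: subrr.
  - by move=> /eqP; rewrite subr_eq0 => /eqP-> /eqP; rewrite subr_eq0 => /eqP->; rewrite mulr1 subrr.
  - by move=> /eqP; rewrite subr_eq0 => /eqP->; rewrite invr1 subrr.
  by rewrite (closure_point (closure_sub Cs)) ai rmorph0 mul0r addr0 subrr.
by rewrite E eqxx; apply/eqP/two_neq1.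
Qed.

(** Equal slopes would place [C] in the subgroup [z_i = z_j]. *)
Lemma slope_inj : injective a.
Proof.
move=> i j aij; apply/eqP; apply: contrapT => /negP ij.
have E s : mpoly.meval s (mpolyX algC (mnm1 i) - mpolyX algC (mnm1 j)) = s i - s j by rewrite mevalB !mevalXU.
have := curve_subgroup_eq (f := mpolyX algC (mnm1 i) - mpolyX algC (mnm1 j)).
move=> /(_ _ _ _ _ _ (point_two_torus i)) H.
have : mpoly.meval (fun j : 'I_n => if j == i then 2 else 1 : algC) (mpolyX algC (mnm1 i) - mpolyX algC (mnm1 j)) = 0.
  apply: H => [|y z|y|s Cs]; rewrite !E.
  - exact: subrr.
  - by move=> /eqP; rewrite subr_eq0 => /eqP-> /eqP; rewrite subr_eq0 => /eqP->; rewrite subrr.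
  - by move=> /eqP; rewrite subr_eq0 => /eqP->; rewrite subrr.
  by rewrite (closure_point (closure_sub Cs)) aij subrr.
by rewrite E eqxx eq_sym (negPf ij); apply/eqP/two_neq1.
Qed.

(** Since [C] is closed in the torus, the points of the line missing from [C] are those with a
    vanishing coordinate. *)
Lemma XiE : Xi iota C x = [set - (iota (a i))^-1 | i in [set: 'I_n]].
Proof.
have ia i : iota (a i) != 0 by rewrite fmorph_eq0 slope_neq0.
apply/seteqP; split=> t /=.
  move=> [s [Zs nCs] <-]; apply: contrapT => none; apply: nCs; rewrite (closed_closure hC); split=> // i.
  rewrite (closure_point Zs); apply/eqP => /eqP; rewrite addr_eq0 => /eqP h; apply: none.
  exists i => //; apply: (mulfI (ia i)); rewrite mulrN mulfV //.
  by rewrite -[RHS]opprK -h.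
move=> [i _ <-]; set t0 := - _; have [Zt et] := ha t0.
exists (fun j => 1 + iota (a j) * t0) => //; split=> // Ct.
have : torus (fun j => 1 + iota (a j) * t0) by move: Ct; rewrite (closed_closure hC) => -[].
by move=> /(_ i); rewrite /t0 mulrN mulfV // subrr eqxx.
Qed.

(** Distinct slopes give distinct elements of [Xi], so the sum over the set is a sum over indices;
    the height is invariant under [z |-> -1/z]. *)
Lemma HXiE (R : realType) : HXi iota R C x = \sum_i height1 R (iota (a i)).
Proof.
rewrite /HXi XiE.
have uq : uniq [seq - (iota (a i))^-1 | i <- enum 'I_n].
  rewrite map_inj_uniq ?enum_uniq // => i j /oppr_inj/invr_inj/fmorph_inj; exact: slope_inj.
rewrite (@eq_fsbigl _ _ _ _ _ _ [set` [seq - (iota (a i))^-1 | i <- enum 'I_n]]); last first.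
  apply/seteqP; split=> t /=.
    by move=> [i _ <-]; apply/mapP; exists i; rewrite ?mem_enum.
  by move=> /mapP[i _ ->]; exists i.
rewrite -fsbig_seq // big_map big_enum; apply: eq_bigr => i _.
have [theta [p [e hE]]] := embeddings_exist K.
by rewrite -fmorphV -rmorphN (height1N R hE iota) (height1V R hE iota).
Qed.
End WithSlopes.
End LineThroughOne.

(** * Complex places *)

Section ComplexPlaces.
Variables (R : realType) (L : fieldExtType rat).
Local Notation Cx := (complex.complex R).
Local Notation normc := (@complex.ComplexField.Normc.normc R).

Lemma embedding_horner (F : fieldType) (s : {rmorphism L -> F}) (io : {rmorphism rat -> F}) (h : {poly rat}) x :
  s (map_poly (in_alg L) h).[x] = (map_poly io h).[s x].
Proof.
rewrite -horner_map -map_poly_comp; congr _.[_]; apply: eq_map_poly => q /=.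
by rewrite alg_num_field fmorph_rat fmorph_eq_rat.
Qed.

Let cj : {rmorphism Cx -> Cx} := (@complex.conjc R : {rmorphism Cx -> Cx}).

(** Each complex place comes from a nonreal embedding; the values at [theta] of these embeddings and
    of their complex conjugates are distinct roots of [p], whose degree is [\dim {:L}]. *)
Lemma complex_places_le : (2 * tau R L <= \dim {:L})%N.
Proof.
rewrite /tau; set X := fset_set _.
have [theta [p [e [pm rep proot pE _]]]] := embeddings_exist L.
(* [fset_set] of an infinite set is empty, so the implication holds before finiteness is known. *)
have XP v : v \in X -> complex_places v.
  have [fin|inf] := pselect (finite_set (@complex_places R L)).
    by rewrite in_fset_set // inE.
  by rewrite /X /fset_set; case: pselect.
have [->|[v0 v0X]] := fset_0Vmem X; first by rewrite cardfs0 muln0.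
have [s0 _] := XP _ v0X.
have ex v : exists s : {rmorphism L -> Cx}, v \in X -> (exists x, complex.Im (s x) != 0) /\ v = normc \o s.
  by have [/XP[s hs]|_] := boolP (v \in X); [exists s|exists s0].
have [s hs] := choice ex.
have io : {rmorphism rat -> Cx} by exact: (ratr : {rmorphism rat -> Cx}).
pose q := map_poly io p.
have q0 : q != 0 by rewrite map_poly_eq0 monic_neq0.
have rootq (f : {rmorphism L -> Cx}) : root q (f theta).
  by apply/rootP; rewrite /q -embedding_horner (eqP (_ : root _ _)) ?rmorph0 // proot.
have det (f g : {rmorphism L -> Cx}) : f theta = g theta -> f =1 g.
  by move=> fg z; have [h _ ->] := rep z; rewrite !(embedding_horner _ io) fg.
have norm_cj z : normc (cj z) = normc z by case: z => u w /=; rewrite sqrrN.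
pose rs := [seq s v theta | v <- X] ++ [seq cj (s v theta) | v <- X].
have : (size rs < size q)%N.
  apply: max_poly_roots => //.
    by rewrite all_cat; apply/andP; split; apply/allP => _ /mapP[v _ ->];
      [exact: rootq|exact: (rootq (cj \o s v))].
  have eqv v w : v \in X -> w \in X -> normc \o s v =1 normc \o s w -> v = w.
    by move=> vX wX h; rewrite (hs v vX).2 (hs w wX).2; exact: funext.
  have inj : {in X &, injective (fun v => s v theta)}.
    by move=> v w vX wX /det h; apply: eqv => // z /=; rewrite h.
  rewrite cat_uniq !map_inj_in_uniq ?fset_uniq //; last first.
    by move=> v w vX wX /fmorph_inj; exact: (inj v w vX wX).
  rewrite andbT /=; apply/hasPn => _ /mapP[v vX ->]; apply/mapP => -[w wX h].
  (* If the conjugate embedding of [v] were the embedding of [w], the moduli would agree, so [v = w]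
     and the embedding would be real. *)
  have /= dw := det (cj \o s v) (s w) h.
  have vw : v = w by apply: eqv => // z /=; rewrite -dw norm_cj.
  have [[z /negP nz] _] := hs v vX; apply: nz; move: (dw z); rewrite -vw /=.
  by case: (s v z) => u y [] /= /eqP; rewrite eq_sym -addr_eq0 -mulr2n mulrn_eq0 /=.
rewrite size_cat !size_map addnn -mul2n size_map_poly.
have -> : size p = (\dim {:L}).+1.
  rewrite -(size_map_poly (ratr : {rmorphism rat -> algC})) pE size_prod_XsubC.
  by rewrite /index_enum -enumT size_enum_ord.
by rewrite ltnS.
Qed.
End ComplexPlaces.

(** * Numerical estimates *)

Lemma height_on_line (R : realType) (K : fieldExtType rat) (iota : {rmorphism K -> algC})
    n (a : 'I_n -> K) (t : algC) (m m' : 'I_n -> nat) :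
  injective a -> (forall i, a i != 0) -> (forall i, 1 + iota (a i) * t != 0) ->
  (exists i, m i != m' i) ->
  \prod_i (1 + iota (a i) * t) ^+ m i = \prod_i (1 + iota (a i) * t) ^+ m' i ->
  height1 R t <= 2 * n%:R * \sum_i height1 R (iota (a i)) + n%:R * (n%:R + 1) * ln 2.
Proof.
move=> inja a0 l0 [i0 mi0] rel.
have [L [f [s sE _]]] := num_field_exists (t :: [seq iota (a i) | i <- enum 'I_n]).
have [T [A fT fA]] : exists T : L, exists2 A : 'I_n -> L, f T = t & forall i, f (A i) = iota (a i).
  case: s sE => [|T s] //= [fT sE]; exists T, (fun i => s`_i) => // i.
  have := congr1 (fun r => r`_i) sE; rewrite (nth_map 0) => [->|].
    by rewrite (nth_map i) ?size_enum_ord // nth_ord_enum.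
  by have := congr1 size sE; rewrite size_map size_map size_enum_ord => ->.
have [theta [p [e hE]]] := embeddings_exist L.
have A_neq0 i : A i != 0 by rewrite -(fmorph_eq0 f) fA fmorph_eq0.
have lE i : f (1 + A i * T) = 1 + iota (a i) * t by rewrite rmorphD rmorph1 rmorphM fA fT.
have lA0 i : 1 + A i * T != 0 by rewrite -(fmorph_eq0 f) lE.
have relL : \prod_i (1 + A i * T) ^+ m i = \prod_i (1 + A i * T) ^+ m' i.
  apply: (fmorph_inj f); rewrite !rmorph_prod.
  by under eq_bigr => j _ do rewrite rmorphXn lE; under [RHS]eq_bigr => j _ do rewrite rmorphXn lE.
(* The common part of the exponents is cancelled, so that no form occurs on both sides. *)
pose c i := minn (m i) (m' i).
have redL : \prod_i (1 + A i * T) ^+ (m i - m' i) = \prod_i (1 + A i * T) ^+ (m' i - m i).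
  have c0 : \prod_i (1 + A i * T) ^+ c i != 0.
    by apply/prodf_neq0 => i _; rewrite expf_neq0.
  apply: (mulIf c0); rewrite -!big_split /=.
  rewrite (eq_bigr (fun i => (1 + A i * T) ^+ m i)) => [|i _]; last first.
    by rewrite -exprD; congr (_ ^+ _); rewrite /c; lia.
  rewrite relL; apply: eq_bigr => i _.
  by rewrite -exprD; congr (_ ^+ _); rewrite /c; lia.
pose sm := (\sum_i (m i - m' i))%N; pose sm' := (\sum_i (m' i - m i))%N; pose d := maxn sm sm'.
(* The index [ord0] carries the constant form [1], used to equalize the degrees. *)
pose A1 (j : 'I_n.+1) := oapp A 0 (unlift ord0 j).
pose P1 (j : 'I_n.+1) := oapp (fun i => (m i - m' i)%N) (d - sm)%N (unlift ord0 j).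
pose Q1 (j : 'I_n.+1) := oapp (fun i => (m' i - m i)%N) (d - sm')%N (unlift ord0 j).
have injA1 : injective A1.
  move=> j k; rewrite /A1; case: unliftP => [j' ->|->]; case: unliftP => [k' ->|->] //=.
  - by move=> /(congr1 f); rewrite !fA => /fmorph_inj/inja->.
  - by move=> /eqP; rewrite (negPf (A_neq0 _)).
  - by move=> /esym/eqP; rewrite (negPf (A_neq0 _)).
have sumP1 : (\sum_j P1 j = d)%N.
  rewrite big_ord_recl /P1 unlift_none /=; under eq_bigr => j _ do rewrite liftK /=.
  by rewrite -/sm subnK // leq_maxl.
have sumQ1 : (\sum_j Q1 j = d)%N.
  rewrite big_ord_recl /Q1 unlift_none /=; under eq_bigr => j _ do rewrite liftK /=.
  by rewrite -/sm' subnK // leq_maxr.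
have d0 : (0 < d)%N.
  rewrite leq_max !lt0n !sum_nat_eq0 -negb_and; apply/negP => /andP[/forallP/(_ i0) h /forallP/(_ i0) h'].
  by move: h h' mi0; rewrite /=; lia.
have := height_relation_bound R hE f (J := 'I_n.+1) (A := A1) (t := T) (p := P1) (q := Q1) ord0 injA1.
move=> /(_ d _ _ sumP1 sumQ1 d0 _).
have lA1 j : 1 + A1 j * T != 0.
  by rewrite /A1; case: unliftP => [j' _|_] //=; rewrite mul0r addr0 oner_eq0.
have PQ j : P1 j = 0%N \/ Q1 j = 0%N.
  rewrite /P1 /Q1; case: unliftP => [j' _|_] /=.
    by have [h|h] := leqP (m j') (m' j'); [left|right]; lia.
  by rewrite /d; have [h|h] := leqP sm sm'; [right|left]; lia.
have rel1 : \prod_j (1 + A1 j * T) ^+ P1 j = \prod_j (1 + A1 j * T) ^+ Q1 j.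
  rewrite !big_ord_recl /A1 /P1 /Q1 !unlift_none /= mul0r addr0 !expr1n !mul1r.
  by under eq_bigr => j _ do rewrite liftK /=; under [RHS]eq_bigr => j _ do rewrite liftK /=.
move=> /(_ lA1 PQ rel1); rewrite fT; set h := fun j => height1 R (f (A1 j)).
have sumh : \sum_j h j = \sum_i height1 R (iota (a i)).
  rewrite big_ord_recl /h {1}/A1 unlift_none /= (height1_0 R hE f) add0r.
  by apply: eq_bigr => i _; rewrite /A1 liftK /= fA.
move=> /le_trans; apply; rewrite -sumh le_eqVlt; apply/orP; left; apply/eqP.
(* Each height occurs [n] times as [h j] and [n] times as [h k]; the extra form has slope 0 and
   height 0. *)
have inner j : \sum_(k | k != j) (ln 2 + h j + h k) = n%:R * (ln 2 + h j) + \sum_k h k - h j.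
  rewrite big_split /= sumr_const cardC1 card_ord /= mulr_natl -addrA; congr (_ + _).
  by rewrite [X in _ = X - _](bigD1 j) //= addrAC subrr add0r.
rewrite (eq_bigr _ (fun j _ => inner j)) sumrB big_split /= -mulr_sumr big_split /= !sumr_const card_ord.
have natS (z : R) : z *+ n.+1 = (n%:R + 1) * z by rewrite natr1 mulr_natl.
by rewrite !natS; ring.
Qed.

Lemma bin_ge_top (N j : nat) : (0 < j < N)%N -> (N <= 'C(N, j))%N.
Proof.
elim: N j => [|N IH] [|j] //; rewrite !ltnS => /andP[_ jN]; rewrite binS.
have [jN'|Nj] := ltnP j.+1 N.
  have := IH j.+1 _; rewrite jN' => /(_ isT); have : (0 < 'C(N, j))%N by rewrite bin_gt0; lia.
  lia.
have -> : N = j.+1 by lia.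
by rewrite binn binSn.
Qed.

Lemma bin_ge_bin2 (N j : nat) : (2 <= j)%N -> (j + 2 <= N)%N -> ('C(N, 2) <= 'C(N, j))%N.
Proof.
elim: N j => [|N IH] [|[|j]] // _ h.
have [->|ne] := eqVneq N.+1 (j.+2 + 2)%N.
  by rewrite -[X in (_ <= X)%N]bin_sub ?leq_addr // addKn.
have h' : (j.+2 + 2 <= N)%N by move: h; rewrite leq_eqVlt eq_sym (negPf ne).
have h1 : ('C(N, 2) <= 'C(N, j.+2))%N by apply: IH.
have h2 : (N <= 'C(N, j.+1))%N by apply: bin_ge_top; rewrite ltn0Sn /=; apply: leq_trans h'; lia.
by rewrite !binS bin1 leq_add.
Qed.

(** For [n = 4k - 1] the binomial is at least ['C(5k + 2, 2)], and
    [(5k + 2)(5k + 1) >= (4k + 1)(4k)]; for [n = 4k + 1] it is at least [5k + 3]. *)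
Lemma A_odd_ge1 (R : realType) n : odd n -> 1 <= A_odd R n.
Proof.
move=> on; rewrite /A_odd; case: eqP => n3.
  set k := (n.+1 %/ 4)%N; have k0 : (0 < k)%N by rewrite /k; lia.
  have bk : ((5 * k + 2) * (5 * k + 1) <= 2 * 'C(5 * k + 2, 4 * k - 1))%N.
    have : ('C(5 * k + 2, 2) <= 'C(5 * k + 2, 4 * k - 1))%N by apply: bin_ge_bin2; lia.
    have -> : ((5 * k + 2) * (5 * k + 1) = 2 * 'C(5 * k + 2, 2))%N.
      by rewrite [RHS]mulnC bin_ffact ffactnS ffactn1 addn2 addn1.
    by rewrite leq_mul2l.
  have D0 : 0 < ((4 * k + 1)%N%:R * (4 * k)%N%:R : R) by rewrite mulr_gt0 ?ltr0n; lia.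
  rewrite mulrAC ler_pdivlMr // mul1r -!natrM ler_nat; apply: leq_trans bk; nia.
set k := (n %/ 4)%N; have D0 : 0 < (4 * k + 2)%N%:R :> R by rewrite ltr0n; lia.
rewrite mulrAC ler_pdivlMr // !mul1r ler_nat.
apply: leq_trans (_ : 5 * k + 3 <= _)%N; first by lia.
by apply: bin_ge_top; lia.
Qed.

Lemma A_ge1 (R : realType) n : (0 < n)%N -> 1 <= A R n.
Proof.
rewrite /A => n0; case: ifP => [on|en]; first exact: A_odd_ge1.
have : 1 <= A_odd R n.-1 by apply: A_odd_ge1; lia.
lra.
Qed.

(** The right side is [(3 delta)^n] at the smallest admissible [delta = (n + 2)/4]. From [n] to
    [n + 1] the left side grows at most by the factor [N = n + 2], and the right side by
    [(3/4) N (1 + 1/N)^(n+1)], at least [(9/8) N] by Bernoulli. *)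
Lemma fact_le_power (R : realType) n :
  n`!%:R * (1 + n%:R / 2) <= (3 / 4 * (n%:R + 2)) ^+ n :> R.
Proof.
elim: n => [|n IH]; first by rewrite fact0 expr0 mul0r addr0 mulr1.
have n0 : 0 <= n%:R :> R by [].
set N := n%:R + 2 : R; have N2 : 2 <= N by rewrite /N; lra.
have N0 : 0 < N by lra.
have Ni : 0 < N^-1 by rewrite invr_gt0.
have bern k : 1 + k%:R * N^-1 <= (1 + N^-1) ^+ k.
  elim: k => [|k IHk]; first by rewrite mul0r addr0 expr0.
  rewrite exprS; apply: le_trans (ler_wpM2l _ IHk); last by lra.
  have := mulr_ge0 (mulr_ge0 (ltW Ni) (ltW Ni)) (ler0n R k).
  rewrite -[k.+1]addn1 natrD; lra.
have b1 : 3 / 2 <= (1 + N^-1) ^+ n.+1.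
  apply: le_trans (bern n.+1); have -> : n.+1%:R = N - 1 by rewrite -natr1 /N; ring.
  have Nh : N^-1 <= 2^-1 by rewrite lef_pV2 ?posrE.
  by rewrite mulrBl mulfV ?gt_eqF // mul1r; lra.
have -> : 3 / 4 * (n.+1%:R + 2) = 3 / 4 * N * (1 + N^-1).
  have NN : N * (1 + N^-1) = N + 1 by rewrite mulrDr mulr1 mulfV ?gt_eqF.
  by rewrite -[RHS]mulrA NN /N -natr1; ring.
rewrite exprMn exprS; set X := (3 / 4 * N) ^+ n in IH *.
have X0 : 0 <= X by rewrite exprn_ge0 // mulr_ge0 // ltW.
apply: (@le_trans _ _ (N * X)); last first.
  apply: (@le_trans _ _ (3 / 4 * N * X * (3 / 2))).
    by have := mulr_ge0 (ltW N0) X0; lra.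
  by rewrite ler_wpM2l // !mulr_ge0 // ltW.
apply: le_trans (ler_wpM2l (ltW N0) IH); rewrite factS natrM -[n.+1]addn1 natrD.
set f := n`!%:R; have f0 : 0 <= f by rewrite /f.
have : 0 <= f * (1 / 2) by rewrite mulr_ge0.
rewrite /N; lra.
Qed.

Lemma B_power_ge (R : realType) n (delta : R) : 1 / 4 * (n%:R + 2) <= delta ->
  1 + n%:R / 2 <= B R n * delta ^+ n.
Proof.
move=> hd; have f0 : 0 < n`!%:R :> R by rewrite ltr0n fact_gt0.
have n0 : 0 <= n%:R :> R by [].
have base : 1 + n%:R / 2 <= 3 ^+ n / n`!%:R * delta ^+ n.
  rewrite mulrAC -exprMn ler_pdivlMr // mulrC; apply: le_trans (fact_le_power R n) _.
  by apply: lerXn2r; rewrite ?nnegrE; lra.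
rewrite /B; case: ifP => // _; rewrite -mulrA; lra.
Qed.

Lemma ln2_le1 (R : realType) : ln 2 <= 1 :> R.
Proof. by have := @le_ln1Dx R 1; rewrite -[1 + 1]/2; apply; lra. Qed.

Theorem theorem1p2 (R : realType) :
  exists c : nat -> R -> R,
  forall (n : nat) (hn : (2 <= n)%N)
    (K : fieldExtType rat) (iota : {rmorphism K -> algC})
    (C : set ('I_n -> algC))
    (hC : closed_in_torus C)
    (hline : is_line (zariski_closure C))
    (hK : defined_over iota (zariski_closure C))
    (hs0 : C (fun=> 1))
    (hgen : forall G : set ('I_n -> algC),
       algebraic_subgroup G -> C `<=` G -> G = torus (n := n))
    (x : mpoly.mpoly n K)
    (hx : is_iso_to_A1 iota (zariski_closure C) x)
    (hx0 : evalK iota x (fun=> 1) = 0)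
    (H : R) (hH : HXi iota R C x <= H)
    (s : 'I_n -> algC) (hCs : C s) (hs : Sigma2 s),
  let Ks := adjoin_coords iota s in
  let D := \dim {:Ks} in
  let delta := maxn 1 (tau R Ks) in
  let lambda : R := 'C(n + delta, delta)%:R in
  [/\ height R s <= c n H * D%:R ^+ n * (ln D%:R + 1),
      delta%:R <= Num.max 1 (1 / 2 * D%:R) :> R,
      height1 R (evalK iota x s) <
        n%:R * (8 * lambda ^+ 3 - 38 / 10 * lambda ^+ 2)
             * (ln delta%:R + 2) * (H + 1)
    & 1 / 4 * (n%:R + 2) <= delta%:R :> R ->
      height1 R (evalK iota x s) <
        8 * n%:R * A R n ^+ 2 * B R n * delta%:R ^+ n
          * (ln (3 * delta%:R) + 2) * (H + 1)].
Proof.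
(* Bounds the sum of the heights of the coordinates [1 + a_i t], each at most [1 + h(a_i) + h(t)];
   the factor in the degree is at least 1. *)
exists (fun n H => n%:R + H + n%:R * (2 * n%:R * H + n%:R * (n%:R + 1))).
move=> n n2 K iota C hC hline _ hs0 hgen x hx hx0 H hH s Cs S2s Ks D delta lambda.
have [a ha] := line_affine hline hs0 hx hx0.
have a0 := slope_neq0 hC hgen hx ha; have inja := slope_inj hC hgen hx ha.
rewrite (HXiE hC hgen hx ha) in hH; set t := evalK iota x s.
have sE : s = (fun i => 1 + iota (a i) * t) by have Z := closure_sub Cs; exact: (closure_point hx ha Z).
have ts : torus s by move: Cs; rewrite (closed_closure hC) => -[].
have l0 i : 1 + iota (a i) * t != 0 by have := ts i; rewrite sE.
have [m [m' [mm' rel]]] := Sigma2_relation S2s.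
have relt : \prod_i (1 + iota (a i) * t) ^+ m i = \prod_i (1 + iota (a i) * t) ^+ m' i.
  by move: rel; rewrite sE.
have bound := height_on_line R inja a0 l0 mm' relt.
set hs := \sum_i _ in hH bound.
have hs_ge0 : 0 <= hs by apply: sumr_ge0 => i _; exact: height1_ge0.
have H0 : 0 <= H by exact: le_trans hH.
have n2R : 2 <= n%:R :> R by rewrite ler_nat.
have n0R : 0 < n%:R :> R by apply: lt_le_trans n2R.
have nn0 : 0 <= n%:R * (n%:R + 1) :> R by rewrite mulr_ge0 // ltW // ltr_wpDl.
have ht : height1 R t <= 2 * n%:R * H + n%:R * (n%:R + 1).
  apply: le_trans bound _; apply: lerD; first by rewrite ler_wpM2l // mulr_ge0.
  by rewrite ler_piMr // ln2_le1.
have D0 : (0 < D)%N := dim_field_gt0 Ks.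
have delta1 : (1 <= delta)%N by rewrite leq_maxl.
have lnd : 0 <= ln delta%:R :> R by rewrite ln_ge0 // ler1n.
split.
- have hsum : height R s <= n%:R + H + n%:R * (2 * n%:R * H + n%:R * (n%:R + 1)).
    apply: le_trans (height_le_sum R s) _.
    have each i : height1 R (s i) <= 1 + height1 R (iota (a i)) + height1 R t.
      rewrite [in leLHS]sE; apply: le_trans (height1_affine_algC R _ _) _.
      by rewrite -!addrA lerD2r ln2_le1.
    apply: le_trans (ler_sum _ (fun i _ => each i)) _.
    rewrite !big_split /= !sumr_const card_ord -/hs; apply: lerD; first by apply: lerD.
    by rewrite -[leLHS]mulr_natl ler_wpM2l // ltW.
  apply: le_trans hsum _; rewrite -[leRHS]mulrA ler_peMr //.
    have n0 := ltW n0R; apply: addr_ge0; first exact: addr_ge0.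
    by apply: mulr_ge0 => //; apply: addr_ge0 => //; rewrite !mulr_ge0.
  by rewrite mulr_ege1 ?exprn_ege1 ?ler1n // lerDr ln_ge0 // ler1n.
- rewrite /delta; case: (leqP (tau R Ks) 1) => h; first by rewrite le_max lexx.
  rewrite le_max; apply/orP; right.
  have := complex_places_le R Ks; rewrite -(ler_nat R) natrM -/D; lra.
(* As [delta >= 1], [lambda] is at least [n + 1 >= 3]; then [8 lambda^2 - 3.8 lambda >= 1], and the
   cubic factor is at least [n + 1]. *)
- have lam : n%:R + 1 <= lambda.
    rewrite /lambda natr1 ler_nat -bin_sub ?leq_addl // addnK.
    apply: leq_trans (_ : 'C(n.+1, n) <= _)%N; first by rewrite binSn.
    by apply: leq_bin2l; rewrite -addn1 leq_add2l.
  have lam1 : n%:R + 1 <= 8 * lambda ^+ 3 - 38 / 10 * lambda ^+ 2.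
    have -> : 8 * lambda ^+ 3 - 38 / 10 * lambda ^+ 2 = lambda * (8 * lambda ^+ 2 - 38 / 10 * lambda) by ring.
    have q1 : 1 <= 8 * lambda ^+ 2 - 38 / 10 * lambda by nra.
    apply: le_trans lam _; rewrite ler_peMr //; lra.
  set Q := 8 * _ - _ in lam1 *; apply: le_lt_trans ht _.
  (* The 2 is the lower bound for [ln delta + 2]. *)
  apply: (@lt_le_trans _ _ (n%:R * (n%:R + 1) * 2 * (H + 1))).
    have := mulr_ge0 (mulr_ge0 (ltW n0R) (ltW n0R)) H0; nra.
  rewrite ler_wpM2r ?addr_ge0 // ler_pM //; first by rewrite ler_wpM2l // ltW.
  by rewrite lerDr.
(* The factors are bounded below by [A n >= 1], [B n * delta^n >= 1 + n/2] and
   [ln (3 delta) + 2 >= 2]. *)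
move=> hd; have hB := B_power_ge hd; have hA := A_ge1 R (ltnW n2).
have ln3 : 0 <= ln (3 * delta%:R) :> R.
  by rewrite ln_ge0 // mulr_ege1 ?ler1n.
apply: le_lt_trans ht _; apply: (@lt_le_trans _ _ (8 * n%:R * (1 + n%:R / 2) * 2 * (H + 1))).
  have := mulr_ge0 (mulr_ge0 (ltW n0R) (ltW n0R)) H0; nra.
rewrite ler_wpM2r ?addr_ge0 // ler_pM ?lerDr //.
have -> : 8 * n%:R * A R n ^+ 2 * B R n * delta%:R ^+ n = 8 * n%:R * (A R n ^+ 2 * (B R n * delta%:R ^+ n)) by ring.
apply: ler_wpM2l; first by rewrite mulr_ge0 // ltW.
apply: (le_trans (hB)); rewrite ler_peMl ?exprn_ege1 //.
by apply: le_trans hB; rewrite addr_ge0 // divr_ge0 // ltW.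
Qed.
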